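(* Let $G$ be a homogeneous graph. Then $$\mathcal{B}=\Big\{(\alpha,\beta)\;:\;-\rho_u>\tfrac12\Big(\sum_{v\succeq u}n_v-1\Big)\ \text{for all } u\in T\Big\}.$$ More specifically, for $(\alpha,\beta)\in\mathcal{B}$ and $\theta\in Q_G$, the integral below converges and $$\int_{P_G}e^{-\langle \theta,y\rangle}H_G(\alpha,\beta;\varphi(y))\,\nu_G(dy)=\prod_{u\in T}\pi^{\frac12\sum_{v\prec u}n_un_v}\,|\theta_{[u]\cdot}|^{\rho_u}\,\Gamma_{n_u}\Big(-\rho_u-\sum_{v\succ u}\frac{n_v}{2}\Big)=H_G(\alpha,\beta;\theta)\prod_{u\in T}\pi^{\frac12\sum_{v\prec u}n_un_v}\,\Gamma_{n_u}\Big(-\rho_u-\sum_{v\succ u}\frac{n_v}{2}\Big).$$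
   Context: **Graphs.** $G=(V,E)$ is an undirected graph with $V=\{1,\dots,r\}$; $E\subset V\times V$ is symmetric and contains all $(i,i)$; $i\sim j$ means $i\ne j$, $(i,j)\in E$. $G$ is decomposable if it is connected and has no induced cycle of length $\ge4$. $G$ is homogeneous if it is decomposable and has no induced subgraph equal to the path on four vertices. A clique is a maximal complete subset of $V$; $\mathcal{C}$ is the set of cliques. A perfect order of the cliques is an order $(C_1,\dots,C_k)$ such that, with $S_j=(C_1\cup\dots\cup C_{j-1})\cap C_j$, for each $j\ge2$ there is $i<j$ with $S_j\subset C_i$; every decomposable graph has one. The sets $S_2,\dots,S_k$ are the minimal separators; $\mathcal{S}$ is the set of distinct ones and $\nu(S)$, the number of $j$ with $S_j=S$, does not depend on the perfect order. **Cones.** $I_G$ is the real space of functions $x:E\to\mathbb{R}$ with $x_{ij}=x_{ji}$ ($G$-incomplete symmetric matrices); $Z_G$ is the space of symmetric $r\times r$ matrices $y$ with $y_{ij}=0$ for $(i,j)\notin E$. $P_G=\{y\in Z_G: y \text{ positive definite}\}$; $Q_G=\{x\in I_G: x_C \text{ positive definite for every clique } C\}$, where $x_C=(x_{ij})_{i,j\in C}$. For $x\in Q_G$ there is a unique positive definite $\hat x$ with $\hat x_{ij}=x_{ij}$ for $(i,j)\in E$ and $\hat x^{-1}\in P_G$; the map $x\mapsto \hat x^{-1}$ is a bijection $Q_G\to P_G$ with inverse $\varphi$ (so $\varphi(y)$ is the restriction of $y^{-1}$ to the entries in $E$). $\langle x,y\rangle=\sum_{(i,j)\in E}x_{ij}y_{ij}$.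 $dy=\prod_{i\le j,(i,j)\in E}dy_{ij}$. $|\cdot|$ of a matrix is its determinant, of a set its cardinality. **Measures.** For $\alpha:\mathcal{C}\to\mathbb{R}$, $\beta:\mathcal{S}\to\mathbb{R}$ and $x\in Q_G$, $H_G(\alpha,\beta;x)=\prod_{C\in\mathcal{C}}|x_C|^{\alpha(C)}\big/\prod_{S\in\mathcal{S}}|x_S|^{\nu(S)\beta(S)}$. With $x=\varphi(y)$, $\nu_G(dy)=\prod_{C\in\mathcal{C}}|x_C|^{(|C|+1)/2}\prod_{S\in\mathcal{S}}|x_S|^{-\nu(S)(|S|+1)/2}\,\mathbf 1_{P_G}(y)\,dy$. $\mathcal{B}$ is the set of $(\alpha,\beta)$ such that $J(\alpha,\beta;x)=\int_{P_G}e^{-\langle x,y\rangle}H_G(\alpha,\beta;\varphi(y))\nu_G(dy)$ converges for all $x\in Q_G$ and $x\mapsto J(\alpha,\beta;x)/H_G(\alpha,\beta;x)$ is constant on $Q_G$. $\Gamma_n(p)=\pi^{n(n-1)/4}\prod_{j=1}^n\Gamma(p-\frac{j-1}{2})$ for $p>\frac{n-1}{2}$. **Hasse tree.** Write $nb(i)=\{j: j\sim i\}$ and $i\to j$ if $\{i\}\cup nb(i)\supseteq\{j\}\cup nb(j)$, a preorder on $V$. Let $T$ be the set of equivalence classes ($i,j$ equivalent iff $i\to j$ and $j\to i$) with the induced partial order $\bar i\preceq\bar j$ iff $i\to j$. For $G$ homogeneous, the Hasse diagram of $T$ is a rooted tree whose root is the minimum of $T$. For $u\in T$, $V_u=\bigcup_{v\preceq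 u}v$. The map $u\mapsto V_u$ is a bijection from endpoints of $T$ (vertices with no children, denoted $t$) to cliques, and from non-endpoints (denoted $q$) to minimal separators; put $\alpha_t=\alpha(V_t)$, $\beta_q=\beta(V_q)$, $\nu(q)=\nu(V_q)$ (equal to the number of children of $q$ minus one). $n_u$ is the number of elements of $V$ in the class $u$, and $\rho_u=\sum_{t:\,u\preceq t}\alpha_t-\sum_{q:\,u\preceq q}\nu(q)\beta_q$. **Blocks.** For $x\in Q_G$ and $u\in T$: $x_{[u]}=(x_{ij})_{\bar i=\bar j=u}$, $x_{[u>}=(x_{ij})_{\bar i=u,\bar j\prec u}$, $x_{<u]}=x_{[u>}^t$, $x_{<u>}=(x_{ij})_{\bar i\prec u,\bar j\prec u}$, $x_{[u]\cdot}=x_{[u]}-x_{[u>}x_{<u>}^{-1}x_{<u]}$ (with $x_{[u]\cdot}=x_{[u]}$ for the root). *)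

(* Defs.v *)
From HB Require Import structures.
From mathcomp Require Import all_boot all_order all_algebra.
From mathcomp Require Import all_classical all_reals all_analysis.

Set Implicit Arguments.
Unset Strict Implicit.
Unset Printing Implicit Defensive.
Import Order.TTheory GRing.Theory Num.Theory.
Import numFieldNormedType.Exports.

Section graph.
Context (r : nat) (E : rel 'I_r).
Local Notation V := 'I_r.
Local Open Scope nat_scope.
Local Open Scope set_scope.

(* [E] contains the diagonal, so only distinct vertices are compared. *)
Definition has_induced n (F : rel 'I_n) :=
  exists f : 'I_n -> V,
    injective f /\ forall a b, a != b -> E (f a) (f b) = F a b.

Definition path_rel n : rel 'I_n :=
  [rel a b : 'I_n | (b == a.+1 :> nat) || (a == b.+1 :> nat)].

Definition cycle_rel n : rel 'I_n :=
  [rel a b : 'I_n | (b == a.+1 %% n :> nat) || (a == b.+1 %% n :> nat)].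

Definition graph_connected := forall i j : V, connect E i j.

Definition decomposable :=
  graph_connected /\ forall n, 4 <= n -> ~ has_induced (@cycle_rel n).

Definition homogeneous := decomposable /\ ~ has_induced (@path_rel 4).

Definition complete_set (A : {set V}) := [forall i in A, forall j in A, E i j].

Definition cliques : {set {set V}} := [set C | maxset complete_set C].

(* Orders are indexed from 0, so S_j of the literature is [separator s j.-1]. *)
Definition separator (s : seq {set V}) (j : nat) : {set V} :=
  (\bigcup_(i < j) nth finset.set0 s i) :&: nth finset.set0 s j.

Definition perfect (s : seq {set V}) :=
  all (fun j => has (fun i => separator s j \subset nth finset.set0 s i)
                    (iota 0 j))
      (iota 1 (size s).-1).

(* Some perfect order of the cliques; a decomposable graph has one. *)
Definition perfect_order : seq {set V} :=
  if [pick s : #|cliques|.-tuple {set V} |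
       perm_eq s (enum cliques) && perfect s] is Some s then s else [::].

Definition separators : seq {set V} :=
  [seq separator perfect_order j | j <- iota 1 (size perfect_order).-1].

Definition nu (S : {set V}) : nat := count_mem S separators.

Definition clique := {C : {set V} | C \in cliques}.
Definition minsep := {S : {set V} | S \in separators}.
Definition edge := {p : V * V | E p.1 p.2}.
Definition upper_edge := {p : V * V | (p.1 <= p.2) && E p.1 p.2}.

Definition nb (i : V) : {set V} := [set j | (j != i) && E i j].

Definition arrow (i j : V) := (j |: nb j) \subset (i |: nb i).

Definition arrow_class (i : V) : {set V} := [set j | arrow i j && arrow j i].

(* The vertices of the Hasse tree, as a set of equivalence classes. *)
Definition classesT : {set {set V}} := [set arrow_class i | i : V].

Definition preceq (u v : {set V}) := [exists i in u, exists j in v, arrow i j].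
Definition prec (u v : {set V}) := preceq u v && (u != v).

Definition child (u v : {set V}) :=
  prec u v && ~~ [exists w in classesT, prec u w && prec w v].

Definition endpoint (u : {set V}) := ~~ [exists v in classesT, child u v].

Definition upto (u : {set V}) : {set V} := \bigcup_(v in classesT | preceq v u) v.
Definition below (u : {set V}) : {set V} := \bigcup_(v in classesT | prec v u) v.

End graph.

Local Open Scope classical_set_scope.
Local Open Scope ring_scope.

(* Lebesgue measure on R^n, as the n-fold product of the Lebesgue measure of R. *)
Section tuple_lebesgue.
Context (R : realType).

Definition cons_pair n (p : R * n.-tuple R) : n.+1.-tuple R :=
  [tuple of p.1 :: p.2].

Lemma measurable_cons_pair n :
  measurable_fun [set: R * n.-tuple R] (@cons_pair n).
Proof. exact: measurable_cons. Qed.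

Section step.
Context n (mu : {sigma_finite_measure set (n.-tuple R) -> \bar R}).

Definition lebesgue_cons : set (n.+1.-tuple R) -> \bar R :=
  pushforward (lebesgue_measure \x mu)%E (@cons_pair n).

Let lebesgue_cons0 : lebesgue_cons set0 = 0%E.
Proof. by rewrite /lebesgue_cons /pushforward preimage_set0 measure0. Qed.

Let lebesgue_cons_ge0 A : (0 <= lebesgue_cons A)%E.
Proof. by rewrite /lebesgue_cons /pushforward; exact: measure_ge0. Qed.

Let lebesgue_cons_sigma_additive : semi_sigma_additive lebesgue_cons.
Proof.
move=> F mF tF mUF; rewrite /lebesgue_cons /pushforward preimage_bigcup.
have mc := @measurable_cons_pair n.
apply: measure_semi_sigma_additive.
- by move=> k; rewrite -[X in measurable X]setTI; exact: mc.
- apply/trivIsetP => /= i j _ _ ij; rewrite -preimage_setI.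
  by move/trivIsetP : tF => /(_ _ _ _ _ ij) ->//; rewrite preimage_set0.
- by rewrite -preimage_bigcup -[X in measurable X]setTI; exact: mc.
Qed.

HB.instance Definition _ := isMeasure.Build _ _ _
  lebesgue_cons lebesgue_cons0 lebesgue_cons_ge0 lebesgue_cons_sigma_additive.

Let lebesgue_cons_sigma_finite : sigma_finite setT lebesgue_cons.
Proof.
have /sigma_finiteP[F1 [T1 nd1 fin1]] := sigma_finiteT (@lebesgue_measure R).
have /sigma_finiteP[F2 [T2 nd2 fin2]] := sigma_finiteT mu.
have mhead : measurable_fun [set: n.+1.-tuple R] (@thead n R).
  exact: measurable_tnth.
pose h := @thead n R; pose b := fun t : n.+1.-tuple R => [tuple of behead t].
have mb : measurable_fun [set: n.+1.-tuple R] b by exact: measurable_behead.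
exists (fun k => h @^-1` F1 k `&` b @^-1` F2 k).
  apply/seteqP; split=> // t _.
  have : [set: R] (h t) by [].
  rewrite T1 => -[i _ Fi].
  have : [set: n.-tuple R] (b t) by [].
  rewrite T2 => -[j _ Fj].
  exists (maxn i j) => //; split => /=.
    by move: Fi; exact/subsetPset/nd1/leq_maxl.
  by move: Fj; exact/subsetPset/nd2/leq_maxr.
move=> k; have [m1 l1] := fin1 k; have [m2 l2] := fin2 k; split.
  apply: measurableI; rewrite -[X in measurable X]setTI.
    exact: mhead.
  exact: mb.
rewrite /lebesgue_cons /pushforward.
have bE x t : b (cons_pair (x, t)) = t by apply/val_inj.
rewrite [X in (_ X < _)%E](_ : _ = F1 k `*` F2 k); last first.
  by apply/seteqP; split => -[x t] /=; rewrite bE /h /cons_pair /= theadE.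
by rewrite product_measure1E// lte_mul_pinfty// ge0_fin_numE.
Qed.

HB.instance Definition _ := Measure_isSigmaFinite.Build _ _ _ lebesgue_cons
  lebesgue_cons_sigma_finite.

End step.

Fixpoint lebesgue_tuple n : {sigma_finite_measure set (n.-tuple R) -> \bar R} :=
  if n is m.+1 then lebesgue_cons (lebesgue_tuple m) else \d_[tuple].

End tuple_lebesgue.

Section measures.
Context (R : realType).

Definition posdef n (A : 'M[R]_n) :=
  A^T = A /\ forall v : 'rV[R]_n, v != 0 -> 0 < (v *m A *m v^T) 0 0.

Definition Gamma (p : R) : R :=
  \int[@lebesgue_measure R]_(t in `]0, +oo[) (t `^ (p - 1) * expR (- t)).

Definition multi_Gamma (n : nat) (p : R) : R :=
  pi `^ ((n * n.-1)%:R / 4) * \prod_(j < n) Gamma (p - j%:R / 2).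

(* A function on a subtype, extended by 0. *)
Definition extend (X : Type) (P : pred X) (sX : subType P) (f : sX -> R)
  (x : X) : R := oapp f 0 (insub x).

Context (r : nat) (E : rel 'I_r).

Definition block (A B : {set 'I_r}) (x : 'M[R]_r) : 'M[R]_(#|A|, #|B|) :=
  \matrix_(i, j) x (enum_val i) (enum_val j).

(* The entries of an incomplete matrix, 0 standing for the missing ones; the
   blocks taken below lie within [E]. *)
Definition fill (x : edge E -> R) : 'M[R]_r :=
  \matrix_(i, j) extend x (i, j).

Definition IG : set (edge E -> R) := [set x | (fill x)^T = fill x].

Definition QG : set (edge E -> R) :=
  IG `&` [set x | forall C, C \in cliques E -> posdef (block C C (fill x))].

Definition ZG : set 'M[R]_r :=
  [set y | y^T = y /\ forall i j, ~~ E i j -> y i j = 0].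

Definition PG : set 'M[R]_r := ZG `&` [set y | posdef y].

Definition phi (y : 'M[R]_r) : edge E -> R :=
  fun e => invmx y (val e).1 (val e).2.

Definition pairing (x : edge E -> R) (y : 'M[R]_r) : R :=
  \sum_(e : edge E) x e * y (val e).1 (val e).2.

Definition H_G (a : clique E -> R) (b : minsep E -> R) (x : edge E -> R) : R :=
  (\prod_(C : clique E) \det (block (val C) (val C) (fill x)) `^ a C) /
  \prod_(S : minsep E)
    \det (block (val S) (val S) (fill x)) `^ ((nu E (val S))%:R * b S).

(* The density of nu_G with respect to dy. *)
Definition nuG_density (y : 'M[R]_r) : R :=
  (\prod_(C : clique E)
     \det (block (val C) (val C) (fill (phi y))) `^ (#|val C|.+1%:R / 2)) *
  \prod_(S : minsep E)
     \det (block (val S) (val S) (fill (phi y)))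
       `^ (- (nu E (val S))%:R * (#|val S|.+1%:R / 2)).

(* The element of Z_G with coordinates y_ij, i <= j, (i, j) in [E]. *)
Definition ZG_mx (t : #|{: upper_edge E}|.-tuple R) : 'M[R]_r :=
  \matrix_(i, j) extend (fun e : upper_edge E => tnth t (enum_rank e))
    (if (i <= j)%N then (i, j) else (j, i)).

Definition PG_coord : set (#|{: upper_edge E}|.-tuple R) := ZG_mx @^-1` PG.

Definition J_integrand a b (x : edge E -> R)
    (t : #|{: upper_edge E}|.-tuple R) : R :=
  let y := ZG_mx t in expR (- pairing x y) * H_G a b (phi y) * nuG_density y.

Definition J_converges a b (x : edge E -> R) : Prop :=
  (lebesgue_tuple R #|{: upper_edge E}|).-integrable PG_coord
    (EFin \o J_integrand a b x).

Definition J_G a b (x : edge E -> R) : R :=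
  \int[lebesgue_tuple R #|{: upper_edge E}|]_(t in PG_coord)
    J_integrand a b x t.

Definition calB : set ((clique E -> R) * (minsep E -> R)) :=
  [set ab | (forall x, QG x -> J_converges ab.1 ab.2 x) /\
    exists c : R, forall x, QG x -> J_G ab.1 ab.2 x / H_G ab.1 ab.2 x = c].

Definition rho (a : clique E -> R) (b : minsep E -> R) (u : {set 'I_r}) : R :=
  \sum_(t in classesT E | endpoint E t && preceq E u t) extend a (upto E t) -
  \sum_(q in classesT E | ~~ endpoint E q && preceq E u q)
     (nu E (upto E q))%:R * extend b (upto E q).

(* x_{[u].}; for the root, [below E u] is empty and the correction vanishes. *)
Definition schur (x : edge E -> R) (u : {set 'I_r}) : 'M[R]_#|u| :=
  let A := block u (below E u) (fill x) in
  block u u (fill x) -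
  A *m invmx (block (below E u) (below E u) (fill x)) *m A^T.

End measures.

(* Main.v *)
From HB Require Import structures.
Require Import Defs.
From mathcomp Require Import all_boot all_order all_algebra all_fingroup.
From mathcomp Require Import all_classical all_reals all_analysis.
From mathcomp Require Import measurable_realfun ring lra zify.

(** Order the vertices so that ancestors in the Hasse tree come first. Every
    [y] in [P_G] is [B^T D^-1 B] for a unique matrix [B] with diagonal [D] whose
    row [k] is supported on the ancestors of [k], because neighbours are
    comparable in the tree. On the entries of [B] the map to [y] is, up to
    triangular shears, the identity, so it preserves Lebesgue measure; the
    determinants of the blocks of [phi y] become products of the [1 / B_kk].
    A second unipotent change of variables [B = T L], with [L] the triangular
    matrix that diagonalises [theta] on each clique, turns [<theta, y>] into
    [sum_k sum_i d_i T_ki^2 / T_kk], where [d_i] is the Schur complement of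
    vertex [i] in [theta]. The integral is then a product of one-dimensional
    Gaussian and Gamma integrals, each with a value in (0, +oo], so it
    is finite exactly when every Gamma argument is positive. The exponents come
    from counting cliques and separators along a perfect order: the cliques
    that contain a complete set outnumber the separators that do by one. *)

Set Implicit Arguments.
Unset Strict Implicit.
Unset Printing Implicit Defensive.
Import Order.TTheory GRing.Theory Num.Theory.
Import numFieldNormedType.Exports.

Local Open Scope classical_set_scope.
Local Open Scope ring_scope.

(** * One-dimensional integrals *)

Section real_measurability.
Context {R : realType}.

(** Dividing by the diagonal of [B], where a Cholesky factor would take square roots, makes entry
    [(i, j)] of [B^T D^-1 B], for an ancestor [j] of [i], equal to [B i j] plus terms from strict
    descendants of [i]; no power of the diagonal enters as a Jacobian. The price is that
    [B k k != 0] is required, so integrals are compared off a null set. The work is done with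
    vertices, not with classes of the tree: equivalent vertices are ordered by index, every variable
    is a scalar, and the block quantities (determinants of Schur complements, values of
    [multi_Gamma], powers of [pi]) reappear only when the vertices of a class are multiplied
    together. The shifts by halves inside [multi_Gamma] come from the [0, 1, ..., n - 1] descendants
    that the vertices of a class have within it. Integrals of nonnegative functions are kept in the
    extended reals, so Tonelli applies before convergence is known. The zeros that fill the missing
    entries of [theta] are harmless, because each row of [T] is supported on a chain of pairwise
    adjacent vertices. *)

Lemma measurable_inv : measurable_fun [set: R] (@GRing.inv R).
Proof.
have mN : measurable_fun [set: R] (fun x : R => - (- x) `^ (-1)).
  refine (measurable_funN _).
  exact: (measurableT_comp (measurable_powR (-1)) (@oppr_measurable R setT)).
(* [powR] of a negative base does not give the inverse, so the sign is split off. *)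
rewrite (_ : @GRing.inv R = fun x => if 0 < x then x `^ (-1)
  else if x < 0 then - ((- x) `^ (-1)) else 0); last first.
  apply/funext => x; case: ltrgt0P => x0; first by rewrite powR_inv1// ltW.
    by rewrite powR_inv1 ?invrN ?opprK// oppr_ge0 ltW.
  by rewrite x0 invr0.
apply: measurable_fun_ifT; first exact: measurable_fun_ltr.
  exact: measurable_powR.
apply: measurable_fun_ifT => //; first exact: measurable_fun_ltr.
Qed.

Local Notation mu := (@lebesgue_measure R).

(** Lebesgue measure is [c] times its image under [x |-> c x + b], because the two agree on
    half-open intervals; the integral is then a pushforward. *)
Lemma ge0_integral_affine (f : R -> \bar R) (c b : R) : 0 < c ->
  measurable_fun setT f -> (forall x, 0 <= f x)%E ->
  (\int[mu]_x f (c * x + b)%R = (c^-1)%:E * \int[mu]_x f x)%E.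
Proof.
move=> c0 mf f0.
pose phi x : R := c * x + b.
have mphi : measurable_fun [set: measurableTypeR R] (phi : measurableTypeR R -> measurableTypeR R).
  by apply: measurable_funD => //; exact: measurable_funM.
have cV : 0 <= c by exact: ltW.
pose P : {measure set (measurableTypeR R) -> \bar R} :=
  measure_function_pushforward__canonical__measure_function_Measure mu mphi.
pose M : {measure set (measurableTypeR R) -> \bar R} := mscale (NngNum cV) P.
have E : forall A, measurable A -> mu A = M A.
  apply: lebesgue_measure_unique => _ [[x y] _ <-] /=.
  have -> : M `]x, y]%classic = (c%:E * mu `]((x - b) / c)%R, ((y - b) / c)%R]%classic)%E.
    rewrite /M /mscale /= /pushforward /=; congr (_ * mu _)%E.
    apply/seteqP; split => z /=; rewrite !in_itv/= /phi ltr_pdivrMr// ler_pdivlMr//.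
      by rewrite ltrBlDr lerBrDr mulrC.
    by rewrite ltrBlDr lerBrDr mulrC.
  rewrite !lebesgue_measure_itv /= !lte_fin ltr_pM2r ?invr_gt0// ltrD2r.
  case: ifPn => _; last by rewrite mule0.
  rewrite -!EFinD -EFinM; congr EFin; field; exact: lt0r_neq0.
rewrite [X in (_ = _ * X)%E](eq_measure_integral M); last by move=> A mA _; exact: E.
rewrite ge0_integral_mscale// muleA -EFinM mulVf ?mul1e ?lt0r_neq0//.
exact/esym/(ge0_integral_pushforward mphi lebesgue_measure measurableT).
Qed.

Section nonneg.
Variables f g : R -> R.
Hypotheses (mf : measurable_fun setT f) (f0 : forall x, 0 <= f x).
Hypotheses (mg : measurable_fun setT g) (g0 : forall x, 0 <= g x).

Lemma integral_EFinZ (k : R) : 0 <= k ->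
  (\int[mu]_x (k * f x)%:E = k%:E * \int[mu]_x (f x)%:E)%E.
Proof.
move=> k0; rewrite -(ge0_integralZl mu measurableT (f := EFin \o f))//.
- exact/measurable_EFinP.
- by move=> x _; rewrite lee_fin.
Qed.

Lemma integral_EFinD :
  (\int[mu]_x (f x + g x)%:E = \int[mu]_x (f x)%:E + \int[mu]_x (g x)%:E)%E.
Proof.
rewrite -(ge0_integralD mu measurableT (f1 := EFin \o f) (f2 := EFin \o g))//.
- by move=> x _; rewrite lee_fin.
- exact/measurable_EFinP.
- by move=> x _; rewrite lee_fin.
- exact/measurable_EFinP.
Qed.

Lemma integral_EFin_affine (c b : R) : 0 < c ->
  (\int[mu]_x (f (c * x + b)%R)%:E = (c^-1)%:E * \int[mu]_x (f x)%:E)%E.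
Proof.
move=> c0; apply: (ge0_integral_affine (f := EFin \o f)) => //.
exact/measurable_EFinP.
Qed.

Lemma le_integral_EFin : (forall x, f x <= g x) ->
  (\int[mu]_x (f x)%:E <= \int[mu]_x (g x)%:E)%E.
Proof.
move=> fg; apply: ge0_le_integral => //.
- by move=> x _; rewrite lee_fin.
- exact/measurable_EFinP.
- exact/measurable_EFinP.
- by move=> x _; rewrite lee_fin.
Qed.

End nonneg.

End real_measurability.

(** * Gaussian and Gamma integrals, finite or not *)

Section gamma_integral.
Context {R : realType}.
Local Notation mu := (@lebesgue_measure R).

Lemma pos_powRD (x r s : R) : 0 < x -> x `^ (r + s) = x `^ r * x `^ s.
Proof. by move=> x0; rewrite powRD// (gt_eqF x0) implybT. Qed.

Lemma integral_gauss_scaled (d a : R) : 0 < d -> 0 < a ->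
  (\int[mu]_x (expR (- (d * x ^+ 2 / a)))%:E = (Num.sqrt (pi * a / d))%:E)%E.
Proof.
move=> d0 a0.
have c0 : 0 < Num.sqrt (d / a) by rewrite sqrtr_gt0 divr_gt0.
transitivity (\int[mu]_x (gauss_fun (Num.sqrt (d / a) * x + 0))%:E)%E.
  apply: eq_integral => x _; rewrite /gauss_fun addr0 exprMn sqr_sqrtr ?divr_ge0 ?ltW//.
  by rewrite mulrAC.
rewrite (integral_EFin_affine measurable_gauss_fun (@gauss_fun_ge0 R) _ c0).
rewrite integralT_gauss -EFinM; congr EFin.
rewrite -sqrtrV ?divr_ge0 ?ltW// -sqrtrM ?invr_ge0 ?divr_ge0 ?ltW//; congr Num.sqrt.
by rewrite invf_div mulrC mulrA.
Qed.

Definition gammaf (p d x : R) : R :=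
  if 0 < x then x `^ (p - 1) * expR (- (d * x)) else 0.

Lemma gammaf_ge0 p d x : 0 <= gammaf p d x.
Proof. by rewrite /gammaf; case: ifP => // _; rewrite mulr_ge0 ?powR_ge0 ?expR_ge0. Qed.

Lemma measurable_gammaf p d : measurable_fun [set: R] (gammaf p d).
Proof.
apply: measurable_fun_ifT => //; first exact: measurable_fun_ltr.
apply: measurable_funM; first exact: measurable_powR.
apply: measurableT_comp => //; apply: measurableT_comp => //.
Qed.

Lemma integral_gammaf_scale p d : 0 < d ->
  (\int[mu]_x (gammaf p d x)%:E = (d `^ (- p))%:E * \int[mu]_x (gammaf p 1 x)%:E)%E.
Proof.
move=> d0.
transitivity (\int[mu]_x (d `^ (1 - p) * gammaf p 1 (d * x + 0))%:E)%E.
  apply: eq_integral => x _; congr EFin; rewrite /gammaf addr0 pmulr_rgt0//.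
  case: ifP => x0; last by rewrite mulr0.
  rewrite powRM ?ltW// mul1r !mulrA -pos_powRD//.
  by rewrite (_ : 1 - p + (p - 1) = 0) ?powRr0 ?mul1r//; ring.
transitivity ((d `^ (1 - p))%:E * \int[mu]_x (gammaf p 1 (d * x + 0))%:E)%E.
  apply: (@integral_EFinZ _ (fun x => gammaf p 1 (d * x + 0))).
  - apply: (measurableT_comp (measurable_gammaf p 1)).
    by apply: measurable_funD => //; exact: measurable_funM.
  - by move=> x; exact: gammaf_ge0.
  - exact: powR_ge0.
rewrite (integral_EFin_affine (measurable_gammaf p 1) (gammaf_ge0 p 1) _ d0).
rewrite muleA -EFinM; congr (_%:E * _)%E.
rewrite -powR_inv1 ?ltW// -pos_powRD//; congr powR; ring.
Qed.

(** Truncation of [x^s] used to compare the Gamma integrand near 0. *)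
Definition powind (s e x : R) : R := if (e < x) && (x <= 1) then x `^ s else 0.

Lemma powind_ge0 s e x : 0 <= powind s e x.
Proof. by rewrite /powind; case: ifP => // _; exact: powR_ge0. Qed.

Lemma measurable_powind s e : measurable_fun [set: R] (powind s e).
Proof.
apply: measurable_fun_ifT => //.
by apply: measurable_and; [exact: measurable_fun_ltr|exact: measurable_fun_ler].
Qed.

Local Notation I s e := (\int[mu]_x (powind s e x)%:E)%E.

(* With [e = 0] this self-similarity forces divergence for [s <= -1]; along
   [e = 2^-n] it gives a geometric bound for [s > -1]. *)
Lemma integral_powind_half s e : 0 <= e <= 1 ->
  I s (e / 2) = (I s 2^-1 + (2 `^ (- s) / 2)%:E * I s e)%E.
Proof.
move=> /andP[e0 e1].
have two : (0 : R) < 2 by [].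
have E x : powind s (e / 2) x = powind s 2^-1 x + 2 `^ (- s) * powind s e (2 * x + 0).
  rewrite /powind addr0 ltr_pdivrMr// [x * 2]mulrC.
  case: (ltP 2^-1 x) => x2 /=.
    rewrite (_ : e < 2 * x); last lra.
    rewrite (_ : (2 * x <= 1) = false); last by apply/negP; lra.
    by rewrite mulr0 addr0.
  rewrite (_ : x <= 1); last lra.
  rewrite (_ : 2 * x <= 1); last lra.
  rewrite add0r; case: ifP => ex //=; last by rewrite mulr0.
  rewrite powRM ?mulrA//; last lra.
  by rewrite -pos_powRD// addNr powRr0 mul1r.
have m2 : measurable_fun setT (fun x : R => powind s e (2 * x + 0)).
  apply: (measurableT_comp (measurable_powind s e)).
  by apply: measurable_funD => //; exact: measurable_funM.
transitivity (\int[mu]_x (powind s 2^-1 x + 2 `^ (- s) * powind s e (2 * x + 0))%:E)%E.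
  by apply: eq_integral => x _; rewrite E.
transitivity (I s 2^-1 + \int[mu]_x (2 `^ (- s) * powind s e (2 * x + 0))%:E)%E.
  apply: (@integral_EFinD _ (powind s 2^-1) (fun x => 2 `^ (- s) * powind s e (2 * x + 0))).
  - exact: measurable_powind.
  - exact: powind_ge0.
  - exact: measurable_funM.
  - by move=> x; rewrite mulr_ge0 ?powR_ge0 ?powind_ge0.
transitivity (I s 2^-1 + (2 `^ (- s))%:E * \int[mu]_x (powind s e (2 * x + 0))%:E)%E.
  congr (_ + _)%E; apply: (@integral_EFinZ _ (fun x => powind s e (2 * x + 0))) => //.
  by move=> x; exact: powind_ge0.
rewrite (integral_EFin_affine (measurable_powind s e) (powind_ge0 s e) _ two).
by rewrite muleA -EFinM.
Qed.

(** Here [|ln x| <= 2], from [ln y < y] at [y = 1 / x <= 2]. *)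
Lemma powR_bounds (s x : R) : 2^-1 < x <= 1 ->
  expR (- (2 * `|s|)) <= x `^ s <= expR (2 * `|s|).
Proof.
move=> /andP[x2 x1]; have x0 : 0 < x by lra.
have l1 : `|ln x| <= 2.
  rewrite ler0_norm ?ln_le0// -lnV ?posrE// (le_trans (ltW (ln_sublinear _))) ?invr_gt0//.
  by rewrite invf_ple ?posrE// ltW.
have l2 : `|s * ln x| <= 2 * `|s| by rewrite normrM mulrC ler_wpM2r.
rewrite /powR gt_eqF// !ler_expR; apply/andP; split.
  by rewrite lerNl (le_trans (ler_norm _))// normrN.
exact: le_trans (ler_norm _) l2.
Qed.

Lemma integral_indic_half : (\int[mu]_x (\1_(`]2^-1, 1]) x : R)%:E = (2^-1)%:E)%E.
Proof.
transitivity (mu [set` `]2^-1, (1 : R)]]).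
  by rewrite integral_indic// setIT.
rewrite lebesgue_measure_itv/= lte_fin ifT; last lra.
by rewrite -EFinB; congr EFin; lra.
Qed.

Lemma powind_halfE s x : powind s 2^-1 x = x `^ s * \1_(`]2^-1, 1]) x.
Proof.
rewrite /powind indicE; case: ifP => h.
  by rewrite mem_set ?mulr1//= in_itv.
by rewrite memNset ?mulr0//= in_itv/= h.
Qed.

Lemma measurable_indic_half : measurable_fun [set: R] (\1_(`]2^-1, 1]) : R -> R).
Proof. by apply: measurable_indic; exact: measurable_itv. Qed.

Lemma integral_powind_half_gt0 s : (0 < I s 2^-1)%E.
Proof.
apply: (@lt_le_trans _ _ ((expR (- (2 * `|s|)))%:E * (2^-1)%:E)%E).
  by rewrite -EFinM lte_fin mulr_gt0 ?expR_gt0.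
rewrite -integral_indic_half -(integral_EFinZ measurable_indic_half) ?expR_ge0//.
apply: le_integral_EFin.
- by apply: measurable_funM => //; exact: measurable_indic_half.
- by move=> x; rewrite mulr_ge0 ?expR_ge0.
- exact: measurable_powind.
- move=> x; rewrite powind_halfE indicE.
  have [|] := boolP (x \in _); last by rewrite !mulr0.
  by rewrite inE/= in_itv/= => /(powR_bounds s)/andP[h _]; rewrite !mulr1.
Qed.

Lemma integral_powind_half_lty s : (I s 2^-1 < +oo)%E.
Proof.
apply: (@le_lt_trans _ _ ((expR (2 * `|s|))%:E * (2^-1)%:E)%E); last first.
  by rewrite -EFinM ltry.
rewrite -integral_indic_half -(integral_EFinZ measurable_indic_half) ?expR_ge0//.
apply: le_integral_EFin.
- exact: measurable_powind.
- exact: powind_ge0.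
- by apply: measurable_funM => //; exact: measurable_indic_half.
- move=> x; rewrite powind_halfE indicE.
  have [|] := boolP (x \in _); last by rewrite !mulr0.
  by rewrite inE/= in_itv/= => /(powR_bounds s)/andP[_ h]; rewrite !mulr1.
Qed.

Lemma integral_powind_ge0 s e : (0 <= I s e)%E.
Proof. by apply: integral_ge0 => x _; rewrite lee_fin powind_ge0. Qed.

(** A finite value [a] would satisfy [a = b + q a] with [b > 0] and [q >= 1]. *)
Lemma integral_powindy s : s <= -1 -> I s 0 = +oo%E.
Proof.
move=> s1; have /= := @integral_powind_half s 0; rewrite mul0r lexx ler01 => /(_ isT) E.
have q1 : 1 <= 2 `^ (- s) / 2 :> R.
  by rewrite ler_pdivlMr// mul1r -[leLHS]powRr1// ler_powR; lra.
case: (ltP (I s 0) +oo%E) => [Afin|]; last by rewrite leye_eq => /eqP.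
have := integral_powind_half_gt0 s; have := integral_powind_ge0 s 0.
have := integral_powind_half_lty s.
move: E Afin; case: (I s 0) => [a||]//; case: (I s 2^-1) => [b||]// [E] _ _.
rewrite lee_fin lte_fin => a0 b0.
have : a <= 2 `^ (- s) / 2 * a by rewrite ler_peMl.
by move=> h; exfalso; lra.
Qed.

(** With [q = 2^(-s) / 2 < 1], the bound [B / (1 - q)] is the fixed point of the recursion
    [z |-> B + q z] that the truncated integrals obey. *)
Lemma integral_powind_exp s n : -1 < s ->
  (I s (2^-1 ^+ n) <= I s 2^-1 * ((1 - 2 `^ (- s) / 2)^-1)%:E)%E.
Proof.
move=> s1.
have q1 : 2 `^ (- s) / 2 < 1 :> R.
  rewrite ltr_pdivrMr// mul1r -[ltRHS]powRr1// /powR pnatr_eq0/= ltr_expR.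
  by rewrite ltr_pM2r ?ln_gt0//; lra.
have q0 : 0 < 2 `^ (- s) / 2 :> R by rewrite divr_gt0// powR_gt0.
set q := 2 `^ (- s) / 2 in q1 q0 *.
have := integral_powind_half_gt0 s; have := integral_powind_half_lty s.
elim: n => [|n]; move BE: (I s 2^-1) => B.
  move=> _ B0; rewrite expr0 (_ : I s 1 = 0)%E.
    by apply: mule_ge0; [exact: ltW|rewrite lee_fin invr_ge0 subr_ge0 ltW].
  apply: integral0_eq => x _; rewrite /powind; case: ifP => //.
  by case: ltP => //= x1 x1'; move: (lt_le_trans x1 x1'); rewrite ltxx.
move=> IH Bfin B0; rewrite exprSr integral_powind_half; last first.
  by rewrite exprn_ge0 ?exprn_ile1//; lra.
rewrite BE -/q; have := IH Bfin B0 => {}IH.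
apply: (@le_trans _ _ (B + q%:E * (B * ((1 - q)^-1)%:E))%E).
  by rewrite leeD2l// lee_pmul2l ?lte_fin.
case: B Bfin B0 {IH BE} => [b||]// _ _.
rewrite -!EFinM -EFinD lee_fin le_eqVlt; apply/orP; left; apply/eqP; field.
by rewrite gt_eqF// subr_gt0.
Qed.

Lemma integral_powind_lty s : -1 < s -> (I s 0 < +oo)%E.
Proof.
move=> s1; have hB := integral_powind_exp _ s1.
have nd x : {homo (fun n => (powind s (2^-1 ^+ n) x)%:E) : n m / (n <= m)%N >-> (n <= m)%E}.
  move=> n m nm; rewrite lee_fin /powind.
  case: ifP => [/andP[h ->]|_]; last by case: ifP => // _; exact: powR_ge0.
  rewrite ifT// andbT (le_lt_trans _ h)// ler_wiXn2l//; lra.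
have MC := @monotone_convergence _ _ _ mu setT measurableT
  (fun n x => (powind s (2^-1 ^+ n) x)%:E).
have -> : (I s 0 = \int[mu]_x limn (fun n => (powind s (2^-1 ^+ n) x)%:E))%E.
  apply: eq_integral => x _; apply/esym/cvg_lim => //.
  apply: cvg_near_cst; have [x0|x0] := ltP 0 x.
    near=> n; rewrite /powind x0 (_ : 2^-1 ^+ n < x)//.
    near: n; have := near_infty_natSinv_expn_lt (PosNum x0).
    by apply: filterS => n; rewrite /= div1r exprVn.
  apply: nearW => n; rewrite /powind !ifF//; first by rewrite ltNge x0.
  by apply/negbTE; rewrite negb_and -leNgt (le_trans x0) ?exprn_ge0.
rewrite MC.
- apply: (@le_lt_trans _ _ (I s 2^-1 * ((1 - 2 `^ (- s) / 2)^-1)%:E)%E).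
    apply: lime_le; last exact: nearW.
    apply: ereal_nondecreasing_is_cvgn => n m nm.
    apply: le_integral_EFin.
    + exact: measurable_powind.
    + exact: powind_ge0.
    + exact: measurable_powind.
    + by move=> x; have := nd x n m nm; rewrite lee_fin.
  have := integral_powind_half_lty s; have := integral_powind_half_gt0 s.
  by case: (I s 2^-1) => [b||]// _ _; rewrite -EFinM ltry.
- by move=> n; apply/measurable_EFinP; exact: measurable_powind.
- by move=> n x _; rewrite lee_fin powind_ge0.
- by move=> x _; exact: nd.
Unshelve. all: by end_near. Qed.

Local Notation G p := (\int[mu]_x (gammaf p 1 x)%:E)%E.

Lemma integral_gammaf_gt0 p : (0 < G p)%E.
Proof.
apply: (@lt_le_trans _ _ ((expR (-1))%:E * I (p - 1) 2^-1)%E).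
  by rewrite mule_gt0 ?integral_powind_half_gt0// lte_fin expR_gt0.
rewrite -(integral_EFinZ (measurable_powind _ _) (powind_ge0 _ _)) ?expR_ge0//.
apply: le_integral_EFin.
- by apply: measurable_funM => //; exact: measurable_powind.
- by move=> x; rewrite mulr_ge0 ?expR_ge0 ?powind_ge0.
- exact: measurable_gammaf.
- move=> x; rewrite /powind /gammaf; case: ifP => [/andP[x0 x1]|_].
    rewrite ifT; last by apply: lt_trans x0.
    by rewrite mulrC ler_wpM2l ?powR_ge0// ler_expR; lra.
  by rewrite mulr0; exact: gammaf_ge0.
Qed.

(** On []0, 1]] the exponential is at least [expR (-1)], so the integral dominates a multiple of
    that of [x^(p - 1)], which diverges. *)
Lemma integral_gammafy p : p <= 0 -> G p = +oo%E.
Proof.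
move=> p0; apply/eqP; rewrite -leye_eq.
have -> : (+oo = (expR (-1))%:E * I (p - 1) 0 :> \bar R)%E.
  by rewrite integral_powindy ?gt0_muley ?lte_fin ?expR_gt0//; lra.
rewrite -(integral_EFinZ (measurable_powind _ _) (powind_ge0 _ _)) ?expR_ge0//.
apply: le_integral_EFin.
- by apply: measurable_funM => //; exact: measurable_powind.
- by move=> x; rewrite mulr_ge0 ?expR_ge0 ?powind_ge0.
- exact: measurable_gammaf.
- move=> x; rewrite /powind /gammaf; case: ifP => [/andP[x0 x1]|_].
    by rewrite x0 mulrC ler_wpM2l ?powR_ge0// ler_expR; lra.
  by rewrite mulr0; exact: gammaf_ge0.
Qed.

(** [ln y < y] at [y = x / K] gives [ln x <= x / K + ln K]; the choice [K = 2|s| + 1] makes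
    [|s| / K] at most 1/2, and the constant is [K^|s|]. *)
Lemma powR_le_expR_half (s : R) : exists2 C : R, 0 <= C &
  forall x, 1 <= x -> x `^ s <= C * expR (2^-1 * x).
Proof.
pose K := 2 * `|s| + 1; have K0 : 0 < K by rewrite /K; have := normr_ge0 s; lra.
exists (expR (`|s| * ln K)) => [|x x1]; first exact: expR_ge0.
have x0 : 0 < x by lra.
rewrite /powR gt_eqF// -expRD ler_expR.
have lx : ln x <= x / K + ln K.
  rewrite -lerBlDr -ln_div ?posrE//; apply/ltW/ln_sublinear; exact: divr_gt0.
apply: (@le_trans _ _ (`|s| * ln x)); first by rewrite ler_wpM2r ?ln_ge0 ?ler_norm.
apply: (@le_trans _ _ (`|s| * (x / K + ln K))); first by rewrite ler_wpM2l.
rewrite mulrDr [leLHS]addrC lerD2l mulrA ler_pdivrMr// /K; nra.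
Qed.

Lemma integral_gammaf_lty p : 0 < p -> (G p < +oo)%E.
Proof.
move=> p0; have [C C0 hC] := powR_le_expR_half (p - 1).
(* The exponential density of rate 1/2 carries a factor 1/2, which the 2 cancels: the tail bound is
   [C exp(-x/2)]. *)
pose g x : R := powind (p - 1) 0 x + 2 * C * exponential_pdf 2^-1 x.
have me : measurable_fun setT (fun x : R => 2 * C * exponential_pdf 2^-1 x).
  by apply: measurable_funM => //; exact: measurable_exponential_pdf.
have e0 (x : R) : 0 <= exponential_pdf 2^-1 x by exact: exponential_pdf_ge0.
have ce0 (x : R) : 0 <= 2 * C * exponential_pdf 2^-1 x by rewrite !mulr_ge0.
apply: (@le_lt_trans _ _ (\int[mu]_x (g x)%:E)%E).
  apply: le_integral_EFin.
  - exact: measurable_gammaf.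
  - exact: gammaf_ge0.
  - by apply: measurable_funD => //; exact: measurable_powind.
  - move=> x; rewrite /g /gammaf; case: ifP => x0; last by rewrite addr_ge0 ?powind_ge0.
    rewrite /powind x0 /=; case: ifP => x1.
      rewrite -[leLHS]addr0 lerD// ler_piMr ?powR_ge0// expR_le1 mul1r; lra.
    rewrite add0r exponential_pdfE ?(ltW x0)//.
    have x1' : 1 <= x by rewrite ltW// ltNge x1.
    rewrite (_ : 2 * C * _ = C * expR (2^-1 * x) * expR (- (1 * x))); last first.
      rewrite -[in RHS]mulrA -expRD (_ : 2^-1 * x + - (1 * x) = - 2^-1 * x); last lra.
      rewrite -!mulrA; by field.
    by rewrite ler_wpM2r ?expR_ge0// hC.
rewrite (integral_EFinD (measurable_powind _ _) (powind_ge0 _ _) me ce0).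
rewrite (integral_EFinZ (@measurable_exponential_pdf R 2^-1) e0) ?mulr_ge0//.
rewrite integral_exponential_pdf// mule1.
by rewrite lte_add_pinfty ?ltry ?integral_powind_lty//; lra.
Qed.

(** [Gamma] is [fine] of an extended integral, so the identity rests on finiteness. *)
Lemma GammaE p : 0 < p -> G p = (Gamma p)%:E.
Proof.
move=> p0.
have E : G p = (\int[mu]_(x in `]0%R, +oo[) (x `^ (p - 1) * expR (- x))%:E)%E.
  rewrite [RHS]integral_mkcond; apply: eq_integral => x _.
  rewrite /gammaf patchE; case: ifPn => x0.
    by rewrite mem_set ?mul1r//= in_itv/= x0.
  by rewrite memNset//= in_itv/= andbT; exact/negP.
rewrite /Gamma /Rintegral -E fineK// ge0_fin_numE ?integral_gammaf_lty//.
exact: ltW (integral_gammaf_gt0 _).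
Qed.

End gamma_integral.

(** * Iterated Lebesgue integrals and shears *)

(* Locked, lest the trivial tactics try to compute with tuples. *)
HB.lock Definition upd (R : realType) n (i : 'I_n) (a : R) (t : n.-tuple R) : n.-tuple R :=
  [tuple if j == i then a else tnth t j | j < n].
Arguments upd {R n}.

Section iterated_integral.
Context {R : realType} {n : nat}.
Local Notation mu := (@lebesgue_measure R).
Implicit Types (t : n.-tuple R) (F G : n.-tuple R -> \bar R) (i j : 'I_n).

Lemma tnth_upd i a t j : tnth (upd i a t) j = if j == i then a else tnth t j.
Proof. by rewrite upd.unlock tnth_mktuple. Qed.

Lemma upd_upd i a b t : upd i a (upd i b t) = upd i a t.
Proof. by apply: eq_from_tnth => k; rewrite !tnth_upd; case: eqP. Qed.

Lemma updC i j a b t : i != j -> upd i a (upd j b t) = upd j b (upd i a t).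
Proof.
move=> ij; apply: eq_from_tnth => k; rewrite !tnth_upd.
by case: eqP => // ->; rewrite (negbTE ij).
Qed.

Lemma measurable_upd d (T : measurableType d) i (f : T -> R) (g : T -> n.-tuple R) :
  measurable_fun setT f -> measurable_fun setT g ->
  measurable_fun setT (fun x => upd i (f x) (g x)).
Proof.
move=> mf mg; apply/measurable_fun_tnthP => j /=.
rewrite (_ : _ \o _ = fun x => if j == i then f x else tnth (g x) j); last first.
  by apply/funext => x /=; rewrite tnth_upd.
case: eqP => // _.
exact: (measurableT_comp (measurable_tnth j) mg).
Qed.

(** The result stays a function of the whole tuple, constant in coordinate [i], so integrals over
    different coordinates compose and commute. *)
Definition int1 i F t : \bar R := (\int[mu]_a F (upd i a t))%E.

Lemma int1_ge0 i F : (forall t, 0 <= F t)%E -> forall t, (0 <= int1 i F t)%E.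
Proof. by move=> F0 t; apply: integral_ge0. Qed.

Lemma measurable_int1 i F : measurable_fun setT F -> (forall t, 0 <= F t)%E ->
  measurable_fun setT (int1 i F).
Proof.
move=> mF F0.
apply: (@measurable_fun_fubini_tonelli_F _ _ _ _ _ mu
  (fun p : n.-tuple R * R => F (upd i p.2 p.1))) => //.
apply: (measurableT_comp mF); apply: measurable_upd; first exact: measurable_snd.
exact: measurable_fst.
Qed.

Lemma int1C i j F : measurable_fun setT F -> (forall t, 0 <= F t)%E ->
  int1 i (int1 j F) = int1 j (int1 i F).
Proof.
move=> mF F0; have [->//|ij] := eqVneq i j; apply/funext => t.
pose f (p : R * R) := F (upd j p.2 (upd i p.1 t)).
have mf : measurable_fun setT f.
  apply: (measurableT_comp mF); apply: measurable_upd; first exact: measurable_snd.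
  apply: measurable_upd; first exact: measurable_fst.
  exact: measurable_cst.
have f0 p : (0 <= f p)%E by exact: F0.
have E := @fubini_tonelli _ _ (measurableTypeR R) (measurableTypeR R) R mu mu f mf f0.
rewrite [LHS]E; apply: eq_integral => b _; apply: eq_integral => a _.
rewrite /f /= updC; [by []|by rewrite eq_sym].
Qed.

Definition iint (s : seq 'I_n) F := foldr int1 F s.

Lemma iint_ge0 s F : (forall t, 0 <= F t)%E -> forall t, (0 <= iint s F t)%E.
Proof. by move=> F0; elim: s => //= i s IH t; exact: int1_ge0. Qed.

Lemma measurable_iint s F : measurable_fun setT F -> (forall t, 0 <= F t)%E ->
  measurable_fun setT (iint s F).
Proof.
move=> mF F0; elim: s => //= i s IH; apply: measurable_int1 => //.
exact: iint_ge0.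
Qed.

Lemma iint_cat s1 s2 F : iint (s1 ++ s2) F = iint s1 (iint s2 F).
Proof. exact: foldr_cat. Qed.

Lemma iint_int1C s i F : measurable_fun setT F -> (forall t, 0 <= F t)%E ->
  iint s (int1 i F) = int1 i (iint s F).
Proof.
move=> mF F0; elim: s => //= j s ->; rewrite int1C//; first exact: measurable_iint.
exact: iint_ge0.
Qed.

Lemma iint_perm s1 s2 F : measurable_fun setT F -> (forall t, 0 <= F t)%E ->
  perm_eq s1 s2 -> iint s1 F = iint s2 F.
Proof.
move=> mF F0; elim: s1 s2 => [s2|i s1 IH s2].
  by rewrite perm_sym => /perm_nilP ->.
move=> s12; have := mem_head i s1; rewrite (perm_mem s12) => /path.splitPr sp.
case: sp s12 => {}s2 s3 s12.
have /IH E : perm_eq s1 (s2 ++ s3).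
  by rewrite -(perm_cons i) (perm_trans s12)// perm_catC /= perm_cons perm_catC.
rewrite /= E iint_cat iint_cat /= iint_int1C//; first exact: measurable_iint.
exact: iint_ge0.
Qed.

Lemma eq_iintr s F G : F =1 G -> iint s F =1 iint s G.
Proof. by move=> /funext ->. Qed.

End iterated_integral.

Section lebesgue_tuple_iterated.
Context {R : realType}.
Local Notation mu := (@lebesgue_measure R).

Lemma iint_lift n (s : seq 'I_n) (F : n.+1.-tuple R -> \bar R) t :
  iint (map (lift ord0) s) F t =
  iint s (fun t' => F [tuple of thead t :: t']) [tuple of behead t].
Proof.
elim: s t => [|i s IH] t /=; first by rewrite -tuple_eta.
apply: eq_integral => a _; rewrite IH /thead tnth_upd /=.
congr (iint s _ _); apply: eq_from_tnth => j.
have B (u : n.+1.-tuple R) : tnth [tuple of behead u] j = tnth u (lift ord0 j).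
  by rewrite tnth_behead; congr tnth; apply/val_inj; rewrite /= inordK// ltnS.
by rewrite B !tnth_upd B (inj_eq lift_inj).
Qed.

(** The tuple [t] is arbitrary: each of its coordinates is overwritten. *)
Lemma integral_lebesgue_tuple n (F : n.-tuple R -> \bar R) t :
  measurable_fun setT F -> (forall t, 0 <= F t)%E ->
  (\int[lebesgue_tuple R n]_x F x)%E = iint (enum 'I_n) F t.
Proof.
elim: n F t => [|n IH] F t mF F0.
  rewrite integral_dirac// diracT mul1e.
  by rewrite (_ : enum _ = [::]) /= ?(tuple0 t)//; apply/size0nil; rewrite size_enum_ord.
pose c : measurableTypeR R * n.-tuple R -> n.+1.-tuple R := @cons_pair R n.
have mc : measurable_fun setT c := @measurable_cons_pair R n.
have E := @ge0_integral_pushforward _ _ (measurableTypeR R * n.-tuple R)%type _ R c mc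
  (lebesgue_measure \x lebesgue_tuple R n)%E setT F measurableT mF (fun y _ => F0 y).
rewrite preimage_setT in E.
have -> : (\int[lebesgue_tuple R n.+1]_x F x =
  \int[pushforward (lebesgue_measure \x lebesgue_tuple R n) c]_x F x)%E by exact: erefl.
rewrite {}E.
rewrite fubini_tonelli1//=; last exact: (measurableT_comp mF).
rewrite enum_ordSl /=.
apply: eq_integral => a _; rewrite iint_lift.
rewrite (_ : thead _ = a); last by rewrite /thead tnth_upd.
rewrite -IH//; apply: (measurableT_comp mF).
exact: measurable_cons.
Qed.

End lebesgue_tuple_iterated.

(** * Unipotent changes of variables *)

Section shear.
Context {R : realType} {n : nat}.
Local Notation mu := (@lebesgue_measure R).
Implicit Types (t : n.-tuple R) (F G : n.-tuple R -> \bar R) (i j : 'I_n).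

Definition shear1 (g : 'I_n -> n.-tuple R -> R) i t := upd i (tnth t i + g i t) t.

Definition shear (g : 'I_n -> n.-tuple R -> R) t : n.-tuple R :=
  [tuple tnth t i + g i t | i < n].

Lemma tnth_shear g t i : tnth (shear g t) i = tnth t i + g i t.
Proof. by rewrite tnth_mktuple. Qed.

Variables (g : 'I_n -> n.-tuple R -> R) (rk : 'I_n -> nat).
Hypothesis mg : forall i, measurable_fun setT (g i).
Hypothesis g_rk : forall i t t',
  (forall j, (rk i < rk j)%N -> tnth t j = tnth t' j) -> g i t = g i t'.

Lemma measurable_shear1 i : measurable_fun setT (shear1 g i).
Proof.
apply: measurable_upd => //; apply: measurable_funD => //.
exact: measurable_tnth.
Qed.

(** [g i] reads only coordinates of rank above that of [i], so along coordinate [i] the shear is a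
    translation. *)
Lemma int1_shear1 i F t : measurable_fun setT F -> (forall t, 0 <= F t)%E ->
  int1 i (F \o shear1 g i) t = int1 i F t.
Proof.
move=> mF F0; rewrite /int1.
have gE a : g i (upd i a t) = g i t.
  by apply: g_rk => j ij; rewrite tnth_upd; case: eqP ij => // ->; rewrite ltnn.
rewrite -[RHS]mul1e -[1%E]/(1%R%:E) -[1%R]invr1.
rewrite -(@ge0_integral_affine _ (fun a => F (upd i a t)) 1 (g i t))//.
  by apply: eq_integral => a _; rewrite /= /shear1 upd_upd tnth_upd eqxx gE mul1r.
by apply: (measurableT_comp mF); apply: measurable_upd.
Qed.

Lemma iint_shear1 i F : measurable_fun setT F -> (forall t, 0 <= F t)%E ->
  iint (enum 'I_n) (F \o shear1 g i) = iint (enum 'I_n) F.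
Proof.
move=> mF F0.
(* Tonelli makes coordinate [i] the innermost one. *)
have P : perm_eq (enum 'I_n) (rem i (enum 'I_n) ++ [:: i]).
  by rewrite perm_sym perm_catC /= perm_sym perm_to_rem// mem_enum.
have mS : measurable_fun setT (F \o shear1 g i).
  by apply: (measurableT_comp mF); exact: measurable_shear1.
have mS0 u : (0 <= (F \o shear1 g i) u)%E by exact: F0.
rewrite [LHS](iint_perm mS mS0 P) [RHS](iint_perm mF F0 P) !iint_cat /=.
by congr (iint _ _); apply/funext => t; exact: int1_shear1.
Qed.

Lemma foldl_shear1 s t : uniq s -> sorted (fun i j => rk i <= rk j)%N s ->
  forall j, tnth (foldl (fun u i => shear1 g i u) t s) j =
            tnth t j + (if j \in s then g j t else 0).
Proof.
elim: s t => [|i s IH] t /=; first by move=> *; rewrite addr0.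
move=> /andP[i_s us] ps j; rewrite IH//; last exact: path_sorted ps.
have /allP m : all (fun j => rk i <= rk j)%N s.
  by apply: order_path_min ps => x y z; exact: leq_trans.
rewrite inE /shear1 tnth_upd; case: eqVneq => [->|ji] /=.
  by rewrite (negbTE i_s) addr0.
(* The rank of the head [i] is at most that of [j], so [g j] does not see the change at [i]. *)
case: ifP => // js; congr (_ + _); apply: g_rk => k jk.
by rewrite tnth_upd; case: eqP jk => // ->; rewrite ltnNge m.
Qed.

(* Shearing the coordinates one by one, lowest rank first, never changes a
   coordinate that is still to be used. *)
Lemma iint_shear F : measurable_fun setT F -> (forall t, 0 <= F t)%E ->
  iint (enum 'I_n) (F \o shear g) = iint (enum 'I_n) F.
Proof.
move=> mF F0.
pose s := sort (fun i j => rk i <= rk j)%N (enum 'I_n).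
have -> : shear g = fun t => foldl (fun u i => shear1 g i u) t s.
  apply/funext => t; apply: eq_from_tnth => j; rewrite tnth_shear foldl_shear1.
  - by rewrite mem_sort mem_enum.
  - by rewrite sort_uniq enum_uniq.
  - by apply: sort_sorted => i k; exact: leq_total.
elim: s => [//|i s IH]; rewrite -[RHS]IH.
apply: (@iint_shear1 i (F \o (fun t => foldl (fun u i => shear1 g i u) t s))); last first.
  by move=> t; exact: F0.
apply: (measurableT_comp mF).
elim: s {IH} => [|j s IH] /=; first exact: measurable_id.
exact: (measurableT_comp IH (measurable_shear1 j)).
Qed.

Lemma measurable_shear : measurable_fun setT (shear g).
Proof.
apply/measurable_fun_tnthP => j /=.
rewrite (_ : _ \o _ = fun t => tnth t j + g j t); last first.
  by apply/funext => t /=; rewrite tnth_shear.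
by apply: measurable_funD => //; exact: measurable_tnth.
Qed.

End shear.

Section product.
Context {R : realType} {n : nat}.
Local Notation mu := (@lebesgue_measure R).
Local Open Scope ereal_scope.
Implicit Types (t : n.-tuple R).

(** Apart from its own variable, a factor depends only on coordinates outside [s], hence is constant
    while the other variables of [s] are integrated. [G] is general so that the induction can absorb
    the factor of the head. *)
Lemma iint_prod (s : seq 'I_n) (h : 'I_n -> R -> n.-tuple R -> \bar R)
    (G : n.-tuple R -> \bar R) t : uniq s ->
  (forall i a t, 0 <= h i a t) -> (forall t, 0 <= G t) ->
  (forall i t, measurable_fun setT (fun a => h i a t)) ->
  (forall i a t t', (forall j, j \notin s -> tnth t j = tnth t' j) -> h i a t = h i a t') ->
  (forall t t', (forall j, j \notin s -> tnth t j = tnth t' j) -> G t = G t') ->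
  iint s (fun t => G t * \prod_(i <- s) h i (tnth t i) t) t =
  G t * \prod_(i <- s) \int[mu]_a h i a t.
Proof.
move=> + h0 + mh; elim: s G t => [|i s IH] G t /=; first by rewrite !big_nil.
move=> /andP[i_s us] G0 hs Gs.
have sub (t1 t2 : n.-tuple R) : (forall j, j \notin s -> tnth t1 j = tnth t2 j) ->
    forall j, j \notin i :: s -> tnth t1 j = tnth t2 j.
  by move=> t12 j; rewrite inE negb_or => /andP[_]; exact: t12.
have hupd j b t0 a : h j a (upd i b t0) = h j a t0.
  by apply: hs => k; rewrite inE negb_or tnth_upd => /andP[/negbTE ->].
have Gupd b t0 : G (upd i b t0) = G t0.
  by apply: Gs => k; rewrite inE negb_or tnth_upd => /andP[/negbTE ->].
transitivity (\int[mu]_a ((G t * \prod_(j <- s) \int[mu]_b h j b t) * h i a t)).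
  apply: eq_integral => a _.
  under eq_iintr => u do rewrite big_cons muleA.
  rewrite (IH (fun u => G u * h i (tnth u i) u))//.
  - rewrite tnth_upd eqxx Gupd hupd [RHS]muleAC; congr (_ * _ * _).
    by apply: eq_bigr => j _; apply: eq_integral => b _; rewrite hupd.
  - by move=> u; exact: mule_ge0.
  - by move=> j b u u' uu'; apply: hs => k ks; exact: sub.
  - move=> u u' uu'; congr (_ * _); first by apply: Gs => k ks; exact: sub.
    rewrite uu'//; apply: hs => k ks; exact: sub.
rewrite ge0_integralZl//.
- by rewrite big_cons -muleA; congr (_ * _); rewrite muleC.
- exact: mh.
- by apply: mule_ge0 => //; apply: prode_ge0 => j _; exact: integral_ge0.
Qed.

End product.

Section nonzero_coordinates.
Context {R : realType} {n : nat}.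
Local Notation mu := (@lebesgue_measure R).
Implicit Types (F G : n.-tuple R -> \bar R) (i : 'I_n) (s : seq 'I_n).

(** Coordinate hyperplanes are null, so integrals do not change; this confines attention to tuples
    where the diagonal entries can be inverted. *)
Definition on_nonzero s F (t : n.-tuple R) : \bar R :=
  if all (fun i => tnth t i != 0) s then F t else 0%E.

Lemma on_nonzero_ge0 s F : (forall t, 0 <= F t)%E -> forall t, (0 <= on_nonzero s F t)%E.
Proof. by move=> F0 t; rewrite /on_nonzero; case: ifP. Qed.

Lemma measurable_on_nonzero s F : measurable_fun setT F ->
  measurable_fun setT (on_nonzero s F).
Proof.
move=> mF; apply: measurable_fun_ifT => //.
elim: s => [|i s IH] /=; first exact: measurable_cst.
apply: measurable_and => //; apply: measurable_neg; apply: measurable_fun_eqr.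
  exact: measurable_tnth.
exact: measurable_cst.
Qed.

Lemma int1_nonzero i F : measurable_fun setT F -> int1 i (on_nonzero [:: i] F) = int1 i F.
Proof.
move=> mF; apply/funext => t; rewrite /int1.
have mu0 : mu [set (0 : R)] = 0 by rewrite lebesgue_measure_set1.
have mFi : measurable_fun setT (fun a : R => F (upd i a t)).
  by apply: (measurableT_comp mF); apply: measurable_upd.
apply: ae_eq_integral => //.
- by apply: (measurableT_comp (measurable_on_nonzero [:: i] mF)); apply: measurable_upd.
- exists [set (0 : R)]; split=> //.
  move=> a /= h; apply: contrapT => /eqP a0; apply: h => _.
  by rewrite /on_nonzero /= tnth_upd eqxx a0.
Qed.

Lemma iint_nonzero s F : measurable_fun setT F -> (forall t, 0 <= F t)%E ->
  iint (enum 'I_n) (on_nonzero s F) = iint (enum 'I_n) F.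
Proof.
move=> mF F0; elim: s => [|i s IH]; first by congr iint; apply/funext.
rewrite -{}IH.
have -> : on_nonzero (i :: s) F = on_nonzero [:: i] (on_nonzero s F).
  by apply/funext => t; rewrite /on_nonzero /= andbT; case: (tnth t i != 0).
have m1 := measurable_on_nonzero s mF; have g1 := on_nonzero_ge0 s F0.
have m2 := measurable_on_nonzero [:: i] m1; have g2 := on_nonzero_ge0 [:: i] g1.
have Q : perm_eq (enum 'I_n) (rem i (enum 'I_n) ++ [:: i]).
  by rewrite perm_sym perm_catC /= perm_sym perm_to_rem// mem_enum.
by rewrite [LHS](iint_perm m2 g2 Q) [RHS](iint_perm m1 g1 Q) !iint_cat /= int1_nonzero.
Qed.

End nonzero_coordinates.

(** * Triangular factorisation along a tree order *)

Section triangular_det.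
Context {R : comNzRingType}.

(** A permutation other than the identity moves some [i] with [rk i <= rk (s i)]: otherwise
    permuting the ranks would strictly decrease their sum. *)
Lemma det_rank_triangular n (M : 'M[R]_n) (rk : 'I_n -> nat) :
  (forall i j, i != j -> (rk i <= rk j)%N -> M i j = 0) ->
  \det M = \prod_i M i i.
Proof.
move=> M0; rewrite /determinant (bigD1 (1%g : 'S_n))//= [X in _ + X]big1 ?addr0.
  by rewrite odd_perm1 expr0 mul1r; apply: eq_bigr => i _; rewrite perm1.
move=> s s1; have [i /andP[si ri]] : exists i, (i != s i) && (rk i <= rk (s i))%N.
  apply/existsP; apply: contraR s1; rewrite negb_exists => /forallP h.
  have le i : (rk (s i) <= rk i)%N.
    have := h i; rewrite negb_and negbK => /orP[/eqP <-//|].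
    by rewrite -ltnNge; exact: ltnW.
  apply/eqP/permP => i; rewrite perm1; apply/eqP/negPn/negP => si.
  have : (\sum_j rk (s j) < \sum_j rk j)%N.
    rewrite [X in (X < _)%N](bigD1 i)//= [X in (_ < X)%N](bigD1 i)//= -addSn.
    apply: leq_add; last by apply: leq_sum => j _; exact: le.
    by have := h i; rewrite negb_and negbK eq_sym (negbTE si)/= -ltnNge.
  by rewrite [X in (_ < X)%N](reindex_inj (@perm_inj _ s)) ltnn.
by rewrite (bigD1 i)//= M0// mul0r mulr0.
Qed.

End triangular_det.

Section blocks.
Context {R : realType} {r : nat}.
Implicit Types (S : {set 'I_r}) (A B X : 'M[R]_r).

Lemma sum_enum_val S (F : 'I_r -> R) : \sum_(a < #|S|) F (enum_val a) = \sum_(i in S) F i.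
Proof. by rewrite [RHS]big_enum_val. Qed.

Lemma block_mulmx S1 S2 S3 A B :
  (forall i k, i \in S1 -> k \notin S2 -> A i k = 0) ->
  block S1 S3 (A *m B) = block S1 S2 A *m block S2 S3 B.
Proof.
move=> A0; apply/matrixP => a b; rewrite !mxE.
under [RHS]eq_bigr => c _ do rewrite !mxE.
rewrite (sum_enum_val S2 (fun k => A (enum_val a) k * B k (enum_val b))).
rewrite (bigID (mem S2))/= [X in _ + X]big1 ?addr0// => k kS.
by rewrite A0 ?mul0r ?enum_valP.
Qed.

Lemma block_mulmxU S1 S2 S2' S3 A B : (forall k, k \in S2 -> k \notin S2') ->
  (forall i k, i \in S1 -> k \notin S2 -> k \notin S2' -> A i k = 0) ->
  block S1 S3 (A *m B) =
  block S1 S2 A *m block S2 S3 B + block S1 S2' A *m block S2' S3 B.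
Proof.
move=> dS A0; apply/matrixP => a b; rewrite !mxE.
under [X in _ = X + _]eq_bigr => c _ do rewrite !mxE.
under [X in _ = _ + X]eq_bigr => c _ do rewrite !mxE.
rewrite (sum_enum_val S2 (fun k => A (enum_val a) k * B k (enum_val b))).
rewrite (sum_enum_val S2' (fun k => A (enum_val a) k * B k (enum_val b))).
rewrite (bigID (mem S2))/=; congr (_ + _).
rewrite (bigID (mem S2'))/= [X in _ + X]big1 ?addr0.
  apply: eq_bigl => k; case: (boolP (k \in S2')) => kS; rewrite ?andbF// andbT.
  by apply/negP => /dS; rewrite kS.
by move=> k /andP[k2 k2']; rewrite A0 ?mul0r ?enum_valP.
Qed.

Lemma trmx_block S1 S2 A : (block S1 S2 A)^T = block S2 S1 A^T.
Proof. by apply/matrixP => a b; rewrite !mxE. Qed.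

Lemma det_block_diag S X (d : 'I_r -> R) :
  (forall i j, i \in S -> j \in S -> X i j = d i *+ (i == j)) ->
  \det (block S S X) = \prod_(i in S) d i.
Proof.
move=> Xd; rewrite (_ : block S S X = diag_mx (\row_a d (enum_val a))).
  rewrite det_diag [RHS]big_enum_val; apply: eq_bigr => a _; by rewrite mxE.
apply/matrixP => a b; rewrite !mxE Xd ?enum_valP// (inj_eq enum_val_inj).
by case: eqP => [->|//].
Qed.

Lemma quad_formE (v : 'rV[R]_r) X :
  (v *m X *m v^T) 0 0 = \sum_i \sum_j v 0 i * X i j * v 0 j.
Proof.
rewrite mxE exchange_big/=; apply: eq_bigr => j _; rewrite !mxE big_distrl/=.
by [].
Qed.

(** Positive definiteness of the block on [S], phrased with supported vectors so that the matrix
    keeps its size. *)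
Definition pos_on S X := forall v : 'rV[R]_r, v != 0 ->
  (forall j, j \notin S -> v 0 j = 0) -> 0 < (v *m X *m v^T) 0 0.

Lemma pos_onS S1 S2 X : S1 \subset S2 -> pos_on S2 X -> pos_on S1 X.
Proof.
move=> /fintype.subsetP sS h v v0 vS; apply: h => // j jS; apply: vS.
by apply: contra jS; exact: sS.
Qed.

Lemma posdef_block_pos_on S X : posdef (block S S X) -> pos_on S X.
Proof.
move=> [_ h] v v0 vS; pose w : 'rV[R]_#|S| := \row_a v 0 (enum_val a).
have w0 : w != 0.
  apply: contra_neq v0 => w0; apply/rowP => j; rewrite mxE.
  case: (boolP (j \in S)) => jS; last exact: vS.
  by have := congr1 (fun u : 'rV_#|S| => u 0 (enum_rank_in jS j)) w0; rewrite !mxE enum_rankK_in.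
have := h w w0; congr (0 < _); rewrite quad_formE.
rewrite mxE; under eq_bigr => b _ do rewrite !mxE.
transitivity (\sum_(j in S) (\sum_(i in S) v 0 i * X i j) * v 0 j).
  rewrite -(sum_enum_val S (fun j => (\sum_(i in S) v 0 i * X i j) * v 0 j)).
  apply: eq_bigr => b _; congr (_ * _).
  rewrite -(sum_enum_val S (fun i => v 0 i * X i (enum_val b))).
  by apply: eq_bigr => a _; rewrite !mxE.
rewrite exchange_big/= [RHS](bigID (mem S))/= [X in _ = _ + X]big1 ?addr0; last first.
  by move=> j jS; rewrite big1// => i _; rewrite (vS j)// mulr0.
apply: eq_bigr => j jS; rewrite big_distrl/= [RHS](bigID (mem S))/=.
by rewrite [X in _ = _ + X]big1 ?addr0// => i iS; rewrite (vS i)// !mul0r.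
Qed.

Lemma pos_on_solve S X (c : 'I_r -> R) : pos_on S X ->
  exists z : 'rV[R]_r, (forall j, j \notin S -> z 0 j = 0) /\
                       (forall j, j \in S -> (z *m X) 0 j = c j).
Proof.
move=> Xp.
(* The block on [S] is padded with the identity. A vector killed by [M] is supported on [S], so
   positivity makes it zero. *)
pose M : 'M[R]_r := \matrix_(i, j) if (i \in S) && (j \in S) then X i j else (i == j)%:R.
have MnS (v : 'rV[R]_r) j : j \notin S -> (v *m M) 0 j = v 0 j.
  move=> jS; rewrite mxE (bigD1 j)//= mxE (negbTE jS) andbF eqxx mulr1 big1 ?addr0// => i ij.
  by rewrite mxE (negbTE jS) andbF (negbTE ij) mulr0.
have MS (v : 'rV[R]_r) j : (forall j, j \notin S -> v 0 j = 0) -> j \in S ->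
    (v *m M) 0 j = (v *m X) 0 j.
  move=> vS jS; rewrite !mxE; apply: eq_bigr => i _; rewrite mxE jS andbT.
  by case: ifPn => // iS; rewrite vS// !mul0r.
have uM : M \in unitmx.
  rewrite -row_free_unit; apply: inj_row_free => v vM; apply/eqP/negPn/negP => v0.
  have vS j : j \notin S -> v 0 j = 0 by move=> jS; rewrite -MnS// vM mxE.
  have := Xp v v0 vS; rewrite mxE big1 ?ltxx// => j _.
  case: (boolP (j \in S)) => jS; first by rewrite -MS// vM !mxE mul0r.
  by rewrite [X in _ * X]mxE vS// mulr0.
pose c' : 'rV[R]_r := \row_j if j \in S then c j else 0.
have zM : c' *m invmx M *m M = c' by rewrite mulmxKV.
have zS j : j \notin S -> (c' *m invmx M) 0 j = 0.
  by move=> jS; rewrite -MnS// zM mxE (negbTE jS).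
exists (c' *m invmx M); split => // j jS.
by rewrite -MS// zM mxE jS.
Qed.

End blocks.

(* [P j i]: the vertex [j] is an ancestor of [i], or [i] itself. *)
Record tree_order r (P : rel 'I_r) (rk : 'I_r -> nat) : Prop := TreeOrder {
  tree_refl : forall i, P i i;
  tree_trans : forall i j k, P k j -> P j i -> P k i;
  tree_rk : forall i j, P j i -> j != i -> (rk j < rk i)%N;
  tree_chain : forall i j k, P j i -> P k i -> P j k || P k j }.

Section tree_matrices.
Context {R : realType} {r : nat} {P : rel 'I_r} {rk : 'I_r -> nat}.
Hypothesis PT : tree_order P rk.
Implicit Types (S : {set 'I_r}) (L X : 'M[R]_r) (i j k : 'I_r).

Definition lower (L : 'M[R]_r) := forall i j, ~~ P j i -> L i j = 0.
Definition unitlower (L : 'M[R]_r) := lower L /\ forall i, L i i = 1.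
Definition ancestral S := forall i j, i \in S -> P j i -> j \in S.

Lemma tree_asym i j : P i j -> P j i -> i = j.
Proof.
move=> ij ji; apply/eqP/negPn/negP => nij.
have := tree_rk PT ij nij; have := tree_rk PT ji.
by rewrite eq_sym => /(_ nij) /ltnW; rewrite leqNgt => /negP.
Qed.

Lemma lower_rk L : lower L -> forall i j, i != j -> (rk i <= rk j)%N -> L i j = 0.
Proof.
move=> lL i j ij rij; apply: lL; apply: contraL rij => ji.
by rewrite -ltnNge (tree_rk PT ji)// eq_sym.
Qed.

Lemma det_lower L : lower L -> \det L = \prod_i L i i.
Proof. by move=> /lower_rk; exact: det_rank_triangular. Qed.

Lemma det_block_unitlower S L : unitlower L -> \det (block S S L) = 1.
Proof.
move=> [lL L1]; rewrite (@det_rank_triangular _ _ _ (fun a => rk (enum_val a))).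
  by rewrite big1// => a _; rewrite mxE L1.
by move=> a b ab; rewrite mxE => /lower_rk ->//; rewrite (inj_eq enum_val_inj).
Qed.

Lemma lower_mul L1 L2 : lower L1 -> lower L2 -> lower (L1 *m L2).
Proof.
move=> l1 l2 i j ji; rewrite mxE big1// => k _.
have [ki|/l1 ->] := boolP (P k i); last by rewrite mul0r.
rewrite l2 ?mulr0//; apply: contra ji => jk. exact: (tree_trans PT jk ki).
Qed.

Lemma lower_mul_diag L1 L2 i : lower L1 -> lower L2 ->
  (L1 *m L2) i i = L1 i i * L2 i i.
Proof.
move=> l1 l2; rewrite mxE (bigD1 i)//= big1 ?addr0// => k ki.
have [Pki|/l1 ->] := boolP (P k i); last by rewrite mul0r.
rewrite l2 ?mulr0//; apply: contra ki => ik; apply/eqP; exact: tree_asym.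
Qed.

(** Rows of a lower matrix indexed by an ancestral set are supported in that set, so blocks multiply
    and conjugation by [L] keeps the determinant of the block. *)
Lemma det_block_conj S X L (d : 'I_r -> R) : unitlower L -> ancestral S ->
  (forall i j, i \in S -> j \in S -> (L *m X *m L^T) i j = d i *+ (i == j)) ->
  \det (block S S X) = \prod_(i in S) d i.
Proof.
move=> uL aS /det_block_diag <-.
have S0 (M : 'M[R]_r) i k : lower M -> i \in S -> k \notin S -> M i k = 0.
  by move=> lM iS kS; apply: lM; apply: contra kS; exact: aS.
rewrite -mulmxA (@block_mulmx _ _ S S S)//; last by move=> i k; exact: S0 uL.1.
rewrite det_mulmx (det_block_unitlower S uL) mul1r -det_tr trmx_block trmx_mul trmxK.
rewrite (@block_mulmx _ _ S S S)//; last by move=> i k; exact: S0 uL.1.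
by rewrite det_mulmx (det_block_unitlower S uL) mul1r -trmx_block det_tr.
Qed.

(** A square-root-free Cholesky reduction, required only at comparable pairs: elsewhere [fill x]
    holds zeros that carry no information. *)
Definition reduces (L X : 'M[R]_r) (d : 'I_r -> R) :=
  [/\ unitlower L, forall i, 0 < d i,
      forall i k, P k i -> k != i -> (L *m X) i k = 0 &
      forall i j, P i j || P j i -> (L *m X *m L^T) i j = d i *+ (i == j)].

(* Row [i] of [L] is a multiple of row [i] of the inverse of the block of [X]
   on the ancestors of [i]. *)
Lemma exists_reduces X : X^T = X ->
  (forall i, pos_on [set j | P j i]%SET X) -> exists L d, reduces L X d.
Proof.
move=> Xs Xp.
have /fin_all_exists[l hl] i : exists l : 'rV[R]_r, [/\ l 0 i = 1,
    forall j, ~~ P j i -> l 0 j = 0 & forall k, P k i -> k != i -> (l *m X) 0 k = 0].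
  have Xp' : pos_on [set j | P j i && (j != i)]%SET X.
    by apply: pos_onS (Xp i); apply/fintype.subsetP => j; rewrite !inE => /andP[].
  (* At a strict ancestor [k] the row [e_i + z] times [X] is [X i k - X i k]. *)
  have [z [zS zX]] := pos_on_solve (fun k => - X i k) Xp'.
  exists (delta_mx 0 i + z); split.
  - by rewrite !mxE !eqxx zS ?addr0// inE eqxx andbF.
  - move=> j ji; rewrite !mxE zS ?inE ?(negbTE ji)// addr0.
    rewrite (_ : (j == i) = false) ?andbF//.
    by apply: contraNF ji => /eqP ->; exact: (tree_refl PT).
  - move=> k ki kn; rewrite mulmxDl mxE zX ?inE ?ki//.
    by rewrite -rowE mxE subrr.
pose L : 'M[R]_r := \matrix_(i, j) l i 0 j.
have rowL i : row i L = l i by apply/rowP => j; rewrite !mxE.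
have LX i k : (L *m X) i k = (l i *m X) 0 k.
  by rewrite -rowL -row_mul [RHS]mxE.
have lL : lower L by move=> i j ji; rewrite mxE; have [_ ->] := hl i.
(* Row [j] of [L] is supported on ancestors of [j], all strict ancestors of [i], where row [i] of
   [L *m X] vanishes. *)
have off i j : P j i -> j != i -> (L *m X *m L^T) i j = 0.
  move=> ji nji; rewrite mxE big1// => k _.
  have [kj|kj] := boolP (P k j); last by rewrite [X in _ * X]mxE lL ?mulr0.
  have [_ _ h] := hl i; rewrite LX h ?mul0r//; first exact: (tree_trans PT kj ji).
  by apply: contra nji => /eqP ki; rewrite ki in kj; apply/eqP/tree_asym.
have sym : (L *m X *m L^T)^T = L *m X *m L^T by rewrite !trmx_mul trmxK Xs mulmxA.
exists L, (fun i => (L *m X *m L^T) i i); split.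
- by split => // i; rewrite mxE; have [] := hl i.
- move=> i; have [li1 li0 _] := hl i.
  have -> : (L *m X *m L^T) i i = (l i *m X *m (l i)^T) 0 0.
    rewrite !mxE; apply: eq_bigr => k _; rewrite LX; congr (_ * _).
    by rewrite !mxE.
  apply: Xp; last by move=> j; rewrite inE; exact: li0.
  by apply: contra_eq_neq li1 => ->; rewrite mxE eq_sym oner_eq0.
- by move=> i k ki kn; rewrite LX; have [_ _ ->] := hl i.
- move=> i j ij; case: eqVneq => [<-|nij]; rewrite ?mulr1n ?mulr0n//.
  case/orP: ij => h; last by apply: off => //; rewrite eq_sym.
  by rewrite -sym mxE off.
Qed.

Lemma det_block_reduces S X L d : reduces L X d -> ancestral S ->
  {in S &, forall i j, P i j || P j i} ->
  \det (block S S X) = \prod_(i in S) d i.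
Proof.
move=> [uL _ _ LXL] aS cS; apply: (det_block_conj uL aS) => i j iS jS.
by apply: LXL; exact: cS.
Qed.

(** Since [L *m X] vanishes on [U x D], the block of [L] there is [- L_UU X_UD X_DD^-1]; hence
    [L_UU] conjugates the Schur complement into the block of [L X L^T] on [U], which is diagonal. *)
Lemma det_schur_reduces (U D : {set 'I_r}) X L d : reduces L X d -> X^T = X ->
  (forall k, k \in U -> k \notin D) ->
  (forall i k, i \in U -> k \in D -> P k i) ->
  {in U &, forall i j, P i j || P j i} ->
  (forall i k, i \in U -> P k i -> (k \in U) || (k \in D)) ->
  ancestral D -> {in D &, forall i j, P i j || P j i} ->
  \det (block U U X - block U D X *m invmx (block D D X) *m (block U D X)^T) =
  \prod_(i in U) d i.
Proof.
move=> red Xs UD DP cU UDa aD cD; have [uL dp LX0 LXL] := red.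
have uX : block D D X \in unitmx.
  by rewrite unitmxE unitfE (det_block_reduces red)// gt_eqF// prodr_gt0.
have sup i k : i \in U -> k \notin U -> k \notin D -> L i k = 0.
  by move=> iU kU kD; apply: uL.1; apply: contra kU => /(UDa _ _ iU); rewrite (negbTE kD) orbF.
have split2 S3 := @block_mulmxU _ _ U U D S3 L X UD sup.
have LXUD0 : block U D (L *m X) = 0.
  apply/matrixP => a b; rewrite [RHS]mxE [LHS]mxE LX0//.
    exact: DP (enum_valP _) (enum_valP _).
  by apply: contraTneq (enum_valP b) => ->; exact: UD (enum_valP a).
have LUD : block U D L = - (block U U L *m block U D X *m invmx (block D D X)).
  move: LXUD0; rewrite split2 => /eqP; rewrite addrC addr_eq0 => /eqP E.
  by rewrite -(mulmxK uX (block U D L)) E mulNmx.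
have -> : \det (block U U X - block U D X *m invmx (block D D X) *m (block U D X)^T) =
    \det (block U U (L *m X *m L^T)).
  have -> : block U U (L *m X *m L^T) = block U U (L *m X) *m (block U U L)^T.
    rewrite -[LHS]trmxK trmx_block !trmx_mul trmxK Xs.
    rewrite (@block_mulmxU _ _ U U D U L (X *m L^T) UD sup).
    rewrite -[X *m L^T]trmxK trmx_mul trmxK Xs -!trmx_block LXUD0 trmx0 mulmx0 addr0.
    by rewrite trmx_mul trmxK.
  rewrite split2 LUD mulNmx -!mulmxA -mulmxBr !det_mulmx.
  rewrite det_tr !det_block_unitlower// mul1r mulr1 mulmxA.
  by rewrite trmx_block Xs mulmxA.
by apply: det_block_diag => i j iU jU; apply: LXL; exact: cU.
Qed.

End tree_matrices.
Arguments lower {R r} P L.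
Arguments unitlower {R r} P L.
Arguments ancestral {r} P S.
Arguments reduces {R r} P L X d.

(** * The factorisation [B^T D^-1 B] *)

Section factored_matrices.
Context {R : realType} {r : nat} {P : rel 'I_r} {rk : 'I_r -> nat}.
Hypothesis PT : tree_order P rk.
Implicit Types (S : {set 'I_r}) (B L W X : 'M[R]_r) (i j k : 'I_r).

(** The weights [1 / B k k] make the term [k = i] of entry [(i, j)] equal to [B i j]; this is what
    turns the map into a shear. *)
Definition gram B : 'M[R]_r := B^T *m diag_mx (\row_k (B k k)^-1) *m B.

Lemma gramE B i j : gram B i j = \sum_k B k i * B k j / B k k.
Proof.
rewrite mxE; apply: eq_bigr => k _; rewrite mul_mx_diag !mxE.
by rewrite mulrAC.
Qed.

Lemma gram_sym B : (gram B)^T = gram B.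
Proof. by rewrite /gram !trmx_mul trmxK tr_diag_mx mulmxA. Qed.

Lemma lower_unitmx B : lower P B -> (forall i, B i i != 0) -> B \in unitmx.
Proof.
move=> lB B0; rewrite unitmxE unitfE (det_lower PT lB).
by apply/prodf_neq0 => i _; exact: B0.
Qed.

Lemma quad_gram B (v : 'rV[R]_r) :
  (v *m gram B *m v^T) 0 0 = \sum_k (v *m B^T) 0 k ^+ 2 / B k k.
Proof.
rewrite /gram !mulmxA -[_ *m B *m v^T]mulmxA -[B *m v^T]trmxK trmx_mul trmxK.
rewrite mxE; apply: eq_bigr => k _; rewrite mul_mx_diag !mxE expr2.
by rewrite mulrAC.
Qed.

(** In the coordinates [v *m B^T] the form is a sum of squares weighted by [1 / B k k]. *)
Lemma posdef_gram B : lower P B -> (forall i, B i i != 0) ->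
  posdef (gram B) <-> forall i, 0 < B i i.
Proof.
move=> lB B0; have uB := lower_unitmx lB B0.
have uBT : B^T \in unitmx by rewrite unitmx_tr.
split => [[_ h] i|Bp].
  pose v : 'rV[R]_r := delta_mx 0 i *m invmx B^T.
  have vB : v *m B^T = delta_mx 0 i by rewrite mulmxKV.
  have v0 : v != 0.
    apply: contraPneq vB => -> /eqP; rewrite mul0mx eq_sym => /eqP/rowP/(_ i).
    by rewrite !mxE !eqxx => /eqP; rewrite oner_eq0.
  have := h v v0; rewrite quad_gram vB (bigD1 i)//= big1 ?addr0.
    by rewrite mxE !eqxx expr1n mul1r invr_gt0.
  by move=> k ki; rewrite mxE (negbTE ki) andbF expr0n mul0r.
split; first exact: gram_sym.
move=> v v0; rewrite quad_gram.
have vB0 : v *m B^T != 0.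
  by apply: contra_neq v0 => vB; rewrite -(mulmxK uBT v) vB mul0mx.
have /rV0Pn[k vk] := vB0.
rewrite (bigD1 k)//= ltr_pwDl//.
  by rewrite divr_gt0// exprn_even_gt0.
by apply: sumr_ge0 => j _; rewrite divr_ge0 ?sqr_ge0// ltW.
Qed.

(** [N = D B], with [D] the inverse of the diagonal of [B], is unit lower and satisfies
    [N (gram B)^-1 N^T = D]. *)
Lemma det_block_inv_gram S B : lower P B -> (forall i, B i i != 0) ->
  ancestral P S -> \det (block S S (invmx (gram B))) = \prod_(i in S) (B i i)^-1.
Proof.
move=> lB B0 aS; have uB := lower_unitmx lB B0.
have uBT : B^T \in unitmx by rewrite unitmx_tr.
pose D := diag_mx (\row_k (B k k)^-1).
pose D' := diag_mx (\row_k (B k k)).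
have DD' : D *m D' = 1%:M.
  rewrite mulmx_diag -[1%:M]diag_const_mx; congr diag_mx.
  by apply/rowP => k; rewrite !mxE mulVf.
have [uD uD'] := mulmx1_unit DD'.
have uy : gram B \in unitmx by rewrite !unitmx_mul uBT uD uB.
pose N := D *m B.
have NE i j : N i j = (B i i)^-1 * B i j by rewrite /N mul_diag_mx !mxE.
have uN : unitlower P N.
  split=> [i j ji|i]; first by rewrite NE (lB i j) ?mulr0//.
  by rewrite NE mulVf.
apply: (det_block_conj PT uN aS) => i j _ _.
have -> : N *m invmx (gram B) *m N^T = D.
  have -> : N^T = B^T *m D by rewrite trmx_mul tr_diag_mx.
  have E : gram B *m (invmx B *m D' *m invmx B^T) = 1%:M.
    rewrite /gram -/D !mulmxA mulmxK// -(mulmxA B^T D) DD'.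
    by rewrite mulmx1 mulmxV.
  have -> : invmx (gram B) = invmx B *m D' *m invmx B^T.
    by rewrite -[LHS]mulmx1 -E mulKmx.
  rewrite /N !mulmxA mulmxK// (mulmxKV uBT).
  by rewrite DD' mul1mx.
by rewrite !mxE; case: eqP => [->|].
Qed.

(** By cyclicity the trace is that of [D^-1 W (L X L^T) W^T]. Row [k] of [W] lives on the ancestors
    of [k], a chain, where [L X L^T] is diagonal. *)
Lemma trace_gram W L X d : reduces P L X d -> lower P W ->
  \tr (X *m gram (W *m L)) =
  \sum_k \sum_(i | P i k) d i * W k i ^+ 2 / W k k.
Proof.
move=> [uL dp _ LXL] lW; set B := W *m L.
have BW k : B k k = W k k by rewrite (lower_mul_diag PT k lW uL.1) uL.2 mulr1.
rewrite /gram -mulmxA mxtrace_mulC -mulmxA -mulmxA mxtrace_mulC -!mulmxA.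
rewrite [X in \tr (_ *m X)](_ : _ = W *m (L *m X *m L^T) *m W^T); last first.
  by rewrite /B trmx_mul !mulmxA.
apply: eq_bigr => k _; rewrite mul_diag_mx [LHS]mxE [X in X * _]mxE BW mulrC [X in X / _]mxE big_distrl/=.
rewrite [RHS](bigID xpredT)/= [X in _ = _ + X]big1 ?addr0; last by move=> i; rewrite andbF.
rewrite (bigID (P^~ k))/= [X in _ + X]big1 ?addr0; last first.
  by move=> i ik; rewrite [W^T i k]mxE lW ?mulr0 ?mul0r.
apply: eq_big => [i|i ik]; first by rewrite andbT.
congr (_ / _); rewrite [W^T i k]mxE mxE (bigD1 i)//= LXL ?(tree_refl PT)// eqxx.
rewrite big1 ?addr0; first by rewrite expr2 mulr1n; ring.
move=> j ji; have [jk|jk] := boolP (P j k); last by rewrite lW ?mul0r.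
by rewrite LXL ?(negbTE ji) ?mulr0n ?mulr0// (tree_chain PT jk ik).
Qed.

End factored_matrices.

(** * Pivoting and measurability of the cone *)

Section schur_complement.
Context {R : realType} {r : nat}.
Implicit Types (X : 'M[R]_r) (v w : 'rV[R]_r) (k : 'I_r) (S : {set 'I_r}).

(** One step of Gaussian elimination at full size; iterating it expresses positivity by finitely
    many pivot inequalities. *)
Definition eliminate k X : 'M[R]_r := \matrix_(i, j) (X i j - X i k * X k j / X k k).

Lemma eliminate_sym k X : X^T = X -> (eliminate k X)^T = eliminate k X.
Proof.
move=> Xs; have s i j : X i j = X j i by rewrite -[in LHS]Xs mxE.
by apply/matrixP => i j; rewrite !mxE [X j i]s [X j k]s [X k i]s [X k j * _]mulrC.
Qed.

(** Completing the square in coordinate [k]. *)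
Lemma quad_eliminate k X v : X^T = X ->
  (v *m X *m v^T) 0 0 =
  (v *m eliminate k X *m v^T) 0 0 + (v *m X) 0 k ^+ 2 / X k k.
Proof.
move=> Xs; have s i j : X i j = X j i by rewrite -[in LHS]Xs mxE.
rewrite !quad_formE.
have -> : (v *m X) 0 k ^+ 2 / X k k = \sum_i \sum_j v 0 i * (X i k * X k j / X k k) * v 0 j.
  rewrite expr2 {1}mxE -mulrA mulr_suml; apply: eq_bigr => i _.
  rewrite mxE mulrA mulr_sumr mulr_suml; apply: eq_bigr => j _.
  by rewrite [X j k]s; ring.
rewrite -big_split/=; apply: eq_bigr => i _; rewrite -big_split/=.
by apply: eq_bigr => j _; rewrite mxE; ring.
Qed.

Lemma quad_eliminate_coord k X v w : X^T = X -> X k k != 0 ->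
  (forall i, i != k -> v 0 i = w 0 i) ->
  (v *m eliminate k X *m v^T) 0 0 = (w *m eliminate k X *m w^T) 0 0.
Proof.
move=> Xs Xk vw; have s i j : X i j = X j i by rewrite -[in LHS]Xs mxE.
rewrite !quad_formE; apply: eq_bigr => i _; apply: eq_bigr => j _.
have [->|ik] := eqVneq i k.
  by rewrite (_ : eliminate k X k j = 0) ?mulr0 ?mul0r// mxE mulrAC mulfV// mul1r subrr.
have [->|jk] := eqVneq j k.
  by rewrite (_ : eliminate k X i k = 0) ?mulr0 ?mul0r// mxE mulfK// subrr.
by rewrite !vw.
Qed.

Lemma pos_on_eliminate k S X : X^T = X -> k \notin S ->
  pos_on (k |: S)%SET X <-> 0 < X k k /\ pos_on S (eliminate k X).
Proof.
move=> Xs kS.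
have dk (c : R) (u : 'rV[R]_r) i : i != k -> (u + c *: delta_mx 0 k) 0 i = u 0 i.
  by move=> ik; rewrite !mxE eqxx (negbTE ik) mulr0 addr0.
split=> [Xp|[Xk Xp] v v0 vS].
  have Xk : 0 < X k k.
    have := Xp (delta_mx 0 k); rewrite -rowE trmx_delta -colE !mxE; apply.
      by apply/eqP => /matrixP/(_ 0 k)/eqP; rewrite !mxE !eqxx oner_eq0.
    by move=> j; rewrite !finset.inE negb_or => /andP[jk _]; rewrite mxE (negbTE jk) andbF.
  split=> // w w0 wS.
  (* Coordinate [k] is adjusted so that [(v *m X) 0 k = 0], which removes the square. *)
  pose v := w + (- ((w *m X) 0 k / X k k)) *: delta_mx 0 k.
  have vX : (v *m X) 0 k = 0.
    rewrite /v mulmxDl -scalemxAl -rowE mxE [X in _ + X]mxE [X in _ * X]mxE mulNr.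
    by rewrite divfK ?subrr// lt0r_neq0.
  rewrite -(@quad_eliminate_coord k X v w)//; last 2 first.
  - by rewrite gt_eqF.
  - by move=> i; exact: dk.
  have <- : (v *m X *m v^T) 0 0 = (v *m eliminate k X *m v^T) 0 0.
    by rewrite (quad_eliminate k)// vX expr0n mul0r addr0.
  have /rV0Pn[j wj] := w0.
  have jk : j != k by apply: contraNneq wj => ->; rewrite wS.
  apply: Xp.
    by apply/eqP => /matrixP/(_ 0 j)/eqP; rewrite dk// mxE (negbTE wj).
  move=> i; rewrite !finset.inE negb_or => /andP[ik iS].
  by rewrite dk// wS.
pose w := v + (- v 0 k) *: delta_mx 0 k.
have wk : w 0 k = 0 by rewrite !mxE !eqxx mulr1 subrr.
rewrite (quad_eliminate k)// (@quad_eliminate_coord k X v w)//; last 2 first.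
- by rewrite gt_eqF.
- by move=> i ik; rewrite dk.
have [w0|w0] := eqVneq w 0.
  have vk : v = v 0 k *: delta_mx 0 k.
    by apply/eqP; rewrite -subr_eq0 -scaleNr -/w w0.
  have vk0 : v 0 k != 0 by apply: contra_neq v0 => e; rewrite vk e scale0r.
  rewrite w0 !mul0mx mxE add0r; apply: divr_gt0 => //.
  have -> : (v *m X) 0 k = v 0 k * X k k.
    by rewrite {1}vk -scalemxAl -rowE mxE [X in _ * X]mxE.
  by rewrite exprn_even_gt0//= mulf_neq0// lt0r_neq0.
apply: ltr_pwDl; last by rewrite divr_ge0 ?sqr_ge0// ltW.
apply: Xp => // j jS; have [->//|jk] := eqVneq j k.
by rewrite dk// vS// !finset.inE negb_or jk.
Qed.

Lemma posdefE X : posdef X <-> X^T = X /\ pos_on [set: 'I_r]%SET X.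
Proof.
split=> -[Xs Xp]; split=> // v v0; first by move=> _; exact: Xp.
by apply: Xp => // j; rewrite finset.inE.
Qed.

End schur_complement.

Section measurable_matrices.
Context d (T : measurableType d) {R : realType}.

Definition measurable_mx m n (Y : T -> 'M[R]_(m, n)) :=
  forall i j, measurable_fun setT (fun t => Y t i j).

Lemma measurable_det n (Y : T -> 'M[R]_n) : measurable_mx Y ->
  measurable_fun setT (fun t => \det (Y t)).
Proof.
move=> mY; apply: measurable_sum => s; apply: measurable_funM; first exact: measurable_cst.
by apply: measurable_prod => i _; exact: mY.
Qed.

(** Cramer's rule, except that [invmx] returns a singular matrix unchanged. *)
Lemma measurable_invmx n (Y : T -> 'M[R]_n) : measurable_mx Y ->
  measurable_mx (fun t => invmx (Y t)).
Proof.
move=> mY i j; have mdet := measurable_det mY.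
rewrite (_ : (fun t => invmx (Y t) i j) =
    fun t => if \det (Y t) == 0 then Y t i j else (\det (Y t))^-1 * cofactor (Y t) j i); last first.
  apply/funext => t; rewrite /invmx unitmxE unitfE; case: ifPn => [/negbTE ->|].
    by rewrite !mxE.
  by rewrite negbK => ->.
apply: measurable_fun_ifT; [|exact: mY|].
  by apply: measurable_fun_eqr.
apply: measurable_funM; first exact: (measurableT_comp measurable_inv mdet).
apply: measurable_funM; first exact: measurable_cst.
apply: measurable_det => a b.
rewrite (_ : (fun t => _) = fun t => Y t (lift j a) (lift i b)); first exact: mY.
by apply/funext => t; rewrite !mxE.
Qed.

Lemma measurable_block r (A B : {set 'I_r}) (Y : T -> 'M[R]_r) : measurable_mx Y ->
  measurable_mx (fun t => block A B (Y t)).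
Proof.
move=> mY i j; rewrite (_ : (fun t => _) = fun t => Y t (enum_val i) (enum_val j)).
  exact: mY.
by apply/funext => t; rewrite mxE.
Qed.

(** Induction on the size of [S]: a positive pivot at [k] is a measurable condition, and the
    eliminated matrix again has measurable entries. *)
Lemma measurable_pos_on r (S : {set 'I_r}) (Y : T -> 'M[R]_r) : measurable_mx Y ->
  (forall t, (Y t)^T = Y t) -> measurable [set t | pos_on S (Y t)].
Proof.
move En : #|S| => n; elim: n S En Y => [|n IH] S Sn Y mY Ys.
  rewrite (_ : mkset _ = setT)//; apply/seteqP; split=> // t _ v v0 vS; exfalso.
  move/eqP: Sn; rewrite cards_eq0 => /eqP S0.
  by move: v0; apply/negP/negPn/eqP/rowP => j; rewrite vS ?mxE// S0 finset.inE.
have [k kS] : exists k, k \in S by apply/card_gt0P; rewrite Sn.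
have Sk : #|(S :\ k)%SET| = n by move: Sn; rewrite (cardsD1 k) kS add1n => -[].
rewrite (_ : mkset _ = [set t | 0 < Y t k k] `&` [set t | pos_on (S :\ k)%SET (eliminate k (Y t))]).
  apply: measurableI.
    rewrite -[X in measurable X]setTI (_ : [set t | _] = (fun t => Y t k k) @^-1` `]0, +oo[).
      exact: mY.
    by apply/seteqP; split=> t /=; rewrite in_itv/= andbT.
  apply: IH => // [i j|t]; last exact: eliminate_sym.
  rewrite (_ : (fun t => _) = fun t => Y t i j - Y t i k * Y t k j * (Y t k k)^-1).
    apply: measurable_funB => //; apply: measurable_funM; first exact: measurable_funM.
    exact: (measurableT_comp measurable_inv (mY k k)).
  by apply/funext => t; rewrite mxE.
have kS' : k \notin (S :\ k)%SET by rewrite !finset.inE eqxx.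
apply/seteqP; split=> t /= h.
  by apply/(pos_on_eliminate (Ys t) kS'); rewrite finset.setD1K.
by rewrite -(finset.setD1K kS); apply/(pos_on_eliminate (Ys t) kS').
Qed.

End measurable_matrices.

(** * Homogeneous graphs *)

Section homogeneous_graph.
Local Open Scope set_scope.
Local Open Scope nat_scope.
Context {r : nat} {E : rel 'I_r}.
Hypothesis E_refl : reflexive E.
Hypothesis E_sym : symmetric E.
Implicit Types (i j k : 'I_r) (A B C S u v : {set 'I_r}).

Definition star i : {set 'I_r} := [set j | E i j].

Lemma star_nb i : i |: nb E i = star i.
Proof. by apply/setP => j; rewrite !inE; case: eqVneq => //= ->; rewrite E_refl. Qed.

Lemma arrowE i j : arrow E i j = (star j \subset star i).
Proof. by rewrite /arrow !star_nb. Qed.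

Lemma arrowP i j : reflect (forall k, E j k -> E i k) (arrow E i j).
Proof.
rewrite arrowE; apply: (iffP fintype.subsetP) => h k; first by have := h k; rewrite !inE.
by rewrite !inE; exact: h.
Qed.

Lemma arrow_refl i : arrow E i i. Proof. exact/arrowP. Qed.

Lemma arrow_trans i j k : arrow E i j -> arrow E j k -> arrow E i k.
Proof. by move=> /arrowP ij /arrowP jk; apply/arrowP => l /jk /ij. Qed.

Lemma arrow_adj i j : arrow E i j -> E i j.
Proof. by move=> /arrowP; apply. Qed.

Lemma arrow_card_eq i j : arrow E i j -> #|star i| <= #|star j| -> arrow E j i.
Proof.
rewrite !arrowE => ij le; have /eqP -> : star j == star i by rewrite eqEcard ij.
exact: fintype.subxx.
Qed.

(* Larger closed neighbourhoods come first; ties are broken by the index. *)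
Definition rank i : nat := (r - #|star i|) * r + i.
Definition anc_rel : rel 'I_r := fun j i => E j i && (rank j <= rank i).

Hypothesis E_hom : homogeneous E.

(* Otherwise private neighbours of [i] and [j] would form with them an induced
   path or cycle on four vertices. *)
Lemma adj_arrow i j : E i j -> arrow E i j || arrow E j i.
Proof.
move=> ij; apply/negPn/negP; rewrite negb_or => /andP[].
rewrite !arrowE => /fintype.subsetPn[b]; rewrite !inE => jb ib.
move=> /fintype.subsetPn[a]; rewrite !inE => ia ja.
(* Along [a, i, j, b] consecutive vertices are adjacent, while [a, j] and [i, b] are not; whether
   [a] and [b] are adjacent decides between a cycle and a path. *)
pose f (x : 'I_4) := nth i [:: a; i; j; b] x.
have ai : a != i by apply: contraNneq ja => ->; rewrite E_sym.
have bj : b != j by apply: contraNneq ib => ->.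
have aj : a != j by apply: contraNneq ja => ->.
have bi : b != i by apply: contraNneq ib => ->.
have nij : i != j by apply: contraTneq jb => <-.
have ab : a != b by apply: contraTneq ia => ->.
have uf : uniq [:: a; i; j; b] by rewrite /= !inE !negb_or ai aj ab nij eq_sym bi eq_sym bj.
have f_inj : injective f.
  by move=> x y /eqP; rewrite nth_uniq// => /eqP/val_inj.
have [[_ hC] hP] := E_hom.
have FE (F : rel 'I_4) : (forall x y, F x y = F y x) ->
    (forall x y : 'I_4, x < y -> E (f x) (f y) = F x y) -> has_induced E F.
  move=> Fs h; exists f; split; first exact: f_inj.
  move=> p q pq; have [lt|gt|/val_inj eq] := ltngtP p q; first exact: h.
    by rewrite E_sym Fs h.
  by rewrite eq eqxx in pq.
have [Eab|Eab] := boolP (E a b).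
  apply: (hC 4) => //; apply: FE => [x y|]; first by rewrite /cycle_rel /path_rel /= orbC.
  by case=> [[|[|[|[|x]]]] hx] [[|[|[|[|y]]]] hy]//= _; rewrite /cycle_rel /path_rel /f /= ?ij ?jb ?Eab ?(negbTE ib)
    ?[E a i]E_sym ?[E a j]E_sym ?ia ?(negbTE ja).
apply: hP; apply: FE => [x y|]; first by rewrite /cycle_rel /path_rel /= orbC.
by case=> [[|[|[|[|x]]]] hx] [[|[|[|[|y]]]] hy]//= _; rewrite /cycle_rel /path_rel /f /= ?ij ?jb ?(negbTE Eab) ?(negbTE ib)
  ?[E a i]E_sym ?[E a j]E_sym ?ia ?(negbTE ja).
Qed.

(** Were the closed neighbourhood of [j] strictly smaller, the rank of [j] would gain at least [r],
    which the indices, below [r], cannot make up for. *)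
Lemma anc_arrow i j : anc_rel j i -> arrow E j i.
Proof.
move=> /andP[ji rji]; have := adj_arrow ji => /orP[//|ij].
apply: (arrow_card_eq ij); rewrite leqNgt; apply/negP => lt.
have ri : #|star i| <= r by rewrite -[X in _ <= X]card_ord max_card.
move: rji; rewrite /rank leqNgt => /negP; apply.
have := ltn_ord i; have := ltn_ord j; nia.
Qed.

Lemma arrow_rank i j : arrow E j i -> ~~ arrow E i j -> rank j < rank i.
Proof.
move=> ji ij; have lt : #|star i| < #|star j|.
  by rewrite ltnNge; apply: contra ij; exact: arrow_card_eq.
have rj : #|star j| <= r by rewrite -[X in _ <= X]card_ord max_card.
by rewrite /rank; have := ltn_ord i; have := ltn_ord j; nia.
Qed.

Lemma rank_inj : injective rank.
Proof.
move=> i j; rewrite /rank => e; apply/val_inj => /=.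
have := congr1 (modn^~ r) e; rewrite !modnMDl !modn_small//; exact: ltn_ord.
Qed.

Lemma adj_anc i j : E i j = anc_rel i j || anc_rel j i.
Proof. by rewrite /anc_rel [E j i]E_sym -andb_orr leq_total andbT. Qed.

(** For the chain property, the closed neighbourhood of an ancestor [j] of [i] contains that of [i],
    hence every other ancestor of [i]; adjacent vertices are comparable. *)
Lemma anc_tree : tree_order anc_rel rank.
Proof.
split=> [i|i j k kj ji|i j /andP[_]|i j k ji ki].
- by rewrite /anc_rel E_refl leqnn.
- have ki := arrow_trans (anc_arrow kj) (anc_arrow ji).
  rewrite /anc_rel arrow_adj//=.
  by move: kj ji => /andP[_ kj] /andP[_ ji]; exact: leq_trans ji.
- by rewrite leq_eqVlt => /orP[/eqP/rank_inj ->|//]; rewrite eqxx.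
- rewrite -adj_anc; move/anc_arrow: ji => /arrowP; apply.
  by rewrite E_sym; case/andP: ki.
Qed.

Lemma complete_setP A : reflect {in A &, forall i j, E i j} (complete_set E A).
Proof.
apply: (iffP forall_inP) => [h i j iA jA|h i iA].
  by have /forall_inP := h i iA; apply.
by apply/forall_inP => j jA; exact: h.
Qed.

Definition up_closed S := forall i j, i \in S -> arrow E j i -> j \in S.

Lemma up_closed_ancestral S : up_closed S -> ancestral anc_rel S.
Proof. by move=> uS i j iS /anc_arrow; exact: uS. Qed.

Lemma clique_complete C : C \in cliques E -> {in C &, forall i j, E i j}.
Proof. by rewrite inE => /maxsetP[/complete_setP]. Qed.

Lemma clique_max C i : C \in cliques E -> {in C, forall j, E i j} -> i \in C.
Proof.
rewrite inE => /maxsetP[/complete_setP cC mC] iC.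
have <- : i |: C = C; last by rewrite !inE eqxx.
apply: mC; last exact: finset.subsetUr.
apply/complete_setP => j k; rewrite !inE => /orP[/eqP ->|jC] /orP[/eqP ->|kC].
- exact: E_refl.
- exact: iC.
- by rewrite E_sym iC.
- exact: cC.
Qed.

Lemma clique_up_closed C : C \in cliques E -> up_closed C.
Proof.
move=> cC i j iC /arrowP ji; apply: (clique_max cC) => k kC.
by apply: ji; exact: clique_complete cC _ _ iC kC.
Qed.

(** For [a] in [A] outside [B] and [b] in [B], [arrow E a b] would put [a] in [B]; so [arrow E b a],
    which puts [b] in [A]. *)
Lemma up_closed_nested A B C : {in C &, forall i j, E i j} ->
  A \subset C -> B \subset C -> up_closed A -> up_closed B ->
  (A \subset B) || (B \subset A).
Proof.
move=> cC /fintype.subsetP AC /fintype.subsetP BC uA uB; apply/orP.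
have [|/fintype.subsetPn[a aA aB]] := boolP (A \subset B); [by left|right].
apply/fintype.subsetP => b bB.
have /orP[ab|ba] := adj_arrow (cC _ _ (AC _ aA) (BC _ bB)).
  by move: aB; rewrite (uB _ _ bB ab).
by apply: uA ba; exact: aA.
Qed.

(* The intersections of a clique with the other ones are nested, so the largest
   of them is the separator: every order of the cliques is perfect. *)
Lemma separatorE (s : seq {set 'I_r}) (j : nat) : {subset s <= cliques E} -> 0 < j < size s ->
  exists2 l, l < j & separator s j = nth finset.set0 s l :&: nth finset.set0 s j.
Proof.
move=> sC /andP[j0 js]; set C := nth finset.set0 s j.
have cs l : l <= j -> nth finset.set0 s l \in cliques E.
  by move=> lj; apply/sC/mem_nth/(leq_ltn_trans lj).
have [l _ lmax] := @arg_maxnP 'I_j (Ordinal j0) xpredT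
  (fun l : 'I_j => #|nth finset.set0 s l :&: C|) isT.
exists l; first exact: ltn_ord.
apply/eqP; rewrite finset.eqEsubset; apply/andP; split; last first.
  by apply: finset.setSI; exact: (finset.bigcup_sup l).
apply/fintype.subsetP => x; rewrite finset.inE => /andP[/bigcupP[m _ xm] xC].
have uI (n : 'I_j) : up_closed (nth finset.set0 s n :&: C).
  move=> i k; rewrite !finset.inE => /andP[i1 i2] ki; apply/andP; split.
    exact: clique_up_closed (cs _ (ltnW (ltn_ord n))) _ _ i1 ki.
  exact: clique_up_closed (cs _ (leqnn j)) _ _ i2 ki.
have := @up_closed_nested _ _ C (clique_complete (cs _ (leqnn j)))
  (finset.subsetIr _ _) (finset.subsetIr _ _) (uI m) (uI l).
have xmC : x \in nth finset.set0 s m :&: C by rewrite finset.inE xm.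
case/orP => [/fintype.subsetP|lm]; first by apply.
suff -> : nth finset.set0 s l :&: C = nth finset.set0 s m :&: C by [].
by apply/eqP; rewrite eqEcard lm; exact: lmax.
Qed.

Lemma perfect_cliques (s : seq {set 'I_r}) : {subset s <= cliques E} -> perfect s.
Proof.
move=> sC; apply/allP => j; rewrite mem_iota add1n => /andP[j0 js].
have js' : j < size s by move: js j0; case: (size s) => //= n; lia.
have [|l lj ->] := @separatorE s j sC; first by rewrite j0.
apply/hasP; exists l; first by rewrite mem_iota.
exact: finset.subsetIl.
Qed.

(** The fallback [[::]] of [perfect_order] is never taken, since the plain enumeration of the
    cliques is perfect. *)
Lemma perfect_orderP : perm_eq (perfect_order E) (enum (cliques E)) /\
  perfect (perfect_order E).
Proof.
rewrite /perfect_order; case: pickP => [s /andP[]//|].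
have sz : size (enum (cliques E)) == #|cliques E| by rewrite -cardE.
move=> /(_ (Tuple sz)); rewrite /= perm_refl perfect_cliques//.
by move=> C; rewrite mem_enum.
Qed.

Lemma mem_perfect_order C : (C \in perfect_order E) = (C \in cliques E).
Proof. by have [/perm_mem -> _] := perfect_orderP; rewrite mem_enum. Qed.

(** By perfection, [A] lies in the separator at [j] exactly when it lies in the clique at [j] and in
    an earlier one; only the first clique containing [A] has no matching separator. *)
Lemma count_separators (s : seq {set 'I_r}) A : perfect s ->
  count (fun S => A \subset S) [seq separator s m | m <- iota 1 (size s).-1] +
    has (fun S => A \subset S) s = count (fun S => A \subset S) s.
Proof.
set q := fun S : {set 'I_r} => A \subset S => ps.
pose g (s : seq {set 'I_r}) (j : nat) := q (nth finset.set0 s j) && has q (take j s).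
have gE (t : seq {set 'I_r}) : count (g t) (iota 0 (size t)) + has q t = count q t.
  elim/last_ind: t => // t x IH; rewrite size_rcons -addn1 iotaD count_cat /=.
  rewrite -cats1 has_cat count_cat /= orbF addn0 -IH add0n.
  have -> : count (g (t ++ [:: x])) (iota 0 (size t)) = count (g t) (iota 0 (size t)).
    apply: eq_in_count => j; rewrite mem_iota add0n => /andP[_ jt].
    by rewrite /g nth_cat jt takel_cat// ltnW.
  rewrite {2}/g nth_cat ltnn subnn /= take_size_cat//.
  by case: (q x); case: (has q t) => /=; lia.
have sep (j : nat) : j \in iota 1 (size s).-1 -> q (separator s j) = g s j.
  move=> js; apply/idP/idP => [qs|].
    have /hasP[l] := allP ps _ js; rewrite mem_iota add0n => /andP[_ lj] sub.
    apply/andP; split; first by apply: (fintype.subset_trans qs); exact: finset.subsetIr.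
    apply/hasP; exists (nth finset.set0 s l); last exact: fintype.subset_trans qs sub.
    have ls : l < size s by move: js; rewrite mem_iota; lia.
    by rewrite -(nth_take finset.set0 lj) mem_nth// size_take; case: ifP => // _; lia.
  move=> /andP[qj /hasP[S /(nthP finset.set0)[l ls <-] ql]].
  rewrite /q finset.subsetI [X in _ && X]qj andbT.
  have lj : l < j by move: ls; rewrite size_take; case: ifP; lia.
  rewrite nth_take// in ql; apply: (fintype.subset_trans ql).
  exact: (finset.bigcup_sup (Ordinal lj)).
rewrite -[RHS]gE count_map; congr (_ + _).
case: (size s) sep => [|n] sep //=.
(* Separators start at index 1; at index 0 there is no earlier clique. *)
have -> : g s 0 = false by rewrite /g take0 andbF.
by rewrite add0n; apply: eq_in_count.
Qed.

Lemma has_perfect_order A :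
  has (fun S => A \subset S) (perfect_order E) = complete_set E A.
Proof.
apply/hasP/idP => [[C]|cA]; last first.
  by have [C mC AC] := maxset_exists cA; exists C; rewrite ?mem_perfect_order ?inE.
rewrite mem_perfect_order => cC /fintype.subsetP AC.
by apply/complete_setP => i j iA jA; apply: (clique_complete cC); exact: AC.
Qed.

Lemma count_perfect_order A :
  count (fun S => A \subset S) (separators E) + complete_set E A =
  count (fun S => A \subset S) (perfect_order E).
Proof. by rewrite -has_perfect_order count_separators//; have [] := perfect_orderP. Qed.

End homogeneous_graph.

(** * Cliques and separators as branches of the Hasse tree *)

Section hasse_tree.
Local Open Scope set_scope.
Local Open Scope nat_scope.
Context {r : nat} {E : rel 'I_r}.
Hypothesis E_refl : reflexive E.
Hypothesis E_sym : symmetric E.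
Implicit Types (i j k : 'I_r) (A B C S u v t : {set 'I_r}).

Let arr_refl i : arrow E i i := arrow_refl E_refl i.
Let arr_trans i j k : arrow E i j -> arrow E j k -> arrow E i k := @arrow_trans _ _ E_refl i j k.

Lemma arrow_classP i j : reflect (arrow_class E i = arrow_class E j) (arrow E i j && arrow E j i).
Proof.
apply: (iffP andP) => [[ij ji]|e].
  apply/setP => k; rewrite !finset.inE; apply/andP/andP => -[h1 h2]; split.
  - exact: arr_trans ji h1.
  - exact: arr_trans h2 ij.
  - exact: arr_trans ij h1.
  - exact: arr_trans h2 ji.
have : i \in arrow_class E i by rewrite finset.inE arr_refl.
by rewrite e finset.inE => /andP[].
Qed.

Lemma mem_arrow_class i : i \in arrow_class E i.
Proof. by rewrite finset.inE arr_refl. Qed.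

Lemma classesTP u : reflect (exists i, u = arrow_class E i) (u \in classesT E).
Proof. by apply: (iffP imsetP) => [[i _ ->]|[i ->]]; exists i. Qed.

Lemma arrow_class_mem i : arrow_class E i \in classesT E.
Proof. by apply/classesTP; exists i. Qed.

Lemma classesT_eq u i : u \in classesT E -> i \in u -> u = arrow_class E i.
Proof.
move=> /classesTP[j ->]; rewrite finset.inE => ji; exact/arrow_classP.
Qed.

Lemma mem_classesT u i : u \in classesT E -> (i \in u) = (arrow_class E i == u).
Proof.
move=> uT; apply/idP/eqP => [/(classesT_eq uT)//|<-]; exact: mem_arrow_class.
Qed.

Lemma preceq_class i j : preceq E (arrow_class E i) (arrow_class E j) = arrow E i j.
Proof.
apply/existsP/idP => [[i' /andP[]]|ij].
  rewrite finset.inE => /andP[ii' _] /existsP[j' /andP[]].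
  rewrite finset.inE => /andP[_ j'j] i'j'.
  exact: arr_trans ii' (arr_trans i'j' j'j).
exists i; rewrite mem_arrow_class; apply/existsP; exists j.
by rewrite mem_arrow_class.
Qed.

Lemma prec_class i j :
  prec E (arrow_class E i) (arrow_class E j) = arrow E i j && ~~ arrow E j i.
Proof.
rewrite /prec preceq_class; have [ij|//] := boolP (arrow E i j).
rewrite /=; congr negb; apply/eqP/idP => [/arrow_classP/andP[]//|ji].
by apply/arrow_classP; rewrite ij.
Qed.

Lemma upto_class j : upto E (arrow_class E j) = [set i | arrow E i j].
Proof.
apply/setP => i; rewrite finset.inE; apply/bigcupP/idP => [[v /andP[vT]]|ij].
  by move=> vj /(classesT_eq vT) vi; move: vj; rewrite vi preceq_class.
exists (arrow_class E i); last exact: mem_arrow_class.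
by rewrite arrow_class_mem preceq_class.
Qed.

Lemma below_class j : below E (arrow_class E j) = [set i | arrow E i j && ~~ arrow E j i].
Proof.
apply/setP => i; rewrite finset.inE; apply/bigcupP/idP => [[v /andP[vT]]|ij].
  by move=> vj /(classesT_eq vT) vi; move: vj; rewrite vi prec_class.
exists (arrow_class E i); last exact: mem_arrow_class.
by rewrite arrow_class_mem prec_class.
Qed.

Lemma upto_inj : {in classesT E &, injective (upto E)}.
Proof.
move=> u v /classesTP[i ->] /classesTP[j ->]; rewrite !upto_class => e.
apply/arrow_classP; move/setP: e => e.
by have := e i; have := e j; rewrite !finset.inE !arr_refl => -> <-.
Qed.

Lemma endpoint_class j : endpoint E (arrow_class E j) = [forall k, arrow E j k ==> arrow E k j].
Proof.
apply/idP/idP => [|/forallP h]; last first.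
  apply/existsP => -[v /andP[/classesTP[k ->] /andP[]]].
  by rewrite prec_class => /andP[/(implyP (h k)) ->].
apply: contraR; rewrite negb_forall => /existsP[k0]; rewrite negb_imply => hk0.
pose Q k := arrow E j k && ~~ arrow E k j.
have hQ : Q k0 by [].
(* Among the strict descendants of [j], one with the largest closed neighbourhood is a child: a
   class in between would have a larger one. *)
have [k hk kmax] := @arg_maxnP 'I_r k0 Q (fun k => #|@star _ E k|) hQ.
apply/existsP; exists (arrow_class E k); rewrite arrow_class_mem /child prec_class -/(Q k) hk /=.
apply/existsP => -[w /andP[/classesTP[m ->]]]; rewrite !prec_class => /andP[jm /andP[mk km]].
have := kmax m jm; apply/negP; rewrite -ltnNge ltnNge; apply: contra km => le.
exact: arrow_card_eq.
Qed.

Lemma sum_classes (Q : pred {set 'I_r}) :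
  \sum_(v in classesT E | Q v) #|v| = #|[set j | Q (arrow_class E j)]|.
Proof.
rewrite -sum1_card (partition_big (arrow_class E) (fun v => (v \in classesT E) && Q v)) /=.
  apply: eq_bigr => v /andP[vT Qv]; rewrite -sum1_card; apply: eq_bigl => i.
  rewrite finset.inE mem_classesT//; case: eqVneq => [->|]; last by rewrite andbF.
  by rewrite Qv.
by move=> i; rewrite finset.inE arrow_class_mem.
Qed.

Lemma prod_classes (T : comSemiRingType) (F : 'I_r -> T) :
  (\prod_(u in classesT E) \prod_(i in u) F i = \prod_i F i)%R.
Proof.
rewrite [RHS](partition_big (arrow_class E) (mem (classesT E)))/=; last first.
  by move=> i _; exact: arrow_class_mem.
apply: eq_bigr => u uT; apply: eq_bigl => i; exact: mem_classesT.
Qed.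

Section connected.
Hypothesis E_hom : homogeneous E.

(** A vertex [w] with the largest closed neighbourhood dominates each of its neighbours, so its
    closed neighbourhood is stable under adjacency and by connectedness is everything. The vertex
    [i] provides nonemptiness. *)
Lemma universal_vertex i : exists w, forall j, arrow E w j.
Proof.
have [w _ wmax] := @arg_maxnP 'I_r i xpredT (fun k => #|@star _ E k|) isT.
have clo : fingraph.closed E [set j | E w j].
  apply: intro_closed; first by apply: sym_connect_sym; exact: E_sym.
  move=> j k jk; rewrite !finset.inE => wj.
  have /arrowP h : arrow E w j.
    have /orP[//|jw] := adj_arrow E_refl E_sym E_hom wj.
    by apply: (arrow_card_eq E_refl jw); exact: wmax.
  exact: h.
exists w => j; apply/(arrowP E_refl) => k _.
have := closed_connect clo (E_hom.1.1 w k).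
by rewrite !finset.inE E_refl => /esym.
Qed.

Let adj_arr i j : E i j -> arrow E i j || arrow E j i := adj_arrow E_refl E_sym E_hom (j := j).

(** The bottom is an element of [S] with the smallest closed neighbourhood. *)
Lemma branch_bottom S i : i \in S -> {in S &, forall i j, E i j} -> up_closed (E := E) S ->
  exists2 j, j \in S & S = [set k | arrow E k j].
Proof.
move=> iS cS uS.
have [j jS jmin] := @arg_minnP 'I_r i (mem S) (fun k => #|@star _ E k|) iS.
exists j => //; apply/setP => k; rewrite finset.inE; apply/idP/idP => [kS|kj]; last exact: uS kj.
have /orP[//|jk] := adj_arr (cS _ _ kS jS).
by apply: (arrow_card_eq E_refl jk); exact: jmin.
Qed.

Lemma clique_mem w C : (forall j, arrow E w j) -> C \in cliques E -> w \in C.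
Proof.
move=> ww cC; apply: (clique_max E_refl E_sym cC) => j _.
by apply: (arrow_adj E_refl).
Qed.

(** If [j] dominates [k], every vertex of the clique dominates [k] too, so maximality puts [k] in
    the clique; hence the bottom [j] is an endpoint. *)
Lemma clique_branch i C : C \in cliques E ->
  exists j, [/\ C = [set k | arrow E k j], C = upto E (arrow_class E j) &
                endpoint E (arrow_class E j)].
Proof.
move=> cC; have [w ww] := universal_vertex i.
have [j jC e] := branch_bottom (clique_mem ww cC) (clique_complete cC)
  (clique_up_closed E_refl E_sym cC).
exists j; split=> //; first by rewrite upto_class.
rewrite endpoint_class; apply/forallP => k; apply/implyP => jk.
suff : k \in C by rewrite e finset.inE.
apply: (clique_max E_refl E_sym cC) => m; rewrite e finset.inE => mj.
by rewrite E_sym (arrow_adj E_refl)// (arr_trans mj jk).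
Qed.

(** A separator is the intersection of two distinct cliques and contains the universal vertex. If
    its bottom were an endpoint, one clique would be contained in the other. *)
Lemma separator_branch i S : S \in separators E ->
  exists j, [/\ S = [set k | arrow E k j], S = upto E (arrow_class E j) &
                ~~ endpoint E (arrow_class E j)].
Proof.
have [pe pp] := perfect_orderP E_refl E_sym E_hom.
have sC : {subset perfect_order E <= cliques E}.
  by move=> C; rewrite (mem_perfect_order E_refl E_sym E_hom).
move=> /mapP[m]; rewrite mem_iota => m_s.
have ms : 0 < m < size (perfect_order E) by move: m_s; lia.
have [l lm ->] := separatorE E_refl E_sym E_hom sC ms.
set K := nth _ _ l; set C := nth _ _ m => ->.
have [ls mS] : l < size (perfect_order E) /\ m < size (perfect_order E) by move: ms; lia.
have cK : K \in cliques E by apply/sC/mem_nth.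
have cC : C \in cliques E by apply/sC/mem_nth.
have KC : K != C.
  by rewrite nth_uniq ?(perm_uniq pe) ?enum_uniq// neq_ltn lm.
have [w ww] := universal_vertex i.
have wKC : w \in K :&: C by rewrite finset.inE !(clique_mem ww).
have uKC : up_closed (E := E) (K :&: C).
  move=> a b; rewrite !finset.inE => /andP[aK aC] ba.
  by rewrite (clique_up_closed E_refl E_sym cK aK ba) (clique_up_closed E_refl E_sym cC aC ba).
have cKC : {in K :&: C &, forall i j, E i j}.
  move=> a b; rewrite !finset.inE => /andP[aK _] /andP[bK _].
  exact: (clique_complete cK).
have [j jKC e] := branch_bottom wKC cKC uKC.
exists j; split=> //; first by rewrite upto_class.
rewrite endpoint_class; apply/negP => /forallP h; move/negP: KC; apply.
move: (cC) (cK); rewrite !finset.inE => /maxsetP[_ mC] /maxsetP[cmK _].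
apply/eqP/mC => //; apply/fintype.subsetP => k kC.
have jC : j \in C by move: jKC; rewrite finset.inE => /andP[].
suff : k \in K :&: C by rewrite finset.inE => /andP[].
rewrite e finset.inE; have /orP[//|jk] := adj_arr (clique_complete cC kC jC).
exact: (implyP (h k)).
Qed.

End connected.
End hasse_tree.

(** * Exponents attached to vertices *)

Section weights.
Local Open Scope set_scope.
Local Open Scope ring_scope.

Lemma sum_count_mem (R : pzSemiRingType) (T : finType) (l : seq T) (F : T -> R) :
  \sum_(x <- l) F x = \sum_x (count_mem x l)%:R * F x.
Proof.
elim: l => [|y l IH]; first by rewrite big_nil big1// => x _; rewrite mul0r.
rewrite big_cons IH /=; under [RHS]eq_bigr do rewrite natrD mulrDl.
rewrite big_split/=; congr (_ + _); rewrite (bigD1 y)//= eqxx mul1r big1 ?addr0// => x xy.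
by rewrite eq_sym (negbTE xy) mul0r.
Qed.

Lemma extend_sum (R : realType) (T : finType) (Q : pred T) (f : {x | Q x} -> R) x :
  extend f x = \sum_(y : {x | Q x} | val y == x) f y.
Proof.
rewrite /extend; case: insubP => [y _ <-|nQ] /=.
  by rewrite (big_pred1 y)// => z; rewrite (inj_eq val_inj).
by rewrite big_pred0// => z; apply: contraNF nQ => /eqP <-; exact: valP.
Qed.

Context {R : realType} {r : nat} {E : rel 'I_r}.
Hypothesis E_refl : reflexive E.
Hypothesis E_sym : symmetric E.
Hypothesis E_hom : homogeneous E.
Implicit Types (a : clique E -> R) (b : minsep E -> R) (i j : 'I_r).

(** The exponent that vertex [i] receives in [H_G] once the block determinants are products over
    vertices. *)
Definition weight a b i : R :=
  \sum_(C : clique E | i \in val C) a C -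
  \sum_(S : minsep E | i \in val S) (nu E (val S))%:R * b S.

Lemma sum_cliques (Q : pred {set 'I_r}) (F : {set 'I_r} -> R) :
  \sum_(C : clique E | Q (val C)) F (val C) = \sum_(C in cliques E | Q C) F C.
Proof. by rewrite big_sub_cond. Qed.

Lemma sum_minseps (Q : pred {set 'I_r}) (F : {set 'I_r} -> R) :
  \sum_(S : minsep E | Q (val S)) (nu E (val S))%:R * F (val S) =
  \sum_(S <- separators E | Q S) F S.
Proof.
rewrite -(big_sub_cond (mem (separators E)) Q (fun S => (nu E S)%:R * F S)).
rewrite [RHS]big_mkcond sum_count_mem [LHS]big_mkcond; apply: eq_bigr => S _ /=.
have [Sl|Sl] := boolP (S \in separators E) => /=.
  by case: ifP => //; rewrite mulr0.
by rewrite (count_memPn Sl) mul0r.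
Qed.

(** Each clique or separator is the branch of exactly one node, which lies above or at [u] in the
    order of the tree exactly when [i] is in the set. [extend] gives 0 to nodes whose branch is not
    of the required kind. *)
Lemma rho_weight a b u i : u \in classesT E -> i \in u -> rho a b u = weight a b i.
Proof.
move=> uT iu; have ui := classesT_eq E_refl uT iu.
have branch (S : {set 'I_r}) (Q : pred {set 'I_r}) j :
    S = upto E (arrow_class E j) -> Q (arrow_class E j) -> forall F : R,
    \sum_(t in classesT E | Q t && preceq E u t && (S == upto E t)) F =
    if i \in S then F else 0.
  move=> Sj Qj F; have cj : arrow_class E j \in classesT E := arrow_class_mem j.
  have iS : (i \in S) = preceq E u (arrow_class E j).
    by rewrite Sj ui preceq_class// upto_class// finset.inE.
  rewrite iS; case: ifP => ut.
    rewrite (big_pred1 (arrow_class E j))// => t; apply/andP/eqP => [[tT]|->].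
      by rewrite Sj => /andP[_ /eqP/(upto_inj E_refl cj tT)].
    by rewrite cj Qj ut Sj eqxx.
  rewrite big_pred0// => t; apply/negP => /andP[tT /andP[/andP[_ ut']]].
  by rewrite Sj => /eqP/(upto_inj E_refl cj tT) tj; rewrite tj ut' in ut.
rewrite /rho /weight; congr (_ - _).
  under eq_bigr => t _ do rewrite extend_sum big_mkcond.
  rewrite exchange_big/= [RHS]big_mkcond; apply: eq_bigr => C _.
  rewrite -big_mkcondr/=.
  have [j [_ Cj ej]] := clique_branch E_refl E_sym E_hom i (valP C).
  rewrite -(branch (val C) (endpoint E) j Cj ej).
  by apply: eq_bigl => t; rewrite !andbA.
under eq_bigr => t _ do rewrite extend_sum big_distrr/= big_mkcond.
rewrite exchange_big/= [RHS]big_mkcond; apply: eq_bigr => S _.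
rewrite -big_mkcondr/=.
have [j [_ Sj ej]] := separator_branch E_refl E_sym E_hom i (valP S).
rewrite -(branch (val S) (fun t => ~~ endpoint E t) j Sj ej).
rewrite (eq_bigl (fun t => [&& t \in classesT E, ~~ endpoint E t && preceq E u t & val S == upto E t])).
  by apply: eq_bigr => t /and3P[_ _ /eqP <-].
by move=> t; rewrite !andbA.
Qed.

(** For [i] in [S], [#|S|] counts the [j] with [{i, j}] inside [S], and the extra 1 counts [{i}]. *)
Lemma sum_size_succ (l : seq {set 'I_r}) i :
  (\sum_(S <- l | i \in S) #|S|.+1 =
   count (fun S : {set 'I_r} => [set i] \subset S) l +
   \sum_j count (fun S : {set 'I_r} => [set i; j] \subset S) l)%N.
Proof.
under [X in (_ = _ + X)%N]eq_bigr do rewrite -sum1_count big_mkcond.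
rewrite exchange_big/= -sum1_count [X in (_ = X + _)%N]big_mkcond [LHS]big_mkcond -big_split/=.
apply: eq_bigr => S _; rewrite finset.sub1set; case: ifP => iS.
  rewrite add1n -sum1_card big_mkcond; congr _.+1; apply: eq_bigr => j _.
  by rewrite finset.subUset !finset.sub1set iS.
by rewrite big1// => j _; rewrite finset.subUset finset.sub1set iS.
Qed.

(** Cliques minus separators containing a complete set is 1; this is applied to [{i}] and to each
    [{i, j}] with [j] in the closed neighbourhood. *)
Lemma weight_size i :
  weight (fun C => #|val C|.+1%:R / 2) (fun S => #|val S|.+1%:R / 2) i =
  #|star (E := E) i|.+1%:R / 2.
Proof.
rewrite /weight (sum_cliques (fun C => i \in C) (fun S => #|S|.+1%:R / 2)).
rewrite (sum_minseps (fun S => i \in S) (fun S => #|S|.+1%:R / 2)).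
rewrite -!mulr_suml -mulrBl; congr (_ / _).
apply/eqP; rewrite subr_eq -!natr_sum -natrD eqr_nat; apply/eqP.
have [pe _] := perfect_orderP E_refl E_sym E_hom.
rewrite -big_enum_cond -(perm_big _ pe) !sum_size_succ.
rewrite -(count_perfect_order E_refl E_sym E_hom).
under eq_bigr => j _ do rewrite -(count_perfect_order E_refl E_sym E_hom).
rewrite big_split/=.
have -> : complete_set E [set i].
  by apply/complete_setP => j k; rewrite !finset.inE => /eqP -> /eqP ->.
have -> : (\sum_j complete_set E [set i; j] = #|star (E := E) i|)%N.
  rewrite -sum1_card [RHS]big_mkcond; apply: eq_bigr => j _.
  rewrite finset.inE; have [ij|ij] := boolP (E i j).
    have -> //: complete_set E [set i; j].
    by apply/complete_setP => k l; rewrite !finset.inE => /orP[]/eqP -> /orP[]/eqP ->//; rewrite E_sym.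
  suff -> : complete_set E [set i; j] = false by [].
  apply: contraNF ij => /complete_setP; apply; first by rewrite !finset.inE eqxx.
  by rewrite !finset.inE eqxx orbT.
rewrite [nat_of_bool true]/=; set c := count _ _; set m := (\sum_(j < r) _)%N.
by rewrite addnA addn1 addSn addnC addnS.
Qed.

End weights.

(** * Ancestors and descendants within a class *)

Section class_counting.
Local Open Scope set_scope.
Local Open Scope nat_scope.
Context {r : nat} {E : rel 'I_r}.
Hypothesis E_refl : reflexive E.
Hypothesis E_sym : symmetric E.
Hypothesis E_hom : homogeneous E.
Implicit Types (i j k l : 'I_r) (u v : {set 'I_r}).
Local Notation P := (@anc_rel r E).
Local Notation rank := (@rank r E).

Definition preds k : {set 'I_r} := [set j | P j k && (k != j)].
Definition succs k : {set 'I_r} := [set l | P k l && (l != k)].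

(** The number of later members of [u] takes each value below [#|u|] once; this produces the
    half-integer shifts of [multi_Gamma]. *)
Lemma big_rank (M : Type) (idx : M) (op : Monoid.com_law idx) (u : {set 'I_r}) (F : nat -> M) :
  \big[op/idx]_(k in u) F #|[set l in u | rank k < rank l]| = \big[op/idx]_(j < #|u|) F j.
Proof.
pose f k := #|[set l in u | rank k < rank l]|.
have f_lt k k' : k' \in u -> rank k < rank k' -> f k' < f k.
  move=> k'u kk'; apply: proper_card; apply/properP; split.
    apply/fintype.subsetP => l; rewrite !finset.inE => /andP[-> h].
    exact: ltn_trans h.
  by exists k'; rewrite !finset.inE ?k'u ?kk'// ltnn andbF.
have f_inj : {in u &, injective f}.
  move=> k k' ku k'u fkk'; apply: (@rank_inj _ E).
  have [h|h|//] := ltngtP (rank k) (rank k').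
    by have := f_lt _ _ k'u h; rewrite fkk' ltnn.
  by have := f_lt _ _ ku h; rewrite fkk' ltnn.
have fu k : k \in u -> f k < #|u|.
  move=> ku; apply: proper_card; apply/properP; split.
    by apply/fintype.subsetP => l; rewrite finset.inE => /andP[].
  by exists k => //; rewrite finset.inE ltnn andbF.
case En : #|u| => [|n].
  by move/eqP: En; rewrite cards_eq0 => /eqP ->; rewrite big_set0 big_ord0.
pose g k : 'I_n.+1 := inord (f k).
have gf k : k \in u -> g k = f k :> nat by move=> ku; rewrite inordK// -En fu.
have g_inj : {in u &, injective g}.
  move=> k k' ku k'u /(congr1 val) /=; rewrite !gf//; exact: f_inj.
have gT : g @: u = [set: 'I_n.+1].
  by apply/eqP; rewrite eqEcard finset.subsetT cardsT card_ord card_in_imset// En leqnn.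
transitivity (\big[op/idx]_(j in g @: u) F j); last first.
  by rewrite gT; apply: eq_bigl => j; rewrite finset.inE.
rewrite big_imset//=; apply: eq_bigr => k ku; by rewrite gf.
Qed.

Lemma card_star k : #|star (E := E) k| = (#|preds k| + #|succs k|).+1.
Proof.
have -> : star (E := E) k = k |: (preds k :|: succs k).
  apply/setP => j; rewrite !finset.inE (adj_anc E_sym).
  have [->|jk] := eqVneq j k; first by rewrite /anc_rel E_refl leqnn.
  by rewrite /= !andbT orbC.
rewrite cardsU1 !finset.inE eqxx !andbF /= add1n cardsU.
suff -> : preds k :&: succs k = finset.set0 by rewrite cards0 subn0.
apply/setP => j; rewrite !finset.inE; apply/negP => /andP[/andP[jk kj] /andP[kj' _]].
by move: kj; rewrite (tree_asym (anc_tree E_refl E_sym E_hom) jk kj') eqxx.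
Qed.

Lemma sum_prec_above k :
  \sum_(v in classesT E | prec E (arrow_class E k) v) #|v| =
  #|[set j | arrow E k j && ~~ arrow E j k]|.
Proof.
rewrite sum_classes//; congr #|pred_of_set _|; apply/setP => j.
by rewrite !finset.inE prec_class.
Qed.

Lemma sum_prec_below k :
  \sum_(v in classesT E | prec E v (arrow_class E k)) #|v| = #|below E (arrow_class E k)|.
Proof.
rewrite (sum_classes E_refl (fun v => prec E v (arrow_class E k))) below_class//.
by congr #|pred_of_set _|; apply/setP => j; rewrite !finset.inE prec_class.
Qed.

Lemma sum_preceq k :
  \sum_(v in classesT E | preceq E (arrow_class E k) v) #|v| =
  #|[set j | arrow E k j]|.
Proof.
rewrite sum_classes//; congr #|pred_of_set _|; apply/setP => j.
by rewrite !finset.inE preceq_class.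
Qed.

Lemma card_preds k :
  #|preds k| = #|below E (arrow_class E k)| +
               #|[set l in arrow_class E k | rank l < rank k]|.
Proof.
have PT := anc_tree E_refl E_sym E_hom.
rewrite below_class// -[RHS]subn0 -[in RHS](cards0 'I_r).
rewrite (_ : finset.set0 = [set i | arrow E i k && ~~ arrow E k i] :&:
   [set l in arrow_class E k | rank l < rank k]); last first.
  apply/setP => l; rewrite !finset.inE; apply/esym/negP => /andP[/andP[_ /negP h]].
  by case/andP => /andP[].
rewrite -cardsU; congr #|pred_of_set _|; apply/setP => l; rewrite !finset.inE.
apply/idP/idP => [/andP[lk nkl]|].
  have alk := anc_arrow E_refl E_sym E_hom lk.
  rewrite alk /=; case: (arrow E k l) => //=.
  by apply: (tree_rk PT lk); rewrite eq_sym.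
case/orP => [/andP[lk kl]|/andP[/andP[kl lk] rlk]].
  have rlk := arrow_rank E_refl lk kl.
  rewrite /anc_rel (arrow_adj E_refl lk) (ltnW rlk)/=.
  by apply: contraTneq rlk => ->; rewrite ltnn.
rewrite /anc_rel (arrow_adj E_refl lk) (ltnW rlk)/=.
by apply: contraTneq rlk => ->; rewrite ltnn.
Qed.

Lemma card_succs k :
  #|succs k| = #|[set j | arrow E k j && ~~ arrow E j k]| +
               #|[set l in arrow_class E k | rank k < rank l]|.
Proof.
have PT := anc_tree E_refl E_sym E_hom.
rewrite -[RHS]subn0 -[in RHS](cards0 'I_r).
rewrite (_ : finset.set0 = [set j | arrow E k j && ~~ arrow E j k] :&:
   [set l in arrow_class E k | rank k < rank l]); last first.
  apply/setP => l; rewrite !finset.inE; apply/esym/negP => /andP[/andP[_ /negP h]].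
  by case/andP => /andP[].
rewrite -cardsU; congr #|pred_of_set _|; apply/setP => l; rewrite !finset.inE.
apply/idP/idP => [/andP[kl nlk]|].
  have akl := anc_arrow E_refl E_sym E_hom kl.
  rewrite akl /=; case: (arrow E l k) => //=.
  by apply: (tree_rk PT kl); rewrite eq_sym.
case/orP => [/andP[kl lk]|/andP[/andP[kl lk] rlk]].
  have rlk := arrow_rank E_refl kl lk.
  rewrite /anc_rel (arrow_adj E_refl kl) (ltnW rlk)/=.
  by apply: contraTneq rlk => ->; rewrite ltnn.
rewrite /anc_rel (arrow_adj E_refl kl) (ltnW rlk)/=.
by apply: contraTneq rlk => ->; rewrite ltnn.
Qed.

(** The two terms account for the two powers of [pi]: the one between classes, and the one inside
    [multi_Gamma]. *)
Lemma sum_preds u : u \in classesT E ->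
  \sum_(k in u) #|preds k| = #|u| * #|below E u| + 'C(#|u|, 2).
Proof.
move=> uT; have E1 k : k \in u -> #|preds k| = #|below E u| + #|[set l in u | rank l < rank k]|.
  by move=> ku; rewrite card_preds -(classesT_eq E_refl uT ku).
rewrite (eq_bigr _ E1) big_split/= sum_nat_const; congr (_ + _).
rewrite -triangular_sum big_mkord -(big_rank _ u id).
under eq_bigr => k _ do rewrite -sum1_card; under [RHS]eq_bigr => k _ do rewrite -sum1_card.
rewrite (exchange_big_dep (mem u))/=; last by move=> k l _; rewrite finset.inE => /andP[].
apply: eq_bigr => l lu; apply: eq_bigl => k; by rewrite !finset.inE lu.
Qed.

Lemma succs_le u k : u \in classesT E -> k \in u ->
  #|succs k| < \sum_(v in classesT E | preceq E u v) #|v|.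
Proof.
move=> uT ku; rewrite (classesT_eq E_refl uT ku) sum_preceq; apply: proper_card.
apply/properP; split.
  by apply/fintype.subsetP => l; rewrite !finset.inE => /andP[/(anc_arrow E_refl E_sym E_hom)].
by exists k; rewrite !finset.inE ?eqxx ?andbF// arrow_refl.
Qed.

(** The first vertex of a class has all the others below it; this is the origin of the [- 1] in the
    convergence condition. *)
Lemma succs_max u : u \in classesT E -> exists2 k, k \in u &
  #|succs k|.+1 = \sum_(v in classesT E | preceq E u v) #|v|.
Proof.
move=> uT; have /classesTP[i ui] := uT.
have iu : i \in u by rewrite ui mem_arrow_class.
have [k ku kmin] := @arg_minnP 'I_r i (mem u) rank iu.
exists k => //; rewrite (classesT_eq E_refl uT ku) sum_preceq.
have -> : [set j | arrow E k j] = k |: succs k.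
  apply/setP => l; rewrite !finset.inE; have [->|lk] /= := eqVneq l k; first by rewrite arrow_refl.
  rewrite andbT; apply/idP/idP => [kl|/(anc_arrow E_refl E_sym E_hom)//].
  rewrite /anc_rel (arrow_adj E_refl kl)/=.
  have [lk'|/(arrow_rank E_refl kl)/ltnW//] := boolP (arrow E l k).
  by apply: kmin; rewrite (classesT_eq E_refl uT ku) !finset.inE kl.
by rewrite cardsU1 !finset.inE eqxx andbF.
Qed.

End class_counting.

(** * Coordinates of the cone *)

Section coordinates.
Context {R : realType} {r : nat} {E P : rel 'I_r} {rk : 'I_r -> nat}.
Hypothesis PT : tree_order P rk.
Hypothesis EP : forall i j, E i j = P i j || P j i.
Implicit Types (i j k : 'I_r).
Local Notation N := #|{: upper_edge E}|.
Implicit Types (t : N.-tuple R) (e : 'I_N).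

Let E_sym i j : E i j = E j i. Proof. by rewrite !EP orbC. Qed.

(** Coordinates are indexed by pairs in increasing index order, which may disagree with the order of
    the tree. *)
Definition ends e : 'I_r * 'I_r :=
  let p := val (enum_val e) in if P p.1 p.2 then (p.2, p.1) else p.

(* The pair of vertices indexed by [e] is [(hi e, lo e)], with [lo e] the ancestor. *)
Definition hi e := (ends e).1.
Definition lo e := (ends e).2.

Lemma lo_hi e : P (lo e) (hi e).
Proof.
rewrite /lo /hi /ends; case: ifP => //= h.
by have /andP[_] := valP (enum_val e); rewrite EP h.
Qed.

Lemma ZG_mx_sym t i j : ZG_mx t i j = ZG_mx t j i.
Proof.
by rewrite !mxE; case: (ltngtP i j) => // /val_inj ->.
Qed.

Lemma ZG_mx_notE t i j : ~~ E i j -> ZG_mx t i j = 0.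
Proof.
move=> nE; rewrite mxE /extend insubF//=; apply/negP => /andP[_].
by case: leqP => _ /=; rewrite ?[E j i]E_sym; exact/negP.
Qed.

Lemma tnth_ZG_mx t e : tnth t e = ZG_mx t (hi e) (lo e).
Proof.
have /andP[le Ee] := valP (enum_val e).
have -> : ZG_mx t (hi e) (lo e) = ZG_mx t (val (enum_val e)).1 (val (enum_val e)).2.
  by rewrite /hi /lo /ends; case: ifP => //= _; rewrite ZG_mx_sym.
by rewrite mxE le /extend -surjective_pairing valK /= enum_valK.
Qed.

Lemma ends_inj : injective ends.
Proof.
move=> e f; have /andP[le _] := valP (enum_val e); have /andP[lf _] := valP (enum_val f).
rewrite /ends => h; apply/enum_val_inj/val_inj.
case: (val (enum_val e)) (val (enum_val f)) le lf h => [a b] [c d] /= ab cd.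
case: ifP => pab; case: ifP => pcd [h1 h2]; subst => //.
- have e1 : c = d by apply/val_inj/eqP; rewrite eqn_leq ab cd.
  by rewrite e1.
- have e1 : c = d by apply/val_inj/eqP; rewrite eqn_leq ab cd.
  by rewrite e1.
Qed.

Lemma ends_surj i j : P j i -> exists e, ends e = (i, j).
Proof.
move=> ji; pose p := if (i <= j)%N then (i, j) else (j, i).
have pU : (p.1 <= p.2)%N && E p.1 p.2.
  by rewrite /p; case: (leqP i j) => h /=; rewrite ?h ?(ltnW h) EP ji ?orbT.
exists (enum_rank (Sub p pU : upper_edge E)); rewrite /ends enum_rankK SubK /p.
case: (leqP i j) => /= ij; last by rewrite ji.
case: ifP => // pij; by rewrite (tree_asym PT pij ji).
Qed.

Lemma eq_ZG_mx t (Y : 'M[R]_r) : (forall i j, ~~ E i j -> Y i j = 0) ->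
  (forall i j, Y i j = Y j i) -> (forall e, tnth t e = Y (hi e) (lo e)) ->
  ZG_mx t = Y.
Proof.
move=> Y0 Ys tY; apply/matrixP => i j.
have main k m : P m k -> ZG_mx t k m = Y k m.
  move=> mk; have [e he] := ends_surj mk.
  by have := tY e; rewrite tnth_ZG_mx /hi /lo he.
have [Eij|nE] := boolP (E i j); last by rewrite ZG_mx_notE ?Y0.
move: Eij; rewrite EP => /orP[ij|/main//].
by rewrite ZG_mx_sym Ys main.
Qed.

(** The coordinates of a symmetric matrix reread as those of a triangular one, so that [gram]
    becomes a self-map of the space of tuples. *)
Definition lower_part t : 'M[R]_r := \matrix_(i, j) if P j i then ZG_mx t i j else 0.

Lemma lower_part_lower t : lower P (lower_part t).
Proof. by move=> i j /negbTE ji; rewrite mxE ji. Qed.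

Lemma lower_part_ends t e : lower_part t (hi e) (lo e) = tnth t e.
Proof. by rewrite mxE lo_hi tnth_ZG_mx. Qed.

Lemma measurable_lower_part i j : measurable_fun setT (fun t => lower_part t i j).
Proof.
have [ji|ji] := boolP (P j i).
  have [e he] := ends_surj ji.
  have -> : (fun t => lower_part t i j) = (fun t => tnth t e).
    by apply/funext => t; rewrite -lower_part_ends /hi /lo he.
  exact: measurable_tnth.
have -> : (fun t => lower_part t i j) = cst 0.
  by apply/funext => t; rewrite lower_part_lower.
exact: measurable_cst.
Qed.

(** Lexicographic order on [(rk (hi e), rk (lo e))], coded in one number. *)
Definition edge_rank e := (rk (hi e) * (\max_i rk i).+1 + rk (lo e))%N.

Lemma eq_lower_part e t t' i j :
  (forall f, (edge_rank e < edge_rank f)%N -> tnth t f = tnth t' f) ->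
  (rk (hi e) < rk i)%N || (rk (hi e) == rk i) && (rk (lo e) < rk j)%N ->
  lower_part t i j = lower_part t' i j.
Proof.
move=> tt' rij; have [ji|ji] := boolP (P j i); last by rewrite !lower_part_lower.
have [f hf] := ends_surj ji.
have iE : i = hi f by rewrite /hi hf.
have jE : j = lo f by rewrite /lo hf.
move: rij; rewrite iE jE !lower_part_ends => rij; apply: tt'; rewrite /edge_rank.
have le k : (rk k <= \max_i rk i)%N by exact: leq_bigmax.
have := le (lo e); have := le (lo f); set M := \max_i rk i => l1 l2.
by case/orP: rij => [h|/andP[/eqP -> h]]; [nia|rewrite ltn_add2l].
Qed.

(** Nonzero terms have [k] strictly below [hi e] in the tree, that is, in rows of larger rank. *)
Definition gram_shift e t : R :=
  \sum_(k | k != hi e) lower_part t k (hi e) * lower_part t k (lo e) / lower_part t k k.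

(** For lower [L], nonzero terms stay in row [hi e] but have [m] strictly below [lo e], that is, in
    columns of larger rank. *)
Definition mul_shift (L : 'M[R]_r) e t : R :=
  \sum_(m | m != lo e) lower_part t (hi e) m * L m (lo e).

Lemma measurable_gram_shift e : measurable_fun setT (gram_shift e).
Proof.
rewrite (_ : gram_shift e = fun t => \sum_k if k != hi e then
  lower_part t k (hi e) * lower_part t k (lo e) / lower_part t k k else 0); last first.
  by apply/funext => t; exact: big_mkcond.
apply: measurable_sum => k; case: (k != hi e); last exact: measurable_cst.
apply: measurable_funM.
  by apply: measurable_funM; exact: measurable_lower_part.
exact: (measurableT_comp measurable_inv (measurable_lower_part k k)).
Qed.

Lemma measurable_mul_shift L e : measurable_fun setT (mul_shift L e).
Proof.
rewrite (_ : mul_shift L e = fun t => \sum_m if m != lo e then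
  lower_part t (hi e) m * L m (lo e) else 0); last first.
  by apply/funext => t; exact: big_mkcond.
apply: measurable_sum => k; case: (k != lo e); last exact: measurable_cst.
by apply: measurable_funM; [exact: measurable_lower_part|exact: measurable_cst].
Qed.

Lemma gram_shift_rank e t t' :
  (forall f, (edge_rank e < edge_rank f)%N -> tnth t f = tnth t' f) ->
  gram_shift e t = gram_shift e t'.
Proof.
move=> tt'; apply: eq_bigr => k ke.
have [hk|hk] := boolP (P (hi e) k); last by rewrite !(lower_part_lower _ hk) !mul0r.
have rke : (rk (hi e) < rk k)%N by apply: tree_rk PT _ _ hk _; rewrite eq_sym.
by rewrite !(eq_lower_part (t' := t') (e := e))// rke.
Qed.

Lemma mul_shift_rank L e t t' : lower P L ->
  (forall f, (edge_rank e < edge_rank f)%N -> tnth t f = tnth t' f) ->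
  mul_shift L e t = mul_shift L e t'.
Proof.
move=> lL tt'; apply: eq_bigr => m me.
have [lm|lm] := boolP (P (lo e) m); last by rewrite (lL _ _ lm) !mulr0.
have rme : (rk (lo e) < rk m)%N by apply: tree_rk PT _ _ lm _; rewrite eq_sym.
by rewrite (eq_lower_part (t' := t') (e := e))// eqxx rme orbT.
Qed.

Lemma ZG_mx_shear_gram t : (forall k, lower_part t k k != 0) ->
  ZG_mx (shear gram_shift t) = gram (lower_part t).
Proof.
move=> t0; apply: eq_ZG_mx => [i j nE|i j|e].
- rewrite gramE big1// => k _.
  have [ik|ik] := boolP (P i k); last by rewrite (lower_part_lower _ ik) !mul0r.
  have [jk|jk] := boolP (P j k); last by rewrite (lower_part_lower _ jk) mulr0 mul0r.
  by move: nE; rewrite EP (tree_chain PT ik jk).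
- by rewrite -[in LHS]gram_sym mxE.
- rewrite tnth_shear gramE (bigD1 (hi e))//= -lower_part_ends; congr (_ + _).
  by rewrite mulrAC mulfV ?mul1r.
Qed.

Lemma lower_part_shear_mul L t : unitlower P L ->
  lower_part (shear (mul_shift L) t) = lower_part t *m L.
Proof.
move=> uL; apply/matrixP => i j.
have [ji|ji] := boolP (P j i); last first.
  by rewrite lower_part_lower// (lower_mul PT (@lower_part_lower t) uL.1).
have [e he] := ends_surj ji.
have -> : i = hi e by rewrite /hi he.
have -> : j = lo e by rewrite /lo he.
by rewrite lower_part_ends tnth_shear mxE (bigD1 (lo e))//= uL.2 mulr1 lower_part_ends.
Qed.

(* The composite of the two shears is the unipotent change of variables
   [y = gram (T L)], where [T] is the lower part of [s]. *)
Lemma integral_ZG_mx (F : 'M[R]_r -> \bar R) L t : unitlower P L ->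
  measurable_fun setT (F \o @ZG_mx R r E) -> (forall y, 0 <= F y)%E ->
  (\int[lebesgue_tuple R N]_s F (ZG_mx s) =
   iint (enum 'I_N) (fun s => F (ZG_mx (shear gram_shift (shear (mul_shift L) s)))) t)%E.
Proof.
move=> uL mF F0.
rewrite (integral_lebesgue_tuple t mF) ?F0//; last by move=> s; exact: F0.
rewrite -(@iint_shear _ _ _ edge_rank measurable_gram_shift gram_shift_rank _ mF)//; last first.
  by move=> s; exact: F0.
rewrite -(@iint_shear _ _ (mul_shift L) edge_rank)//.
- exact: measurable_mul_shift.
- by move=> e s s'; apply: mul_shift_rank uL.1.
- exact: (measurableT_comp mF (measurable_shear measurable_gram_shift)).
- by move=> s; exact: F0.
Qed.

End coordinates.

Section edge_products.
Context {r : nat} {E P : rel 'I_r} {rk : 'I_r -> nat}.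
Hypothesis PT : tree_order P rk.
Hypothesis EP : forall i j, E i j = P i j || P j i.
Local Notation N := #|{: upper_edge E}|.
Implicit Types (e : 'I_N) (i j k : 'I_r).
Local Notation hi := (hi (E := E) (P := P)).
Local Notation lo := (lo (E := E) (P := P)).

Lemma prod_edges (T : Type) (idx : T) (op : Monoid.com_law idx)
    (Q : 'I_r -> 'I_r -> bool) (F : 'I_r -> 'I_r -> T) :
  \big[op/idx]_(e | Q (hi e) (lo e)) F (hi e) (lo e) =
  \big[op/idx]_k \big[op/idx]_(j | P j k && Q k j) F k j.
Proof.
rewrite pair_big_dep /=.
pose A : {set 'I_N} := [set e | Q (hi e) (lo e)]%SET.
have -> : \big[op/idx]_(p | P p.2 p.1 && Q p.1 p.2) F p.1 p.2 =
    \big[op/idx]_(p in [set ends (P := P) e | e in A]%SET) F p.1 p.2.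
  apply: eq_bigl => p; apply/idP/imsetP => [/andP[Pp Qp]|[e eA ->]].
    have [e he] := ends_surj PT EP Pp; exists e.
      by rewrite finset.inE /hi /lo he.
    by rewrite he -surjective_pairing.
  by move: eA; rewrite finset.inE => ->; rewrite (lo_hi EP).
rewrite big_imset; last by move=> e f _ _ h; exact: ends_inj h.
by apply: eq_bigl => e; rewrite finset.inE.
Qed.

Lemma prod_loops (T : Type) (idx : T) (op : Monoid.com_law idx) (F : 'I_r -> T) :
  \big[op/idx]_(e | hi e == lo e) F (hi e) = \big[op/idx]_k F k.
Proof.
rewrite (prod_edges op (fun i j => i == j) (fun i _ => F i)); apply: eq_bigr => k _.
rewrite (big_pred1 k)// => j; rewrite /= eq_sym; case: eqVneq => [->|]; rewrite ?andbF ?andbT//.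
exact: tree_refl PT _.
Qed.

End edge_products.

(** * The integral *)

Section density.
Context {R : realType} {r : nat} {E : rel 'I_r}.
Hypothesis E_refl : reflexive E.
Hypothesis E_sym : symmetric E.
Hypothesis E_hom : homogeneous E.
Implicit Types (i j k : 'I_r) (S : {set 'I_r}) (X : 'M[R]_r).
Implicit Types (a : clique E -> R) (b : minsep E -> R).

Local Notation P := (@anc_rel r E).
Let PT : tree_order P (@rank r E) := anc_tree E_refl E_sym E_hom.
Let EP : forall i j, E i j = P i j || P j i := adj_anc E_sym.

Definition branch S := {in S &, forall i j, E i j} /\ ancestral P S.

Lemma branch_clique (C : clique E) : branch (val C).
Proof.
split; first exact: clique_complete (valP C).
apply: (up_closed_ancestral E_refl E_sym E_hom).
exact: (clique_up_closed E_refl E_sym (valP C)).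
Qed.

Lemma branch_anc i : branch [set j | P j i]%SET.
Proof.
split=> [j k|j k]; rewrite !finset.inE; last by move=> ji kj; exact: (tree_trans PT kj ji).
by move=> ji ki; rewrite EP (tree_chain PT ji ki).
Qed.

Lemma branch_minsep (S : minsep E) : branch (val S).
Proof.
have [S0|[i iS]] := set_0Vmem (val S).
  by rewrite S0; split=> i j; rewrite finset.inE.
have [j [Sj _ _]] := separator_branch E_refl E_sym E_hom i (valP S).
split=> [k l|k l]; rewrite Sj !finset.inE.
  by move=> /arrowP kj /(arrow_adj E_refl) lj; apply: kj => //; rewrite E_sym.
move=> kj lk; apply: (arrow_trans E_refl _ kj).
exact: (anc_arrow E_refl E_sym E_hom).
Qed.

(** Logarithms of the vertex factors: real powers of determinants then become linear in the
    exponent. *)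
Definition block_dets X (l : 'I_r -> R) :=
  forall S, branch S -> \det (block S S X) = expR (\sum_(i in S) l i).

Lemma prod_dets_powR (I : finType) (F : I -> {set 'I_r}) (c : I -> R) X l :
  block_dets X l -> (forall x, branch (F x)) ->
  \prod_x \det (block (F x) (F x) X) `^ c x =
  expR (\sum_i (\sum_(x | i \in F x) c x) * l i).
Proof.
move=> hX bF; under eq_bigr => x _ do
  rewrite (hX _ (bF x)) /powR gt_eqF ?expR_gt0// expRK mulr_sumr big_mkcond.
rewrite -expR_sum exchange_big/=; congr expR; apply: eq_bigr => i _.
by rewrite mulr_suml [RHS]big_mkcond.
Qed.

Lemma H_G_weight a b (x : edge E -> R) l : block_dets (fill x) l ->
  H_G a b x = expR (\sum_i weight a b i * l i).
Proof.
move=> hx; rewrite /H_G (prod_dets_powR _ hx branch_clique).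
rewrite (prod_dets_powR _ hx branch_minsep) -expRN -expRD -sumrN -big_split/=.
by congr expR; apply: eq_bigr => i _; rewrite mulrBl.
Qed.

Lemma nuG_density_star (y : 'M[R]_r) l : block_dets (fill (phi (E := E) y)) l ->
  nuG_density E y = expR (\sum_i #|star (E := E) i|.+1%:R / 2 * l i).
Proof.
move=> hy; rewrite /nuG_density (prod_dets_powR _ hy branch_clique).
rewrite (prod_dets_powR _ hy branch_minsep) -expRD -big_split/=.
congr expR; apply: eq_bigr => i _; rewrite -weight_size// -mulrDl; congr (_ * _).
by rewrite /weight -sumrN; congr (_ + _); apply: eq_bigr => S _; rewrite mulNr.
Qed.

Lemma fillE (x : edge E -> R) i j (ij : E i j) : fill x i j = x (Sub (i, j) ij).
Proof. by rewrite mxE /extend insubT. Qed.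

Lemma fill_notE (x : edge E -> R) i j : ~~ E i j -> fill x i j = 0.
Proof. by move=> ij; rewrite mxE /extend insubN. Qed.

Lemma block_fill_phi S (y : 'M[R]_r) : branch S ->
  block S S (fill (phi (E := E) y)) = block S S (invmx y).
Proof.
move=> [cS _]; apply/matrixP => i j; rewrite [LHS]mxE [RHS]mxE.
by rewrite fillE ?cS ?enum_valP// => ij; rewrite /phi SubK.
Qed.

Lemma pairing_fill (x : edge E -> R) y :
  pairing x y = \sum_i \sum_j fill x i j * y i j.
Proof.
rewrite pair_bigA/= (bigID (fun p => E p.1 p.2))/= [X in _ = _ + X]big1 ?addr0.
  rewrite /pairing.
  have := big_sub (fun p : 'I_r * 'I_r => E p.1 p.2) (fun p => fill x p.1 p.2 * y p.1 p.2).
  move=> ->; apply: eq_bigr => -[[i j] ij] _ /=.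
  by rewrite (fillE x ij).
by move=> [i j] /= ij; rewrite fill_notE ?mul0r.
Qed.

Lemma pairing_trace (x : edge E -> R) y : y^T = y -> pairing x y = \tr (fill x *m y).
Proof.
move=> ys; rewrite pairing_fill; apply: eq_bigr => i _; rewrite mxE.
apply: eq_bigr => j _; congr (_ * _).
by rewrite -[in LHS]ys mxE.
Qed.

(** The ancestors of a vertex form a complete set, so a clique contains them and [fill x] is
    positive definite there. *)
Lemma QG_reduces (x : edge E -> R) : QG x -> exists L d, reduces P L (fill x) d.
Proof.
move=> [xs xp]; apply: (exists_reduces PT xs) => i.
have cA : complete_set E [set j | P j i]%SET by apply/complete_setP; have [] := branch_anc i.
have [C mC AC] := maxset_exists cA.
apply: (pos_onS AC); apply: posdef_block_pos_on; apply: xp.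
by rewrite finset.inE.
Qed.

Lemma reduces_block_dets X L d : reduces P L X d -> block_dets X (fun i => ln (d i)).
Proof.
move=> red S [cS aS]; rewrite (det_block_reduces PT red aS) => [|i j iS jS].
  rewrite expR_sum; apply: eq_bigr => i _ /=; rewrite lnK// posrE.
  by have [] := red.
by rewrite -EP cS.
Qed.

Lemma gram_block_dets B : lower P B -> (forall i, 0 < B i i) ->
  block_dets (fill (phi (E := E) (gram B))) (fun i => - ln (B i i)).
Proof.
move=> lB Bp S [cS aS]; rewrite block_fill_phi// (det_block_inv_gram PT)//; last first.
  by move=> i; rewrite gt_eqF.
by rewrite expR_sum; apply: eq_bigr => i _; rewrite expRN lnK ?posrE.
Qed.

Definition density a b (x : edge E -> R) (y : 'M[R]_r) : R :=
  expR (- pairing x y) * H_G a b (phi y) * nuG_density E y.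

Lemma density_gram a b (x : edge E -> R) W L d : reduces P L (fill x) d ->
  lower P W -> (forall i, 0 < W i i) ->
  density a b x (gram (W *m L)) =
  \prod_k (W k k `^ (- (weight a b k + #|star (E := E) k|.+1%:R / 2)) *
           \prod_(i | P i k) expR (- (d i * W k i ^+ 2 / W k k))).
Proof.
move=> red lW Wp; have [uL _ _ _] := red.
have lB := lower_mul PT lW uL.1.
have BE i : (W *m L) i i = W i i by rewrite (lower_mul_diag PT i lW uL.1) uL.2 mulr1.
have Bp i : 0 < (W *m L) i i by rewrite BE.
have hB := gram_block_dets lB Bp.
rewrite /density (pairing_trace _ (gram_sym _)) (trace_gram PT red lW).
rewrite (H_G_weight _ _ hB) (nuG_density_star hB) -!expRD -sumrN -!big_split/=.
rewrite expR_sum; apply: eq_bigr => k _; rewrite -addrA expRD mulrC -expR_sum; congr (_ * _).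
  rewrite /powR gt_eqF// BE; congr expR; ring.
by rewrite sumrN.
Qed.

Lemma PG_ZG_mx (t : #|{: upper_edge E}|.-tuple R) : PG E (ZG_mx t) <-> posdef (ZG_mx t).
Proof.
split=> [[]//|py]; split=> //; split; first by case: py.
by move=> i j; exact: (ZG_mx_notE EP).
Qed.

End density.

(** * Measurability, and the total mass as an extended real *)

Section density_integral.
Context {R : realType} {r : nat} {E : rel 'I_r}.
Hypothesis E_sym : symmetric E.
Implicit Types (i j k : 'I_r).
Local Notation N := #|{: upper_edge E}|.
Implicit Types (s t : N.-tuple R) (e : 'I_N).

Context (a : clique E -> R) (b : minsep E -> R) (x : edge E -> R).

Definition density_on_PG (y : 'M[R]_r) : \bar R :=
  if `[< PG E y >] then (density a b x y)%:E else 0%E.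

Lemma measurable_ZG_mx : measurable_mx (@ZG_mx R r E).
Proof.
move=> i j; rewrite (_ : (fun t => ZG_mx t i j) = fun t =>
    if insub (if (i <= j)%N then (i, j) else (j, i)) is Some e
    then tnth t (enum_rank (e : upper_edge E)) else 0); last first.
  by apply/funext => t; rewrite mxE /extend; case: insub.
by case: insub => [e|]; [exact: measurable_tnth|exact: measurable_cst].
Qed.

Lemma PG_coordE : @PG_coord R r E = [set t | pos_on [set: 'I_r]%SET (ZG_mx t : 'M[R]_r)].
Proof.
apply/seteqP; split=> t /=.
  by move=> /(PG_ZG_mx E_sym) /posdefE[].
move=> h; apply/(PG_ZG_mx E_sym)/posdefE; split=> //.
by apply/matrixP => i j; rewrite mxE ZG_mx_sym.
Qed.

Lemma measurable_PG_coord : measurable (@PG_coord R r E).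
Proof.
rewrite PG_coordE; apply: measurable_pos_on; first exact: measurable_ZG_mx.
by move=> t; apply/matrixP => i j; rewrite mxE ZG_mx_sym.
Qed.

Lemma measurable_J_integrand : measurable_fun setT (J_integrand a b x).
Proof.
have mI := measurable_invmx measurable_ZG_mx.
have mF : measurable_mx (fun t => fill (phi (E := E) (ZG_mx t : 'M[R]_r))).
  move=> i j; have [ij|ij] := boolP (E i j).
    rewrite (_ : (fun t => _) = fun t => invmx (ZG_mx t) i j); first exact: mI.
    by apply/funext => t; rewrite (fillE _ ij).
  rewrite (_ : (fun t => _) = cst 0); first exact: measurable_cst.
  by apply/funext => t; rewrite (fill_notE _ ij).
have mD (S : {set 'I_r}) (c : R) : measurable_fun setT
    (fun t => \det (block S S (fill (phi (E := E) (ZG_mx t : 'M[R]_r)))) `^ c).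
  have md := measurable_det (measurable_block (A := S) (B := S) mF).
  exact: (measurableT_comp (measurable_powR c) md).
apply: measurable_funM; first apply: measurable_funM.
- apply: measurableT_comp => //; apply: measurableT_comp => //.
  by apply: measurable_sum => e; apply: measurable_funM => //; exact: measurable_ZG_mx.
- apply: measurable_funM; first by apply: measurable_prod => C _; exact: mD.
  apply: (measurableT_comp measurable_inv).
  by apply: measurable_prod => S _; exact: mD.
- apply: measurable_funM; first by apply: measurable_prod => C _; exact: mD.
  by apply: measurable_prod => S _; exact: mD.
Qed.

Lemma density_on_PG_ZG_mx : density_on_PG \o @ZG_mx R r E =
  (EFin \o J_integrand a b x) \_ (@PG_coord R r E).
Proof.
apply/funext => t; rewrite patchE /density_on_PG /=.
case: asboolP => h; first by rewrite mem_set.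
by rewrite memNset.
Qed.

Lemma measurable_density_on_PG : measurable_fun setT (density_on_PG \o @ZG_mx R r E).
Proof.
rewrite density_on_PG_ZG_mx; apply/(measurable_restrictT _ _).1.
  exact: measurable_PG_coord.
apply: measurable_funTS; apply/measurable_EFinP; exact: measurable_J_integrand.
Qed.

Lemma density_ge0 y : 0 <= density a b x y.
Proof.
rewrite !mulr_ge0 ?expR_ge0//.
- by apply: prodr_ge0 => C _; exact: powR_ge0.
- by rewrite invr_ge0; apply: prodr_ge0 => C _; exact: powR_ge0.
- by apply: prodr_ge0 => C _; exact: powR_ge0.
- by apply: prodr_ge0 => C _; exact: powR_ge0.
Qed.

Lemma density_on_PG_ge0 y : (0 <= density_on_PG y)%E.
Proof. by rewrite /density_on_PG; case: ifP => // _; rewrite lee_fin density_ge0. Qed.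

Definition total_mass : \bar R :=
  (\int[lebesgue_tuple R N]_(t in @PG_coord R r E) (J_integrand a b x t)%:E)%E.

Lemma total_massE : total_mass = (\int[lebesgue_tuple R N]_t density_on_PG (ZG_mx t))%E.
Proof.
rewrite /total_mass integral_mkcond.
by apply: eq_integral => t _; have := congr1 (fun f => f t) density_on_PG_ZG_mx.
Qed.

Lemma J_convergesE : J_converges a b x <-> (total_mass < +oo)%E.
Proof.
have E1 : (\int[lebesgue_tuple R N]_(t in @PG_coord R r E) `|(EFin \o J_integrand a b x) t| = total_mass)%E.
  apply: eq_integral => t _ /=; rewrite ger0_norm//; exact: density_ge0.
split=> [/integrableP[_]|h]; first by rewrite E1.
apply/integrableP; split; last by rewrite E1.
by apply: measurable_funTS; apply/measurable_EFinP; exact: measurable_J_integrand.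
Qed.

Lemma J_GE : J_G a b x = fine total_mass.
Proof. by []. Qed.

End density_integral.

Section product_formula.
Context {R : realType} {r : nat} {E : rel 'I_r}.
Hypothesis E_refl : reflexive E.
Hypothesis E_sym : symmetric E.
Hypothesis E_hom : homogeneous E.
Implicit Types (i j k : 'I_r).
Local Notation P := (@anc_rel r E).
Let PT : tree_order P (@rank r E) := anc_tree E_refl E_sym E_hom.
Let EP : forall i j, E i j = P i j || P j i := adj_anc E_sym.
Local Notation N := #|{: upper_edge E}|.
Implicit Types (s t : N.-tuple R) (e : 'I_N).
Local Notation hi := (hi (E := E) (P := P)).
Local Notation lo := (lo (E := E) (P := P)).
Local Notation T s := (lower_part (P := P) s).

Context (a : clique E -> R) (b : minsep E -> R) (x : edge E -> R).
Context (L : 'M[R]_r) (d : 'I_r -> R).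
Hypothesis red : reduces P L (fill x) d.

Let uL : unitlower P L. Proof. by have [] := red. Qed.

(** The term [i = k] of the exponent is [d k * c ^+ 2 / c], hence linear in the diagonal variable
    [c]. *)
Definition loop_factor k (c : R) : R :=
  if 0 < c then c `^ (- (weight a b k + #|star (E := E) k|.+1%:R / 2)) * expR (- (d k * c))
  else 0.

Definition link_factor k j (c z : R) : R := expR (- (d j * z ^+ 2 / c)).

Definition loops : seq 'I_N := [seq e <- enum 'I_N | hi e == lo e].
Definition links : seq 'I_N := [seq e <- enum 'I_N | hi e != lo e].

Definition prod_density s : R :=
  (\prod_(e <- loops) loop_factor (hi e) (tnth s e)) *
  \prod_(e <- links) link_factor (hi e) (lo e) (T s (hi e) (hi e)) (tnth s e).

Lemma loopP k : exists2 e, e \in loops & hi e = k /\ lo e = k.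
Proof.
have [e he] := ends_surj PT EP (tree_refl PT k).
exists e; last by rewrite /hi /lo he.
by rewrite mem_filter /hi /lo he /= eqxx mem_enum.
Qed.

Lemma big_loops (M : Type) (idx : M) (op : Monoid.com_law idx) (F : 'I_N -> M) :
  \big[op/idx]_(e <- loops) F e = \big[op/idx]_(e | hi e == lo e) F e.
Proof. by rewrite big_filter big_enum_cond. Qed.

Lemma big_links (M : Type) (idx : M) (op : Monoid.com_law idx) (F : 'I_N -> M) :
  \big[op/idx]_(e <- links) F e = \big[op/idx]_(e | hi e != lo e) F e.
Proof. by rewrite big_filter big_enum_cond. Qed.

Lemma loop_factor_ge0 k c : 0 <= loop_factor k c.
Proof. by rewrite /loop_factor; case: ifP => // _; rewrite mulr_ge0 ?powR_ge0 ?expR_ge0. Qed.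

Lemma measurable_loop_factor k : measurable_fun setT (loop_factor k).
Proof.
apply: measurable_fun_ifT => //; first exact: measurable_fun_ltr.
apply: measurable_funM; first exact: measurable_powR.
by apply: measurableT_comp => //; apply: measurableT_comp => //; exact: measurable_funM.
Qed.

Lemma measurable_prod_density : measurable_fun setT prod_density.
Proof.
apply: measurable_funM; apply: measurable_prod => e _.
  exact: (measurableT_comp (measurable_loop_factor _) (measurable_tnth e)).
apply: measurableT_comp => //; apply: measurableT_comp => //.
apply: measurable_funM.
  apply: measurable_funM; first exact: measurable_cst.
  by apply: measurable_funX; exact: measurable_tnth.
exact: (measurableT_comp measurable_inv (measurable_lower_part PT EP _ _)).
Qed.

Lemma prod_density_ge0 s : 0 <= prod_density s.
Proof.
rewrite mulr_ge0//; apply: prodr_ge0 => e _; last exact: expR_ge0.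
exact: loop_factor_ge0.
Qed.

(** With nonzero diagonal, the matrix is in the cone exactly when the diagonal of [T] is positive;
    otherwise some loop factor vanishes and both sides are 0. *)
Lemma density_shear s : all (fun e => tnth s e != 0) loops ->
  density_on_PG a b x
    (ZG_mx (shear (@gram_shift R r E P) (shear (mul_shift (P := P) L) s))) =
  (prod_density s)%:E.
Proof.
move=> /allP s0.
have T0 k : T s k k != 0.
  have [e el [h1 h2]] := loopP k.
  by rewrite -{1}h1 -h2 (lower_part_ends EP) s0.
have TL := lower_part_shear_mul PT EP s uL.
have lT : lower P (T s) by exact: lower_part_lower.
have TLk k : (T s *m L) k k = T s k k by rewrite (lower_mul_diag PT k lT uL.1) uL.2 mulr1.
rewrite (ZG_mx_shear_gram PT EP)//; last by move=> k; rewrite TL TLk.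
rewrite TL /density_on_PG.
have PGE : `[< PG E (gram (T s *m L)) >] = [forall k, 0 < T s k k].
  have lTL := lower_mul PT lT uL.1.
  have TL0 k : (T s *m L) k k != 0 by rewrite TLk.
  apply/asboolP/forallP => [[_ /(posdef_gram PT lTL TL0) h] k|h].
    by have := h k; rewrite TLk.
  split; last by apply/(posdef_gram PT lTL TL0) => k; rewrite TLk.
  have : PG E (ZG_mx (shear (@gram_shift R r E P) (shear (mul_shift (P := P) L) s))).
    apply/(PG_ZG_mx E_sym); rewrite (ZG_mx_shear_gram PT EP)// TL; last by move=> k; rewrite TLk.
    by apply/(posdef_gram PT lTL TL0) => k; rewrite TLk.
  by rewrite (ZG_mx_shear_gram PT EP)// TL; [case|move=> k; rewrite TLk].
rewrite {}PGE; case: ifPn => [/forallP Tp|].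
  rewrite (density_gram E_refl E_sym E_hom a b red lT Tp); congr EFin.
  rewrite /prod_density big_loops big_links.
  under [X in _ = X * _]eq_bigr => e _ do rewrite -(lower_part_ends EP).
  under [X in _ = _ * X]eq_bigr => e _ do rewrite -(lower_part_ends EP).
  rewrite (eq_bigr (fun e => loop_factor (hi e) (T s (hi e) (hi e)))); last first.
    by move=> e /eqP <-.
  rewrite (prod_loops PT EP _ (fun k => loop_factor k (T s k k))).
  rewrite (prod_edges PT EP _ (fun k j => k != j) (fun k j => link_factor k j (T s k k) (T s k j))).
  rewrite -big_split/=; apply: eq_bigr => k _.
  rewrite /loop_factor Tp -mulrA; congr (_ * _).
  rewrite (bigD1 k)/=; last exact: (tree_refl PT).
  congr (_ * _); first by rewrite expr2 mulrA mulfK.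
  by apply: eq_bigl => j; rewrite eq_sym.
rewrite negb_forall => /existsP[k nk]; congr EFin.
have [e el [h1 h2]] := loopP k.
rewrite /prod_density (big_rem e)//= {1}/loop_factor.
by rewrite -(lower_part_ends EP) h1 h2 (negbTE nk) !mul0r.
Qed.

End product_formula.

(** * Reduction to one integral per vertex *)

Section total_product.
Context {R : realType} {r : nat} {E : rel 'I_r}.
Hypothesis E_refl : reflexive E.
Hypothesis E_sym : symmetric E.
Hypothesis E_hom : homogeneous E.
Implicit Types (i j k : 'I_r).
Local Notation mu := (@lebesgue_measure R).
Local Notation P := (@anc_rel r E).
Let PT : tree_order P (@rank r E) := anc_tree E_refl E_sym E_hom.
Let EP : forall i j, E i j = P i j || P j i := adj_anc E_sym.
Local Notation N := #|{: upper_edge E}|.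
Implicit Types (s t : N.-tuple R) (e : 'I_N).
Local Notation hi := (hi (E := E) (P := P)).
Local Notation lo := (lo (E := E) (P := P)).
Local Notation T s := (lower_part (P := P) s).

Context (a : clique E -> R) (b : minsep E -> R) (x : edge E -> R).
Context (L : 'M[R]_r) (d : 'I_r -> R).
Hypothesis red : reduces P L (fill x) d.

Let uL : unitlower P L. Proof. by have [] := red. Qed.
Let dp k : 0 < d k. Proof. by have [] := red. Qed.

Local Notation loop_factor := (loop_factor a b d).
Local Notation link_factor := (link_factor d).
Local Notation prod_density := (prod_density a b d).

Definition vertex_factor k (c : R) : R :=
  loop_factor k c * \prod_(j | P j k && (k != j)) Num.sqrt (pi * c / d j).

Lemma vertex_factor_ge0 k c : 0 <= vertex_factor k c.
Proof. by rewrite mulr_ge0 ?loop_factor_ge0// prodr_ge0// => j _; exact: sqrtr_ge0. Qed.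

Lemma mem_loops e : (e \in loops) = (hi e == lo e).
Proof. by rewrite mem_filter mem_enum andbT. Qed.

Lemma mem_links e : (e \in links) = (hi e != lo e).
Proof. by rewrite mem_filter mem_enum andbT. Qed.

Lemma lower_part_diag k : exists e, [/\ e \in loops, hi e = k & forall t, T t k k = tnth t e].
Proof.
have [e el [h1 h2]] := loopP E_refl E_sym E_hom k.
by exists e; split=> // t; rewrite -{1}h1 -h2 (lower_part_ends EP).
Qed.

Lemma iint_links s : iint links (EFin \o prod_density) s =
  (\prod_(e <- loops) vertex_factor (hi e) (tnth s e))%:E.
Proof.
pose G u : \bar R := (\prod_(e <- loops) loop_factor (hi e) (tnth u e))%:E.
pose h e z (u : N.-tuple R) : \bar R := (link_factor (hi e) (lo e) (T u (hi e) (hi e)) z)%:E.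
have split_prod u : (EFin \o prod_density) u = (G u * \prod_(e <- links) h e (tnth u e) u)%E.
  by rewrite /G /h prodEFin -EFinM.
rewrite (eq_iintr _ split_prod) iint_prod.
- have [/forallP Tp|] := boolP [forall k, 0 < T s k k].
    have hE e : (\int[mu]_z h e z s)%E = (Num.sqrt (pi * T s (hi e) (hi e) / d (lo e)))%:E.
      exact: integral_gauss_scaled.
    rewrite (eq_bigr _ (fun e _ => hE e)).
    rewrite prodEFin /G -EFinM; congr EFin.
    rewrite /vertex_factor big_split/=; congr (_ * _).
    rewrite big_links big_loops.
    rewrite (prod_edges PT EP _ (fun k j => k != j) (fun k j => Num.sqrt (pi * T s k k / d j))).
    rewrite -(prod_loops PT EP _ (fun k => \prod_(j | P j k && (k != j)) Num.sqrt (pi * T s k k / d j))).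
    apply: eq_bigr => e /eqP le; apply: eq_bigr => j _.
    by rewrite -(lower_part_ends EP) -le.
  (* The Gaussian integrals may be infinite here, but a loop factor is 0 and [0 * +oo = 0]. *)
  rewrite negb_forall => /existsP[k nk].
  have [e [el hk he]] := lower_part_diag k.
  have d0 : loop_factor (hi e) (tnth s e) = 0.
    by rewrite /loop_factor hk -he (negbTE nk).
  rewrite /G (big_rem e)//= d0 mul0r mul0e.
  by rewrite (big_rem e)//= /vertex_factor d0 !mul0r.
- exact: filter_uniq (enum_uniq _).
- by move=> e z u; rewrite lee_fin expR_ge0.
- move=> u; rewrite lee_fin; apply: prodr_ge0 => e _; exact: loop_factor_ge0.
- move=> e u; apply/measurable_EFinP; apply: measurableT_comp => //; apply: measurableT_comp => //.
  by apply: measurable_funM => //; apply: measurable_funM => //; exact: measurable_funX.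
- move=> e z u u' uu'; rewrite /h; have [f [fl _ hf]] := lower_part_diag (hi e).
  by rewrite !hf uu'// mem_links; move: fl; rewrite mem_loops negbK.
- move=> u u' uu'; rewrite /G; congr EFin; apply: eq_big_seq => e.
  by rewrite mem_loops => le; rewrite uu'// mem_links negbK.
Qed.

Lemma total_product :
  total_mass a b x = (\prod_k \int[mu]_c (vertex_factor k c)%:E)%E.
Proof.
rewrite total_massE (integral_ZG_mx PT EP [tuple 0 | _ < _] uL (measurable_density_on_PG E_sym a b x)); last first.
  exact: density_on_PG_ge0.
set G := fun s => _.
have G0 s : (0 <= G s)%E by exact: density_on_PG_ge0.
have mG : measurable_fun setT G.
  apply: (measurableT_comp (measurable_density_on_PG E_sym a b x)).
  apply: (measurableT_comp (measurable_shear (measurable_gram_shift PT EP))).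
  exact: measurable_shear (measurable_mul_shift PT EP L).
have mP : measurable_fun setT (EFin \o prod_density).
  by apply/measurable_EFinP; exact: measurable_prod_density.
have P0 s : (0 <= (EFin \o prod_density) s)%E by rewrite lee_fin prod_density_ge0.
(* The two integrands are known to agree only where the diagonal is nonzero, so the restriction is
   imposed, used and lifted. *)
rewrite -(iint_nonzero loops mG G0).
have -> : on_nonzero loops G = on_nonzero loops (EFin \o prod_density).
  apply/funext => s; rewrite /on_nonzero; case: ifP => // s0.
  exact: density_shear.
rewrite (iint_nonzero loops mP P0).
have Q : perm_eq (enum 'I_N) (loops ++ links).
  by rewrite perm_sym; apply/permPl/perm_filterC.
rewrite (iint_perm mP P0 Q) iint_cat.
have E1 s : iint links (EFin \o prod_density) s =
    (1 * \prod_(e <- loops) (vertex_factor (hi e) (tnth s e))%:E)%E.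
  by rewrite iint_links mul1e prodEFin.
rewrite (eq_iintr _ E1) (iint_prod (h := fun e z _ => (vertex_factor (hi e) z)%:E) (G := cst 1%E)).
- rewrite mul1e big_loops.
  by rewrite (prod_loops PT EP _ (fun k => \int[mu]_c (vertex_factor k c)%:E)%E).
- exact: filter_uniq (enum_uniq _).
- by move=> e z u; rewrite lee_fin vertex_factor_ge0.
- by [].
- move=> e u; apply/measurable_EFinP; apply: measurable_funM; first exact: measurable_loop_factor.
  rewrite (_ : (fun c => \prod_(j | _) _) = fun c => \prod_(j <- [seq j <- enum 'I_r | P j (hi e) && (hi e != j)])
      Num.sqrt (pi * c / d j)); last by apply/funext => c; rewrite big_filter big_enum_cond.
  have msqrt : measurable_fun setT (@Num.sqrt R) by exact: continuous_measurable_fun (@sqrt_continuous R).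
  apply: measurable_prod => j _; apply: (measurableT_comp msqrt).
  by apply: measurable_funM => //; exact: measurable_funM.
- by [].
- by [].
Qed.

End total_product.

(** * Gamma values and the convergence criterion *)

Section total_value.
Context {R : realType} {r : nat} {E : rel 'I_r}.
Hypothesis E_refl : reflexive E.
Hypothesis E_sym : symmetric E.
Hypothesis E_hom : homogeneous E.
Implicit Types (i j k : 'I_r).
Local Notation mu := (@lebesgue_measure R).
Local Notation P := (@anc_rel r E).
Let PT : tree_order P (@rank r E) := anc_tree E_refl E_sym E_hom.
Let EP : forall i j, E i j = P i j || P j i := adj_anc E_sym.
Local Notation preds := (@preds r E).
Local Notation succs := (@succs r E).

Context (a : clique E -> R) (b : minsep E -> R) (x : edge E -> R).
Context (L : 'M[R]_r) (d : 'I_r -> R).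
Hypothesis red : reduces P L (fill x) d.

Let dp k : 0 < d k. Proof. by have [] := red. Qed.

Definition gamma_arg k : R := - weight a b k - #|succs k|%:R / 2.

Lemma preds_cond k j : (P j k && (k != j)) = (j \in preds k).
Proof. by rewrite finset.inE. Qed.

(** Each Gaussian over a strict ancestor contributes [c^(1/2)]. As the closed neighbourhood has
    [#|preds k| + #|succs k| + 1] vertices, the ancestors cancel from the exponent and half the
    descendants remain. *)
Lemma vertex_factor_gammaf k (c : R) : vertex_factor a b d k c =
  (\prod_(j in preds k) Num.sqrt (pi / d j)) * gammaf (gamma_arg k) (d k) c.
Proof.
rewrite /vertex_factor /loop_factor /gammaf; case: ifP => c0; last by rewrite mul0r mulr0.
under eq_bigl => j do rewrite preds_cond.
have -> : \prod_(j in preds k) Num.sqrt (pi * c / d j) =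
    (\prod_(j in preds k) Num.sqrt (pi / d j)) * c `^ (#|preds k|%:R / 2).
  rewrite (eq_bigr (fun j => Num.sqrt (pi / d j) * Num.sqrt c)); last first.
    by move=> j _; rewrite -sqrtrM ?divr_ge0 ?pi_ge0 ?ltW//; congr Num.sqrt; ring.
  rewrite big_split/= prodr_const; congr (_ * _).
  by rewrite -powR12_sqrt ?ltW// -powR_mulrn ?powR_ge0// -powRrM mulrC.
rewrite mulrCA; congr (_ * _); rewrite mulrAC -pos_powRD//; congr (_ `^ _ * _).
by rewrite /gamma_arg (card_star E_refl E_sym E_hom) -!natr1 natrD; field.
Qed.

Lemma integral_vertex_factor k : (\int[mu]_c (vertex_factor a b d k c)%:E =
  ((\prod_(j in preds k) Num.sqrt (pi / d j)) * d k `^ (- gamma_arg k))%:E *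
  \int[mu]_c (gammaf (gamma_arg k) 1 c)%:E)%E.
Proof.
transitivity (\int[mu]_c ((\prod_(j in preds k) Num.sqrt (pi / d j)) *
    gammaf (gamma_arg k) (d k) c)%:E)%E.
  by apply: eq_integral => c _; rewrite vertex_factor_gammaf.
rewrite (integral_EFinZ (measurable_gammaf _ _) (gammaf_ge0 _ _)).
  by rewrite integral_gammaf_scale// muleA -EFinM.
by apply: prodr_ge0 => j _; exact: sqrtr_ge0.
Qed.

(** Exchanging the products, [d j] occurs once for each descendant of [j]; this later cancels the
    descendants in [d k ^ (- gamma_arg k)] and leaves the weight. *)
Lemma prod_sqrt_preds : \prod_k \prod_(j in preds k) Num.sqrt (pi / d j) =
  \prod_k (pi `^ (#|preds k|%:R / 2) * d k `^ (- (#|succs k|%:R / 2))).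
Proof.
have E1 j : Num.sqrt (pi / d j) = pi `^ (2^-1) * d j `^ (- 2^-1).
  rewrite sqrtrM ?pi_ge0// -!powR12_sqrt ?pi_ge0 ?invr_ge0 ?ltW//; congr (_ * _).
  by rewrite -powR_inv1 ?ltW// -powRrM mulN1r.
rewrite [RHS]big_split/=.
under eq_bigr => k _ do rewrite (eq_bigr _ (fun j _ => E1 j)) big_split/=.
rewrite big_split/=; congr (_ * _).
  apply: eq_bigr => k _; rewrite prodr_const.
  by rewrite -powR_mulrn ?powR_ge0// -powRrM mulrC.
rewrite (exchange_big_dep xpredT)//=; apply: eq_bigr => j _.
rewrite (eq_bigl (mem (succs j))); last by move=> k; rewrite !finset.inE eq_sym.
by rewrite prodr_const -powR_mulrn ?powR_ge0// -powRrM mulNr mulrC.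
Qed.

Lemma total_mass_value : (forall k, 0 < gamma_arg k) ->
  total_mass a b x =
  (\prod_k (pi `^ (#|preds k|%:R / 2) * d k `^ weight a b k * Gamma (gamma_arg k)))%:E.
Proof.
move=> g0; rewrite (total_product E_refl E_sym E_hom a b red).
rewrite (eq_bigr (fun k => ((\prod_(j in preds k) Num.sqrt (pi / d j)) *
   (d k `^ (- gamma_arg k) * Gamma (gamma_arg k)))%:E)); last first.
  by move=> k _; rewrite integral_vertex_factor GammaE// -EFinM mulrA.
rewrite prodEFin; congr EFin; rewrite big_split/= prod_sqrt_preds -big_split/=.
apply: eq_bigr => k _; rewrite -!mulrA; congr (_ * _); rewrite mulrA -pos_powRD//.
by congr (_ `^ _ * _); rewrite /gamma_arg; ring.
Qed.

Lemma total_mass_infinite k : gamma_arg k <= 0 -> total_mass a b x = +oo%E.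
Proof.
move=> gk; rewrite (total_product E_refl E_sym E_hom a b red).
have c0 j : (0 < ((\prod_(i in preds j) Num.sqrt (pi / d i)) * d j `^ (- gamma_arg j))%:E)%E.
  rewrite lte_fin mulr_gt0 ?powR_gt0//; apply: prodr_gt0 => i _.
  by rewrite sqrtr_gt0 divr_gt0 ?pi_gt0.
have F0 j : (0 < \int[mu]_c (vertex_factor a b d j c)%:E)%E.
  by rewrite integral_vertex_factor mule_gt0// integral_gammaf_gt0.
rewrite (bigD1 k)//= integral_vertex_factor integral_gammafy// gt0_muley// gt0_mulye//.
by apply: (big_ind (fun z : \bar R => 0 < z)%E) => // u v u0 v0; exact: mule_gt0.
Qed.

Lemma gamma_arg_rho u k : u \in classesT E -> k \in u ->
  gamma_arg k = - rho a b u - #|succs k|%:R / 2.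
Proof. by move=> uT ku; rewrite /gamma_arg (rho_weight E_refl E_sym E_hom a b uT ku). Qed.

(** Weights are constant on a class, so the binding vertex is the one with the most descendants. *)
Lemma gamma_arg_gt0 : (forall k, 0 < gamma_arg k) <->
  forall u, u \in classesT E ->
    2^-1 * (\sum_(v in classesT E | preceq E u v) #|v|%:R - 1) < - rho a b u.
Proof.
split=> [h u uT|h k].
  have [k ku E1] := succs_max E_refl E_sym E_hom uT.
  have := h k; rewrite (gamma_arg_rho uT ku) -natr_sum -E1 -natr1; lra.
have ku := mem_arrow_class E_refl k; have uT := arrow_class_mem (E := E) k.
have := h _ uT; rewrite (gamma_arg_rho uT ku) -natr_sum => h1.
have := succs_le E_refl E_sym E_hom uT ku; rewrite -(ler_nat R) -natr1.
lra.
Qed.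

Lemma J_converges_iff : J_converges a b x <-> forall k, 0 < gamma_arg k.
Proof.
split=> [/J_convergesE h k|h]; last by apply/J_convergesE; rewrite total_mass_value ?ltry.
by rewrite ltNge; apply/negP => /total_mass_infinite e; rewrite e ltxx in h.
Qed.

Lemma prod_d_weight : \prod_k d k `^ weight a b k = H_G a b x.
Proof.
rewrite (H_G_weight E_refl E_sym E_hom a b (reduces_block_dets E_refl E_sym E_hom red)).
by rewrite expR_sum; apply: eq_bigr => k _; rewrite /powR gt_eqF.
Qed.

Lemma det_schur u : (fill x)^T = fill x -> u \in classesT E ->
  \det (schur x u) = \prod_(k in u) d k.
Proof.
move=> xs uT; have /classesTP[i ui] := uT.
have UE k : (k \in u) = arrow E i k && arrow E k i by rewrite ui finset.inE.
have DE k : (k \in below E u) = arrow E k i && ~~ arrow E i k.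
  by rewrite ui below_class// finset.inE.
have at_ := arrow_trans E_refl.
apply: (det_schur_reduces PT red xs).
- by move=> k; rewrite UE DE => /andP[-> _]; rewrite andbF.
- move=> j k; rewrite UE DE => /andP[ij ji] /andP[ki ik].
  have kj : arrow E k j by exact: at_ ki ij.
  have jk : ~~ arrow E j k by apply: contra ik; exact: at_ ij.
  by rewrite /anc_rel (arrow_adj E_refl kj) (ltnW (arrow_rank E_refl kj jk)).
- move=> j k; rewrite !UE -EP => /andP[_ ji] /andP[ik _].
  exact: arrow_adj E_refl _ _ (at_ _ _ _ ji ik).
- move=> j k; rewrite !UE DE => /andP[ij ji] kj.
  have ki := at_ _ _ _ (anc_arrow E_refl E_sym E_hom kj) ji.
  by rewrite ki andbT; case: (arrow E i k).
- move=> j k; rewrite !DE => /andP[ji ij] kj.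
  have kj' := anc_arrow E_refl E_sym E_hom kj.
  rewrite (at_ _ _ _ kj' ji); apply: contra ij => ik; exact: at_ ik kj'.
- move=> j k; rewrite !DE -EP => /andP[/(arrowP E_refl) ji _] /andP[ki _].
  by apply: ji; rewrite E_sym (arrow_adj E_refl).
Qed.

Lemma prod_class_value u : u \in classesT E ->
  \prod_(k in u) (pi `^ (#|preds k|%:R / 2) * Gamma (gamma_arg k)) =
  pi `^ (2^-1 * \sum_(v in classesT E | prec E v u) #|u|%:R * #|v|%:R) *
  multi_Gamma #|u|
    (- rho a b u - \sum_(v in classesT E | prec E u v) #|v|%:R / 2).
Proof.
move=> uT; have /classesTP[i ui] := uT.
rewrite big_split/= /multi_Gamma mulrA; congr (_ * _).
  rewrite -mulr_sumr -natr_sum {3}ui (sum_prec_below E_refl) -ui.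
  rewrite -(pos_powRD _ _ (pi_gt0 R)).
  have -> : \prod_(k in u) (pi : R) `^ (#|preds k|%:R / 2) = pi `^ (\sum_(k in u) #|preds k|%:R / 2).
    apply: (big_rec2 (fun p q => p = pi `^ q)); first by rewrite powRr0.
    by move=> k p q _ ->; rewrite pos_powRD ?pi_gt0.
  rewrite -mulr_suml -natr_sum (sum_preds E_refl E_sym E_hom uT); congr powR.
  have e2 : ('C(#|u|, 2) * 2 = #|u| * #|u|.-1)%N by rewrite (bin_ffact _ 2) ffactnS ffactn1.
  have e3 : ('C(#|u|, 2)%:R * 2 = (#|u| * #|u|.-1)%:R :> R) by rewrite -natrM e2.
  by rewrite -e3 natrD natrM; field.
rewrite -[RHS](@big_rank _ E _ _ _ u
  (fun m : nat => Gamma (- rho a b u - \sum_(v in classesT E | prec E u v) #|v|%:R / 2 - m%:R / 2))).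
apply: eq_bigr => k ku; congr Gamma; rewrite (gamma_arg_rho uT ku).
have uk := classesT_eq E_refl uT ku.
rewrite (card_succs E_refl E_sym E_hom) -uk -mulr_suml -natr_sum [in RHS]uk.
by rewrite (sum_prec_above E_refl) -uk natrD; ring.
Qed.

End total_value.

(** A point of [Q_G], so that convergence on all of [Q_G] is not vacuous. *)
Lemma QG_identity (R : realType) r (E : rel 'I_r) : reflexive E ->
  QG (fun e : edge E => ((val e).1 == (val e).2)%:R : R).
Proof.
move=> E_refl; set x := fun e => _.
have fx : fill x = 1%:M.
  apply/matrixP => i j; rewrite mxE [RHS]mxE /extend; case: insubP => [e _ eE|].
    by rewrite /= /x eE.
  by rewrite /=; case: eqVneq => // ->; rewrite E_refl.
split; first by rewrite /IG /= fx trmx1.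
move=> C _; rewrite fx (_ : block C C 1%:M = 1%:M); last first.
  by apply/matrixP => i j; rewrite !mxE (inj_eq enum_val_inj).
split; first exact: trmx1.
move=> v v0; rewrite mulmx1 mxE; have /rV0Pn[k vk] := v0.
rewrite (bigD1 k)//= mxE -expr2; apply: ltr_pwDl; first by rewrite exprn_even_gt0.
by apply: sumr_ge0 => j _; rewrite mxE -expr2 sqr_ge0.
Qed.

Lemma prodr_powR (R : realType) (I : finType) (Q : pred I) (f : I -> R) (c : R) :
  (forall i, 0 <= f i) ->
  (\prod_(i | Q i) f i) `^ c = \prod_(i | Q i) f i `^ c.
Proof.
move=> f0; suff [] : 0 <= \prod_(i | Q i) f i /\
    (\prod_(i | Q i) f i) `^ c = \prod_(i | Q i) f i `^ c by [].
apply: (big_rec2 (fun p q => 0 <= p /\ p `^ c = q)); first by rewrite powR1.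
by move=> i p q _ [p0 <-]; rewrite powRM// mulr_ge0.
Qed.

Theorem theorem3p2 (R : realType) (r : nat) (E : rel 'I_r)
    (r_gt0 : (0 < r)%N) (E_refl : reflexive E) (E_sym : symmetric E)
    (E_hom : homogeneous E) :
  @calB R r E =
    [set ab | forall u, u \in classesT E ->
       2^-1 * (\sum_(v in classesT E | preceq E u v) #|v|%:R - 1)
         < - rho ab.1 ab.2 u] /\
  forall (a : clique E -> R) (b : minsep E -> R), calB (a, b) ->
  forall theta : edge E -> R, QG theta ->
    [/\ J_converges a b theta,
        J_G a b theta =
          \prod_(u in classesT E)
            (pi `^ (2^-1 * \sum_(v in classesT E | prec E v u) #|u|%:R * #|v|%:R) *
             \det (schur theta u) `^ rho a b u *
             multi_Gamma #|u|
               (- rho a b u - \sum_(v in classesT E | prec E u v) #|v|%:R / 2))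
      & J_G a b theta =
          H_G a b theta *
          \prod_(u in classesT E)
            (pi `^ (2^-1 * \sum_(v in classesT E | prec E v u) #|u|%:R * #|v|%:R) *
             multi_Gamma #|u|
               (- rho a b u - \sum_(v in classesT E | prec E u v) #|v|%:R / 2))].
Proof.
pose K (a : clique E -> R) (b : minsep E -> R) : R := \prod_(u in classesT E)
  (pi `^ (2^-1 * \sum_(v in classesT E | prec E v u) #|u|%:R * #|v|%:R) *
   multi_Gamma #|u| (- rho a b u - \sum_(v in classesT E | prec E u v) #|v|%:R / 2)).
have KE a b : K a b = \prod_k (pi `^ (#|@preds r E k|%:R / 2) * Gamma (gamma_arg a b k)).
  rewrite -(prod_classes E_refl); apply: eq_bigr => u uT.
  by rewrite (prod_class_value E_refl E_sym E_hom).
have value a b theta L d : reduces (@anc_rel r E) L (fill theta) d ->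
    (forall k, 0 < gamma_arg a b k) -> J_G a b theta = H_G a b theta * K a b.
  move=> red g0; rewrite J_GE (total_mass_value E_refl E_sym E_hom red g0) /=.
  rewrite -(prod_d_weight E_refl E_sym E_hom a b red) KE -big_split/=.
  by apply: eq_bigr => k _; rewrite mulrCA mulrA.
have conv (a : clique E -> R) (b : minsep E -> R) theta : QG theta ->
    J_converges a b theta <-> forall k, 0 < gamma_arg a b k.
  move=> Qt; have [L [d red]] := QG_reduces E_refl E_sym E_hom Qt.
  exact: (J_converges_iff E_refl E_sym E_hom a b red).
(* Convergence at the identity forces every Gamma argument to be positive; conversely the quotient
   is the constant [K a b]. *)
have calB_gt0 (a : clique E -> R) (b : minsep E -> R) : calB (a, b) <-> forall k, 0 < gamma_arg a b k.
  have Q1 := @QG_identity R r E E_refl.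
  split=> [[/= cv _]|g0]; first by apply/(conv _ _ _ Q1); exact: cv.
  split=> [theta Qt|]; first exact/conv.
  exists (K a b) => theta Qt /=.
  have [L [d red]] := QG_reduces E_refl E_sym E_hom Qt.
  rewrite (value _ _ _ _ _ red g0) mulrAC divff ?mul1r//.
  rewrite (H_G_weight E_refl E_sym E_hom a b (reduces_block_dets E_refl E_sym E_hom red)).
  by rewrite gt_eqF ?expR_gt0.
split.
  apply/seteqP; split=> -[a b] /=.
    by move=> /calB_gt0/(gamma_arg_gt0 E_refl E_sym E_hom).
  by move=> h; apply/calB_gt0/(gamma_arg_gt0 E_refl E_sym E_hom).
move=> a b /calB_gt0 g0 theta Qt.
have [L [d red]] := QG_reduces E_refl E_sym E_hom Qt.
split; [exact/conv| |exact: value red g0].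
rewrite (value _ _ _ _ _ red g0) -(prod_d_weight E_refl E_sym E_hom a b red).
rewrite -(prod_classes E_refl) -big_split/=; apply: eq_bigr => u uT.
rewrite mulrA [_ * (pi `^ _)]mulrC -!mulrA; congr (_ * (_ * _)).
rewrite (det_schur E_refl E_sym E_hom red _ uT); last by case: Qt.
have [_ dp _ _] := red.
rewrite prodr_powR => [|k]; last by rewrite ltW.
by apply: eq_bigr => k ku; rewrite (rho_weight E_refl E_sym E_hom a b uT ku).
Qed.
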